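(* Fix $q\in[0,1)$ and let $Y_q=\mathrm{RW}(\mathcal{X}_q)$ be the redwood tree of a two-sided infinite Mallows permutation $\mathcal{X}_q$ with parameter $q$. For $k\in\mathbb{Z}$ let $Y_q(k)=Y_q\cap 1^k0\mathbb{T}$. Then the sizes $(|Y_q(k)|)_{k\in\mathbb{Z}}$ are independent, with $|Y_q(k)|\sim\mathrm{Geom}_0(1-q)$ for $k\neq0$ and $|Y_q(0)|\sim\mathrm{SBGeom}(1-q)$; moreover, conditionally on the sizes, the trees $(Y_q(k))_{k\in\mathbb{Z}}$ are independent and for every $n\ge0$ and every binary tree $t\subseteq\mathbb{T}$ with $|t|=n$, $$\mathbb{P}\big(Y_q(k)=1^k0t\ \big|\ |Y_q(k)|=n\big)=\mathbb{P}\big(\mathrm{BST}(\Pi_n)=t\big),$$ where $\Pi_n$ is $\pi_{n,q}$-distributed. Conversely, these properties fully characterize the distribution of $Y_q$.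
   Context: Geometric laws: $G\sim\mathrm{Geom}_0(p)$ means $\mathbb{P}(G=k)=(1-p)^kp$ for $k\ge0$; $G\sim\mathrm{SBGeom}(p)$ means $\mathbb{P}(G=k)=(k+1)(1-p)^kp^2$ for $k\ge0$. Mallows distribution: $\pi_{n,q}(\sigma)=q^{\mathrm{Inv}(\sigma)}/Z_{n,q}$ on $S_n$, $\mathrm{Inv}(\sigma)=|\{i<j:\sigma(i)>\sigma(j)\}|$, $0^0=1$. A Mallows permutation on $\mathbb{N}$ with parameter $q$ is $(I_1,I_2,\dots)$ where, for independent Bernoulli$(1-q)$ variables $(B_{i,j})_{i,j\ge1}$, $I_i=\min\{j\notin\{I_1,\dots,I_{i-1}\}:B_{i,j}=1\}$. Binary trees: $\mathbb{T}$ is the set of finite words over $\{0,1\}$ with empty word $\varnothing$; $aS=\{aw:w\in S\}$. For a finite sequence $x=(x_1,\dots,x_n)$ of distinct numbers, $\mathrm{BST}(x)=\emptyset$ if $n=0$, else $\mathrm{BST}(x)=\{\varnothing\}\cup0\,\mathrm{BST}(x_-)\cup1\,\mathrm{BST}(x_+)$, with $x_-$ (resp. $x_+$) the subsequence of entries smaller (resp. larger) than $x_1$ in original order; $\mathrm{BST}(\sigma)=\mathrm{BST}(\sigma(1),\dots,\sigma(n))$. A binary tree is a prefix-closed subset of $\mathbb{T}$. Extended words: add a letter $\Upsilon$ with convention $1^k=1\cdots1$ ($k$ letters) for $k>0$, $1^0=\varnothing$, $1^k=\Upsilon^{|k|}$ for $k<0$. Redwood tree: an injective $\sigma:\mathbb{Z}\to\mathbb{Z}$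 is admissible if $|\{i\in\mathbb{N}:\sigma(i)\notin\mathbb{N}\}|+|\{i\in\mathbb{Z}\setminus\mathbb{N}:\sigma(i)\in\mathbb{N}\}|<\infty$. A record index is $r$ with $\sigma(r)>\sigma(k)$ for all $k<r$; the standard record representation is the increasing enumeration $(r_k)_{k\in\mathbb{Z}}$ of all record indices with $\sigma(r_0)\le0<\sigma(r_1)$. $\sigma[k]$ is the sequence of values $\sigma(i)$ with $\sigma(r_k)<\sigma(i)<\sigma(r_{k+1})$ in increasing order of $i$. $\mathrm{RW}(\sigma)=\bigcup_{k\in\mathbb{Z}}(\{1^k\}\cup1^k0\,\mathrm{BST}(\sigma[k]))$. Two-sided Mallows permutation: $\Pi_+,\Pi_-$ independent Mallows permutations on $\mathbb{N}$; $(M_i)_{i\ge1}$ independent, $\mathbb{P}(M_i=m)=q^{im}(1-q^i)$; $\Lambda_1\ge\Lambda_2\ge\dots\ge0$ with $|\{j:\Lambda_j=i\}|=M_i$ for $i\ge1$; $\ell_i=i-\Lambda_i$; $k_0>k_{-1}>\dots$ enumerate $\mathbb{Z}\setminus\{\ell_i\}$; $\mathcal{X}_q(\ell_i)=\Pi_+(i)$, $\mathcal{X}_q(k_i)=1-\Pi_-(1-i)$ ($i\le0$). It is a.s. admissible. *)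

(* Defs.v *)
From HB Require Import structures.
From mathcomp Require Import all_boot all_order all_algebra perm.
From mathcomp Require Import all_classical all_reals all_analysis.
From Stdlib Require Import ClassicalEpsilon.
Set Implicit Arguments. Unset Strict Implicit. Unset Printing Implicit Defensive.
Import Order.TTheory GRing.Theory Num.Theory.
Local Open Scope classical_set_scope.
Local Open Scope ring_scope.

(* Definite description: the unique x with P x, or x0 if there is no  *)
(* unique such x (only used on null events).                            *)
Definition the_or {A : Type} (x0 : A) (P : A -> Prop) : A :=
  match pselect (exists! x, P x) with
  | left _ => epsilon (inhabits x0) P
  | right _ => x0
  end.

Definition set_size {T : eqType} (S : set T) (n : nat) : Prop :=
  exists s : seq T, [/\ uniq s, size s = n & S = [set x | x \in s]].

Definition geom0 {R : realType} (p : R) (k : nat) : R := (1 - p) ^+ k * p.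
Definition sbgeom {R : realType} (p : R) (k : nat) : R :=
  (k.+1)%:R * (1 - p) ^+ k * p ^+ 2.

(* Words.  The binary tree T = seq bool (false = letter 0, true = 1).  *)
(* Extended words: letters option bool, Some false = 0, Some true = 1, *)
(* None = Upsilon.                                                      *)
Definition word := seq (option bool).
Definition emb (w : seq bool) : word := map Some w.

Definition onepow (k : int) : word :=
  match k with
  | Posz n => nseq n (Some true)
  | Negz n => nseq n.+1 None
  end.

Definition prefixS (a : word) (S : set (seq bool)) : set word :=
  [set a ++ emb w | w in S].

Definition subtree_dom (k : int) : set word :=
  prefixS (rcons (onepow k) (Some false)) setT.

Definition binary_tree (t : set (seq bool)) : Prop :=
  forall u v : seq bool, t (u ++ v) -> t u.

Fixpoint bst_fuel (n : nat) (x : seq int) : set (seq bool) :=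
  match n, x with
  | 0%N, _ => set0
  | n.+1, [::] => set0
  | n.+1, a :: r =>
      [set [::]]
        `|` [set false :: w | w in bst_fuel n [seq y <- r | y < a]]
        `|` [set true :: w | w in bst_fuel n [seq y <- r | a < y]]
  end.
Definition BST (x : seq int) : set (seq bool) := bst_fuel (size x) x.

Definition Inv (n : nat) (s : 'S_n) : nat :=
  #|[set ij : 'I_n * 'I_n | (ij.1 < ij.2)%N && (s ij.2 < s ij.1)%N]|.
Definition perm_values (n : nat) (s : 'S_n) : seq int :=
  [seq ((s i : nat).+1)%:Z | i <- enum 'I_n].
Definition Zmallows {R : realType} (q : R) (n : nat) : R :=
  \sum_(s : 'S_n) q ^+ Inv s.
Definition mallows {R : realType} (q : R) (n : nat) (s : 'S_n) : R :=
  q ^+ Inv s / Zmallows q n.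
Definition prob_bst {R : realType} (q : R) (n : nat) (t : set (seq bool)) : R :=
  \sum_(s : 'S_n) (if `[< BST (perm_values s) = t >] then mallows q s else 0).

(* Mallows permutation on N = {1,2,...} from Bernoulli array B:        *)
(* I_i = min{ j >= 1, j notin {I_1..I_{i-1}} : B i j }  (0 if none).   *)
Definition mnext (B : nat -> nat -> bool) (i : nat) (s : seq nat) : nat :=
  match pselect (exists j, [&& (0 < j)%N, j \notin s & B i j]) with
  | left h => ex_minn h
  | right _ => 0%N
  end.
Fixpoint mseq (B : nat -> nat -> bool) (n : nat) : seq nat :=
  match n with
  | 0%N => [::]
  | n.+1 => rcons (mseq B n) (mnext B n.+1 (mseq B n))
  end.
Definition mallowsN (B : nat -> nat -> bool) (i : nat) : nat := last 0%N (mseq B i).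

Definition Lambda (M : nat -> nat) : nat -> nat :=
  the_or (fun _ => 0%N) (fun L : nat -> nat =>
    L 0%N = 0%N (* index 0 unused; fixed for uniqueness *) /\
    (forall j, (1 <= j)%N -> (L j.+1 <= L j)%N) /\
    (forall i, (1 <= i)%N -> set_size [set j | (1 <= j)%N /\ L j = i] (M i))).
Definition ell (M : nat -> nat) (i : nat) : int := i%:Z - (Lambda M i)%:Z.
Definition kenum (M : nat -> nat) : int -> int :=
  the_or (fun _ => 0) (fun k : int -> int =>
    (forall i : int, 0 < i -> k i = 0) (* indices > 0 unused *) /\
    (forall i j : int, i < j <= 0 -> k i < k j) /\
    (forall z : int, (forall i, (1 <= i)%N -> ell M i <> z) <->
                     (exists i : int, i <= 0 /\ k i = z))).
Definition two_sided_mallows (Pip Pim : nat -> nat) (M : nat -> nat) : int -> int :=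
  the_or (fun _ => 0) (fun X : int -> int =>
    (forall i, (1 <= i)%N -> X (ell M i) = (Pip i)%:Z) /\
    (forall i : int, i <= 0 -> X (kenum M i) = 1 - (Pim `|1 - i|%N)%:Z)).

Definition is_record (sigma : int -> int) (r : int) : Prop :=
  forall k, k < r -> sigma k < sigma r.
Definition records (sigma : int -> int) : int -> int :=
  the_or (fun _ => 0) (fun r : int -> int =>
    [/\ (forall i j : int, i < j -> r i < r j),
        (forall z, is_record sigma z <-> exists k, r k = z) &
        sigma (r 0) <= 0 < sigma (r 1)]).
Definition sigma_block (sigma : int -> int) (k : int) : seq int :=
  let r := records sigma in
  the_or [::] (fun s : seq int => exists idx : seq int,
    [/\ sorted (fun a b : int => a < b) idx,
        (forall i, i \in idx <-> (sigma (r k) < sigma i < sigma (r (k + 1)))) &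
        s = map sigma idx]).
Definition RW (sigma : int -> int) : set word :=
  \bigcup_(k in [set: int])
     ([set onepow k] `|` prefixS (rcons (onepow k) (Some false)) (BST (sigma_block sigma k))).

Definition Ycomp (Y : set word) (k : int) : set word := Y `&` subtree_dom k.

Definition size_law {R : realType} (q : R) (k : int) (n : nat) : R :=
  if k == 0 then sbgeom (1 - q) n else geom0 (1 - q) n.

Section Laws.
Context {R : realType} {d : measure_display} {Omega : measurableType d}.

Definition redwood_size_law (q : R) (P : probability Omega R)
    (Y : Omega -> set word) : Prop :=
  forall (K : seq int) (n : int -> nat), uniq K ->
    P [set w | forall k, k \in K -> set_size (Ycomp (Y w) k) (n k)] =
    (\prod_(k <- K) size_law q k (n k))%:E.

(* conditionally on the sizes, the Y(k) are independent and
   P(Y(k) = 1^k0t | |Y(k)| = n) = P(BST(Pi_n) = t)  (stated in multiplied-out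
   form, so that it is meaningful also for null conditioning events) *)
Definition redwood_tree_law (q : R) (P : probability Omega R)
    (Y : Omega -> set word) : Prop :=
  forall (K : seq int) (n : int -> nat) (t : int -> set (seq bool)), uniq K ->
    (forall k, k \in K -> binary_tree (t k) /\ set_size (t k) (n k)) ->
    P [set w | forall k, k \in K ->
                 Ycomp (Y w) k = prefixS (rcons (onepow k) (Some false)) (t k)] =
    (P [set w | forall k, k \in K -> set_size (Ycomp (Y w) k) (n k)] *
     (\prod_(k <- K) prob_bst q (n k) (t k))%:E)%E.
End Laws.

(* Law of the inputs: (B^+_{ij}), (B^-_{ij}) i.i.d. Bernoulli(1-q),
   M_i with P(M_i = m) = q^{im}(1 - q^i), all independent
   (product rule on every finite box of coordinates). *)
Definition bern {R : realType} (q : R) (b : bool) : R := if b then 1 - q else q.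

Definition input_law {R : realType} {d : measure_display} {Omega : measurableType d}
    (q : R) (P : probability Omega R)
    (Bp Bm : Omega -> nat -> nat -> bool) (M : Omega -> nat -> nat) : Prop :=
  forall (N : nat) (bp bm : nat -> nat -> bool) (m : nat -> nat),
    P [set w | (forall i j, (0 < i <= N)%N -> (0 < j <= N)%N ->
                   Bp w i j = bp i j /\ Bm w i j = bm i j) /\
               (forall i, (0 < i <= N)%N -> M w i = m i)] =
    ((\prod_(1 <= i < N.+1) \prod_(1 <= j < N.+1) (bern q (bp i j) * bern q (bm i j)))
     * \prod_(1 <= i < N.+1) (q ^+ (i * m i) * (1 - q ^+ i)))%:E.

Definition Yq (Bp Bm : nat -> nat -> bool) (M : nat -> nat) : set word :=
  RW (two_sided_mallows (mallowsN Bp) (mallowsN Bm) M).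

(* Main.v *)
Require Import Defs.
From HB Require Import structures.
From mathcomp Require Import all_boot all_order all_algebra perm.
From mathcomp Require Import all_classical all_reals all_analysis.
From mathcomp Require Import zify ring.
Set Implicit Arguments. Unset Strict Implicit. Unset Printing Implicit Defensive.
Import Order.TTheory GRing.Theory Num.Theory.
Import numFieldNormedType.Exports.
Local Open Scope classical_set_scope.
Local Open Scope ring_scope.

(* Proof idea.  Fix a finite interval of values and record the order in which    *)
(* the two-sided permutation X visits it.  The inputs restricted to this interval *)
(* are encoded by a finite word over the clipped values, and the probability of   *)
(* the word is q to the number of its inversions, times a constant: inversions    *)
(* inside Pi_+, inside Pi_-, and cells of the Young diagram Lambda add up to the   *)
(* inversions of the word.  Permuting the letters of the interval changes the     *)
(* number of inversions only through the induced pattern, hence that pattern is   *)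
(* Mallows distributed.  The record values above a record are read off the first  *)
(* letters of the successive restrictions of the pattern, and the Mallows law     *)
(* splits at its first letter: the rank of that letter is a truncated geometric   *)
(* variable, and the smaller and larger entries are independent Mallows           *)
(* sequences.  Letting the interval grow upwards, the record values form a         *)
(* Bernoulli(1 - q) process with independent Mallows patterns in the gaps; the gap *)
(* that contains the origin is size-biased because it can start at any of n + 1    *)
(* positions.                                                                      *)

(** * Inversions of integer sequences and Mallows weights *)

(** Everything follows from one exchange property, [evE_law]: the probability that X visits a window
    of consecutive values in the order [x] is q^(linv x) times the probability that it visits them
    increasingly, so the order of visits is Mallows distributed ([arrQ_law]).

    To see this, code the outcome by a finite word [f]. The Bernoulli trials that fail are exactly
    the inversions inside each one-sided sequence ([asg_false]), the M_i contribute q to the size of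
    the partition, and these exponents add up to [linv f] ([linv_word]); hence the inputs agree with
    [f] with probability q^(linv f) times a constant ([cons_prob], [consinf_prob]). Permuting the
    letters of the window does not change how they compare with the other letters ([linv_relabel]),
    so summing over all words with a given pattern gives the exchange property on words
    ([sum_relabel]). As the length grows, words describe almost every outcome ([word_exists],
    [prob_evt_cvg]).

    Record values are the values that precede all larger ones in position ([aval_fst], [fst_aval],
    [aval_next]). Consecutive record values and the gaps above a value c are therefore determined by
    the order of visits above c. In a finite window the Mallows law splits at its first letter: n
    smaller values give the weight q^n over a q-integer, and the smaller and the larger values are
    independent Mallows arrangements ([wsum_shuffle], [wexp_chain_cons]). As the window grows
    upwards the q-integer tends to 1/(1 - q), so gaps become independent geometric variables
    ([evH_law]).

    Requiring a given value to be a record costs one more factor 1 - q ([steps_start]). If the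
    central gap has size n, the last record value at most 0 is -e with e in {0, ..., n}; these n + 1
    cases are disjoint and equally likely, whence the size bias ([steps_centered], [evB_range_law]).
    Summing out blocks gives every finite set of indices ([evB_law]). For the converse, a finite set
    of words sees only finitely many components, and families of finite trees are countable, so the
    two laws determine every such observation ([converse_law]). *)

Definition nlt (x : int) (s : seq int) : nat := count (fun y : int => y < x) s.
Arguments nlt : simpl never.

Fixpoint linv (s : seq int) : nat :=
  if s is x :: s' then (nlt x s' + linv s')%N else 0%N.

Lemma nlt_cons x y s : nlt x (y :: s) = ((y < x)%R + nlt x s)%N.
Proof. by []. Qed.

Lemma nlt_cat x s t : nlt x (s ++ t) = (nlt x s + nlt x t)%N.
Proof. exact: count_cat. Qed.

(* Replaces the i-th entry of x by the i-th entry of x', and fixes all other integers. *)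
Definition relab (x x' : seq int) (v : int) : int := nth v x' (index v x).

Definition window (a : int) (n : nat) : seq int := [seq a + i%:Z | i <- iota 0 n].

Definition int_convex (J : pred int) := forall x y z, J x -> J y -> x < z < y -> J z.

Lemma convex_ltl (J : pred int) x y z : int_convex J -> J x -> J y -> ~~ J z ->
  (z < x) = (z < y).
Proof.
move=> cJ Jx Jy nJz; apply/idP/idP => h; case: (ltgtP z y) (h) => //.
- by move=> yz _; rewrite (cJ _ _ _ Jy Jx) ?yz in nJz.
- by move=> zy; rewrite zy Jy in nJz.
- by move=> _ _; case: (ltgtP z x) => // [xz|zx]; [rewrite (cJ _ _ _ Jx Jy) ?xz in nJz|rewrite zx Jx in nJz].
Qed.

Lemma convex_ltr (J : pred int) x y z : int_convex J -> J x -> J y -> ~~ J z ->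
  (x < z) = (y < z).
Proof.
move=> cJ Jx Jy nJz; have xz : x != z by apply: contraNneq nJz => <-.
have yz : y != z by apply: contraNneq nJz => <-.
by have := convex_ltl cJ Jx Jy nJz; rewrite (ltNge z) (ltNge z) !le_eqVlt (negbTE xz) (negbTE yz) /= => /negb_inj.
Qed.

(** By convexity a value outside [J] compares in the same way with all elements of [J], so only
    pairs with both letters in [J] can change. The additive form avoids subtraction in [nat]. *)
Lemma linv_relabel (J : pred int) (rho : int -> int) (s : seq int) :
  int_convex J -> (forall x, J (rho x) = J x) -> (forall x, ~~ J x -> rho x = x) ->
  (linv (map rho s) + linv (seq.filter J s) = linv s + linv (map rho (seq.filter J s)))%N.
Proof.
move=> cJ Jrho rhoN; elim: s => //= x s IH; case: ifPn => Jx /=.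
  suff: (nlt (rho x) (map rho s) + nlt x (seq.filter J s)
     = nlt x s + nlt (rho x) (map rho (seq.filter J s)))%N by lia.
  elim: s {IH} => //= y s IH; case: ifPn => Jy /=; rewrite !nlt_cons; first by lia.
  have -> : (rho y < rho x) = (y < x).
    by rewrite (rhoN _ Jy); apply: convex_ltl Jy; rewrite ?Jrho.
  by lia.
rewrite (rhoN _ Jx); suff -> : nlt x (map rho s) = nlt x s by lia.
rewrite /nlt count_map; apply: eq_count => y /=; case: (boolP (J y)) => Jy; last by rewrite rhoN.
by apply: convex_ltr Jx; rewrite ?Jrho.
Qed.

Section Relab.
Variables (x x' : seq int).
Hypotheses (ux : uniq x) (pxx : perm_eq x' x).

Lemma relab_out v : v \notin x -> relab x x' v = v.
Proof.
by move=> vx; rewrite /relab nth_default // (perm_size pxx) memNindex.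
Qed.

Lemma relab_in v : (relab x x' v \in x) = (v \in x).
Proof.
case: (boolP (v \in x)) => vx; last by rewrite relab_out ?(negbTE vx).
by rewrite -(perm_mem pxx) /relab mem_nth // (perm_size pxx) index_mem.
Qed.

Lemma map_relab : map (relab x x') x = x'.
Proof.
apply: (@eq_from_nth _ 0); first by rewrite size_map (perm_size pxx).
move=> i; rewrite size_map => ix; rewrite (nth_map 0) // /relab index_uniq //.
by apply: set_nth_default; rewrite (perm_size pxx).
Qed.
End Relab.

Lemma relabK (x x' : seq int) : uniq x -> perm_eq x' x ->
  cancel (relab x x') (relab x' x).
Proof.
move=> ux pxx v; have ux' : uniq x' by rewrite (perm_uniq pxx).
have pxx' : perm_eq x x' by rewrite perm_sym.
case: (boolP (v \in x)) => vx; last first.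
  by rewrite (relab_out pxx vx) (relab_out pxx') // (perm_mem pxx).
have ix : (index v x < size x)%N by rewrite index_mem.
rewrite /relab index_uniq //; last by rewrite (perm_size pxx).
by rewrite (set_nth_default v) // nth_index.
Qed.

Lemma filter_map_relab (x x' s : seq int) : uniq x -> perm_eq x' x ->
  seq.filter (mem x) s = x -> seq.filter (mem x) (map (relab x x') s) = x'.
Proof.
move=> ux pxx fs; rewrite filter_map (eq_filter (a2 := mem x)) ?fs ?map_relab //.
exact: (relab_in pxx).
Qed.

Lemma perm_map_relab (x x' b : seq int) : uniq x -> perm_eq x' x ->
  perm_eq (seq.filter (mem x) b) x -> perm_eq (map (relab x x') b) b.
Proof.
move=> ux pxx pb.
have e0 : perm_eq b (seq.filter (mem x) b ++ seq.filter (predC (mem x)) b).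
  by rewrite perm_sym perm_filterC.
rewrite (perm_trans (perm_map _ e0)) // perm_sym (perm_trans e0) // map_cat.
apply: perm_cat; last first.
  rewrite map_id_in // => y; rewrite mem_filter => /andP[/= yx _].
  by rewrite relab_out.
rewrite (perm_trans pb) // perm_sym (perm_trans (perm_map _ pb)) // map_relab //.
Qed.

(** The map [relab x x'] is a bijection from the words with the increasing pattern [x] to those with
    pattern [x'], and it raises the inversion number by [linv x']. Letters outside [x] may repeat in
    [b], as they do in clipped words. *)
Lemma sum_relabel (R : realType) (q : R) (b x x' : seq int) (g : seq int -> R) :
  uniq x -> perm_eq x' x -> int_convex (mem x) -> linv x = 0%N ->
  perm_eq (seq.filter (mem x) b) x ->
  (forall f, g (map (relab x x') f) = g f) ->
  \sum_(f <- permutations b | seq.filter (mem x) f == x') g f * q ^+ linv f =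
  q ^+ linv x' * \sum_(f <- permutations b | seq.filter (mem x) f == x) g f * q ^+ linv f.
Proof.
move=> ux pxx cx lx pb hg; have pxx' : perm_eq x x' by rewrite perm_sym.
have ux' : uniq x' by rewrite (perm_uniq pxx).
have mxx : mem x' =1 mem x by move=> v /=; rewrite (perm_mem pxx).
have pm : perm_eq (permutations b) (map (map (relab x x')) (permutations b)).
  apply: uniq_perm; rewrite ?permutations_uniq // ?map_inj_uniq ?permutations_uniq //.
    by apply: inj_map; apply: can_inj (relabK ux pxx).
  move=> f; rewrite mem_permutations; apply/idP/mapP => [pf|[f' + ->]].
    exists (map (relab x' x) f).
      rewrite mem_permutations (perm_trans _ pf) // perm_map_relab //.
      rewrite (eq_filter mxx) (perm_trans _ pxx') // (perm_trans _ pb) //.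
      exact: perm_filter.
    rewrite -map_comp map_id_in // => v _ /=.
    by rewrite (relabK ux').
  rewrite mem_permutations => pf; rewrite (perm_trans _ pf) //.
  by rewrite perm_map_relab // (perm_trans _ pb) // perm_filter.
rewrite (perm_big _ pm) /= big_map big_distrr /=.
have hE f : (seq.filter (mem x) (map (relab x x') f) == x') = (seq.filter (mem x) f == x).
  apply/eqP/eqP => [h|]; last exact: filter_map_relab.
  have h' : seq.filter (mem x') (map (relab x x') f) = x' by rewrite (eq_filter mxx).
  have := filter_map_relab ux' pxx' h'.
  by rewrite -map_comp (eq_map (g := id)) ?map_id ?(eq_filter mxx) // => v /=; rewrite relabK.
apply: congr_big => // f; rewrite hE => /eqP h; rewrite hg mulrCA; congr (_ * _).
rewrite -exprD; congr (_ ^+ _).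
have := @linv_relabel (mem x) (relab x x') f cx (relab_in pxx) (fun v => relab_out pxx (v := v)).
by rewrite h lx map_relab //; lia.
Qed.

(** * Removing the smallest values from a Mallows sum *)

Definition qnat (R : realType) (q : R) (n : nat) : R := \sum_(i < n) q ^+ i.

Definition insl (k : nat) (a : int) (s : seq int) := take k s ++ a :: drop k s.

Lemma linv_cat s t : linv (s ++ t) =
  (linv s + linv t + \sum_(x <- s) nlt x t)%N.
Proof.
elim: s => [|x s IH] /=; first by rewrite big_nil addn0.
by rewrite big_cons nlt_cat IH; lia.
Qed.

(** The new minimum forms an inversion with each of the [k] entries before it and with none after
    it. Summed over [k], this produces a q-integer. *)
Lemma linv_insl k a s : (k <= size s)%N -> all (fun y : int => a < y) s ->
  linv (insl k a s) = (k + linv s)%N.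
Proof.
move=> ks; rewrite -{1}(cat_take_drop k s) all_cat => /andP[h1 h2].
rewrite -[in RHS](cat_take_drop k s) /insl !linv_cat /=.
have -> : nlt a (drop k s) = 0%N.
  apply/eqP; rewrite -leqn0 leqNgt /nlt -has_count; apply/hasPn => y /(allP h2).
  by rewrite -leNgt; apply: ltW.
have -> : (\sum_(x <- take k s) nlt x (a :: drop k s) =
  k + \sum_(x <- take k s) nlt x (drop k s))%N; last by rewrite add0n addnCA.
have hk : k = (\sum_(x <- take k s) 1)%N by rewrite sum1_size size_takel.
rewrite [X in (X + _)%N]hk -big_split /=.
by apply: eq_big_seq => x /(allP h1) ax; rewrite nlt_cons ax.
Qed.

Lemma filter_insl k a s : all (fun y : int => a < y) s -> seq.filter (fun y : int => a < y) (insl k a s) = s.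
Proof.
rewrite -{1}(cat_take_drop k s) all_cat => /andP[h1 h2].
rewrite /insl filter_cat /= ltxx (all_filterP h1) (all_filterP h2).
exact: cat_take_drop.
Qed.

Lemma perm_insl k a s : perm_eq (insl k a s) (a :: s).
Proof. by rewrite /insl -[in X in perm_eq _ X](cat_take_drop k s) perm_catC /= perm_cons perm_catC. Qed.

Lemma index_insl k a s : (k <= size s)%N -> all (fun y : int => a < y) s -> index a (insl k a s) = k.
Proof.
move=> ks; rewrite -{1}(cat_take_drop k s) all_cat => /andP[h1 h2].
rewrite /insl index_cat ifN /= ?eqxx ?addn0 ?size_takel //.
by apply/negP => /(allP h1); rewrite ltxx.
Qed.

(** An arrangement is determined by the index of its minimum and by the arrangement left after
    deleting it. *)
Lemma permutations_cons_min (a : int) (V : seq int) : all (fun y : int => a < y) V ->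
  perm_eq (permutations (a :: V))
    [seq insl k a s | s <- permutations V, k <- iota 0 (size V).+1].
Proof.
move=> aV.
have hall s : s \in permutations V -> all (fun y : int => a < y) s.
  by rewrite mem_permutations => p; rewrite (perm_all _ p).
have hsz s k : s \in permutations V -> k \in iota 0 (size V).+1 -> (k <= size s)%N.
  by rewrite mem_permutations mem_iota add0n ltnS => /perm_size ->.
apply: uniq_perm; first exact: permutations_uniq.
  apply: allpairs_uniq; rewrite ?permutations_uniq ?iota_uniq //.
  cbv zeta => p p' /allpairsP[[s1 k1] [p1 p2 ->]] /allpairsP[[s2 k2] [p3 p4 ->]] h.
  change (insl k1 a s1 = insl k2 a s2) in h.
  have {}p1 : s1 \in permutations V := p1; have {}p2 : k1 \in iota 0 (size V).+1 := p2.
  have {}p3 : s2 \in permutations V := p3; have {}p4 : k2 \in iota 0 (size V).+1 := p4.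
  have := congr1 (index a) h; have := congr1 (seq.filter (fun y : int => a < y)) h.
  by rewrite !filter_insl ?hall // !index_insl ?hall ?hsz // => -> ->.
move=> s; rewrite mem_permutations; apply/idP/allpairsP => [p|[[s' k] [p1 p2 ->]]]; last first.
  by apply: (perm_trans (perm_insl _ _ _)); rewrite perm_cons -mem_permutations.
have as_ : a \in s by rewrite (perm_mem p) mem_head.
pose k := index a s; exists (take k s ++ drop k.+1 s, k); cbn [fst snd].
have hs : s = take k s ++ a :: drop k.+1 s.
  by rewrite -[LHS](cat_take_drop k) (drop_nth a) ?index_mem // nth_index.
have ks : (k < size s)%N by rewrite index_mem.
split.
- rewrite mem_permutations -(perm_cons a) (perm_trans _ p) // perm_sym {1}hs.
  by rewrite perm_catC /= perm_cons perm_catC.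
- by rewrite mem_iota /= add0n; have /= <- := perm_size p.
rewrite /insl take_cat drop_cat size_takel ?ltnn ?subnn ?take0 ?drop0 ?cats0 //.
exact: ltnW.
Qed.

Lemma sum_permutations_cons_min (R : realType) (q : R) (a : int) (V : seq int) (g : seq int -> R) :
  all (fun y : int => a < y) V ->
  \sum_(s <- permutations (a :: V)) g (seq.filter (fun y : int => a < y) s) * q ^+ linv s =
  qnat q (size V).+1 * \sum_(s <- permutations V) g s * q ^+ linv s.
Proof.
move=> aV; rewrite (perm_big _ (permutations_cons_min aV)) big_allpairs_dep.
rewrite mulr_sumr; apply: eq_big_seq => s; rewrite mem_permutations => ps.
have as_ : all (fun y : int => a < y) s by rewrite (perm_all _ ps).
rewrite /qnat -(big_mkord xpredT (fun i => q ^+ i)) mulr_suml.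
rewrite [LHS]big_seq /index_iota subn0 [RHS]big_seq; apply: eq_bigr => k; rewrite mem_iota => hk.
rewrite filter_insl // linv_insl ?(perm_size ps) //; first by rewrite exprD; ring.
Qed.

(** The values of [V1] are deleted one at a time, each being the minimum at its turn; they
    contribute only a constant, so the restriction of a Mallows arrangement to its upper values is
    again Mallows. *)
Lemma sum_permutations_cat_min (R : realType) (q : R) (V1 V2 : seq int) (g : seq int -> R) :
  sorted <%R (V1 ++ V2) ->
  \sum_(s <- permutations (V1 ++ V2)) g (seq.filter (mem V2) s) * q ^+ linv s =
  (\prod_(i < size V1) qnat q (size V2 + i).+1) * \sum_(s <- permutations V2) g s * q ^+ linv s.
Proof.
elim: V1 => [|a V1 IH] /= hs.
  rewrite big_ord0 mul1r; apply: eq_big_seq => s; rewrite mem_permutations => ps.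
  congr (g _ * _); apply/all_filterP/allP => y; by rewrite (perm_mem ps).
have aV : all (fun y : int => a < y) (V1 ++ V2) by apply: order_path_min hs => //; exact: lt_trans.
rewrite big_ord_recr /= (mulrC _ (qnat _ _)) -mulrA -IH; last exact: path_sorted hs.
have -> : (size V2 + size V1 = size (V1 ++ V2))%N by rewrite size_cat addnC.
rewrite -(sum_permutations_cons_min q (fun s => g (seq.filter (mem V2) s)) aV); apply: eq_bigr => s _.
congr (g _ * _); rewrite -filter_predI; apply: eq_filter => y /=.
apply/idP/andP => [h|[]//]; split => //.
by apply: (allP aV); rewrite mem_cat h orbT.
Qed.

Lemma permutations_head (V : seq int) c : uniq V -> c \in V ->
  perm_eq (seq.filter (fun s => ohead s == Some c) (permutations V))
          (map (cons c) (permutations (rem c V))).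
Proof.
move=> uV cV; apply: uniq_perm.
- by rewrite filter_uniq // permutations_uniq.
- by rewrite map_inj_uniq ?permutations_uniq // => s t [].
move=> s; rewrite mem_filter mem_permutations; apply/andP/mapP => [[]|[t + ->]].
  case: s => //= d s /eqP[->] ps; exists s => //; rewrite mem_permutations -(perm_cons c).
  by rewrite (perm_trans ps) // perm_to_rem.
rewrite mem_permutations => pt; rewrite /= eqxx; split => //.
by rewrite perm_sym (perm_trans (perm_to_rem cV)) // perm_cons perm_sym.
Qed.

Lemma windowS a n : window a n.+1 = a :: window (a + 1) n.
Proof.
rewrite /window /= addr0; congr (_ :: _); rewrite (iotaDl 1 0) -map_comp.
by apply: eq_map => i /=; rewrite PoszD addrA.
Qed.

Lemma size_window a n : size (window a n) = n.
Proof. by rewrite size_map size_iota. Qed.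

Lemma mem_window a n x : (x \in window a n) = (a <= x < a + n%:Z).
Proof.
elim: n a => [|n IH] a; first by rewrite addr0 in_nil; case: leP => //= /le_gtF ->.
by rewrite windowS in_cons IH; apply/idP/idP; lia.
Qed.

Lemma sorted_window a n : sorted <%R (window a n).
Proof.
elim: n a => // n IH a; rewrite windowS /= path_min_sorted //.
by apply/allP => x; rewrite mem_window; lia.
Qed.

Lemma uniq_window a n : uniq (window a n).
Proof. by apply: lt_sorted_uniq; exact: sorted_window. Qed.

Lemma linv_window a n : linv (window a n) = 0%N.
Proof.
elim: n a => // n IH a; rewrite windowS /= IH addn0.
apply/eqP; rewrite -leqn0 leqNgt /nlt -has_count; apply/hasPn => y.
by rewrite mem_window; lia.
Qed.

Lemma window_cat a m n : window a (m + n) = window a m ++ window (a + m%:Z) n.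
Proof.
elim: m a => [|m IH] a; first by rewrite addr0.
rewrite addSn !windowS IH /=; congr (_ :: (_ ++ window _ _)); lia.
Qed.

Lemma convex_window a n : int_convex (mem (window a n)).
Proof. by move=> x y z /=; rewrite !mem_window; lia. Qed.

(** * The Mallows law on a window, its splitting and its limit *)

Section Wexp.
Variables (R : realType) (q : R).
Hypothesis q0 : 0 <= q.

(** Here [wtot] is the Mallows partition function and [wexp] the Mallows probability of a test on
    arrangements of [V]. *)
Definition wsum (V : seq int) (g : seq int -> R) : R :=
  \sum_(s <- permutations V) g s * q ^+ linv s.
Definition wtot (V : seq int) : R := wsum V (fun=> 1).
Definition wexp (V : seq int) (Q : seq int -> bool) : R :=
  wsum V (fun s => (Q s)%:R) / wtot V.

Lemma qnat_gt0 n : 0 < qnat q n.+1.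
Proof.
rewrite /qnat big_ord_recl expr0 ltr_pwDl // sumr_ge0 // => i _.
exact: exprn_ge0.
Qed.

Lemma wtot_cat_min V1 V2 : sorted <%R (V1 ++ V2) ->
  wtot (V1 ++ V2) = (\prod_(i < size V1) qnat q (size V2 + i).+1) * wtot V2.
Proof. by move=> h; rewrite /wtot /wsum -(sum_permutations_cat_min q (fun=> 1) h). Qed.

Lemma wtot_nil : wtot [::] = 1.
Proof. by rewrite /wtot /wsum big_seq1 mul1r expr0. Qed.

Lemma wtot_gt0 a n : 0 < wtot (window a n).
Proof.
have := @wtot_cat_min (window a n) [::]; rewrite cats0 => ->; last exact: sorted_window.
rewrite wtot_nil mulr1; apply: prodr_gt0 => i _; exact: qnat_gt0.
Qed.

Lemma sum_fiber (T U : eqType) (f : T -> U) (r : seq T) (s : seq U) (g : T -> R) :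
  uniq s -> (forall x, x \in r -> f x \in s) ->
  \sum_(x <- r) g x = \sum_(y <- s) \sum_(x <- r | f x == y) g x.
Proof.
move=> us h; rewrite (exchange_big_dep xpredT) //=.
rewrite big_seq [RHS]big_seq; apply: eq_bigr => x xr.
rewrite (eq_bigl (pred1 (f x))); last by move=> y; rewrite eq_sym.
by rewrite -big_filter filter_pred1_uniq ?h // big_seq1.
Qed.

(** Independence of the lower and the upper pattern. By [sum_relabel] the words with lower pattern
    [x] have total weight q^(linv x) times a constant [K] that depends on [g] but not on [x];
    summing over [x] normalises by [wtot]. *)
Lemma wsum_shuffle a n V2 (T : seq int -> bool) (g : seq int -> R) :
  sorted <%R (window a n ++ V2) ->
  \sum_(s <- permutations (window a n ++ V2))
    (T (seq.filter (mem (window a n)) s))%:R * g (seq.filter (mem V2) s) * q ^+ linv s =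
  wexp (window a n) T *
  \sum_(s <- permutations (window a n ++ V2)) g (seq.filter (mem V2) s) * q ^+ linv s.
Proof.
move=> hs; set V1 := window a n; set r := permutations _.
have uV : uniq (V1 ++ V2) by apply: lt_sorted_uniq.
have dis y : y \in V2 -> y \notin V1.
  by move: uV; rewrite cat_uniq => /and3P[_ /hasPn h _] /h.
have fV1 : seq.filter (mem V1) (V1 ++ V2) = V1.
  rewrite filter_cat (all_filterP _); last by apply/allP.
  by rewrite (eq_in_filter (a2 := pred0)) ?filter_pred0 ?cats0 // => y /dis /negbTE.
have hfib s : s \in r -> seq.filter (mem V1) s \in permutations V1.
  rewrite !mem_permutations => p; rewrite -[X in perm_eq _ X]fV1; exact: perm_filter.
pose K : R := \sum_(s <- r | seq.filter (mem V1) s == V1) g (seq.filter (mem V2) s) * q ^+ linv s.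
have hK x : x \in permutations V1 -> \sum_(s <- r | seq.filter (mem V1) s == x)
    g (seq.filter (mem V2) s) * q ^+ linv s = q ^+ linv x * K.
  rewrite mem_permutations => px.
  apply: (@sum_relabel _ q _ V1 x (fun s => g (seq.filter (mem V2) s))) => //.
  - exact: uniq_window.
  - exact: convex_window.
  - exact: linv_window.
  - by rewrite fV1.
  move=> f; congr g; rewrite filter_map.
  rewrite (eq_filter (a2 := mem V2)); last first.
    move=> y /=; case: (boolP (y \in V1)) => yV; last by rewrite relab_out.
    rewrite (negbTE (contraL (@dis y) yV)); apply/negbTE.
    by apply: contraL (@dis (relab V1 x y)) _; rewrite relab_in.
  rewrite map_id_in // => y; rewrite mem_filter => /andP[/= /dis yV _].
  by rewrite relab_out.
have hS : \sum_(s <- r) g (seq.filter (mem V2) s) * q ^+ linv s = wtot V1 * K.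
  rewrite (sum_fiber _ (permutations_uniq V1) hfib) /wtot /wsum mulr_suml.
  by apply: eq_big_seq => x /hK ->; rewrite mul1r.
rewrite hS (sum_fiber _ (permutations_uniq V1) hfib) /wexp mulrA divfK; last first.
  by rewrite gt_eqF // wtot_gt0.
rewrite /wsum mulr_suml; apply: eq_big_seq => x xp.
rewrite -mulrA -(hK _ xp) mulr_sumr; apply: eq_bigr => s /eqP ->.
by rewrite mulrA.
Qed.

(* With c_0 = c and c_(i+1) = c_i + n_i + 1: among the entries of s above c_i the    *)
(* first one is c_(i+1), and the entries between c_i and c_(i+1) pass the i-th test. *)
Fixpoint chain (c : int) (l : seq (nat * (seq int -> bool))) (s : seq int) : bool :=
  if l is (n, T) :: l' then
    let c' := c + n.+1%:Z in
    [&& ohead s == Some c', T [seq y <- s | y < c'] & chain c' l' [seq y <- s | c' < y]]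
  else true.

(** The first letter [c'] forms inversions with the [n] smaller entries only, hence q^n; the entries
    after it split by [wsum_shuffle]. The quotient of partition functions leaves the q-integer of
    the window's length, so the rank of the first letter is a truncated geometric variable. *)
Lemma wexp_chain_cons c n T l N :
  wexp (window (c + 1) (n.+1 + N)) (chain c ((n, T) :: l)) =
  q ^+ n / qnat q (n.+1 + N) * wexp (window (c + 1) n) T *
  wexp (window (c + n.+1%:Z + 1) N) (chain (c + n.+1%:Z) l).
Proof.
set c' := c + n.+1%:Z; set V1 := window (c + 1) n; set V2 := window (c' + 1) N.
set V := window (c + 1) (n.+1 + N).
have hV : V = V1 ++ c' :: V2.
  by rewrite /V addSnnS window_cat windowS; congr (_ ++ _ :: window _ _); rewrite /c'; lia.
have sV : sorted <%R (V1 ++ c' :: V2) by rewrite -hV sorted_window.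
have sV' : sorted <%R ((rcons V1 c') ++ V2) by rewrite cat_rcons.
(* The letters after the first one have a hole at [c']; this is why the lemmas on sums ask for a
   sorted list rather than for one window. *)
have sV12 : sorted <%R (V1 ++ V2).
  apply: subseq_sorted sV; first exact: lt_trans.
  by rewrite cat_subseq // subseq_cons.
have cV1 : c' \notin V1 by rewrite mem_window /c'; lia.
have hrem : rem c' V = V1 ++ V2.
  rewrite rem_filter ?uniq_window // hV filter_cat /= eqxx /=; congr (_ ++ _); apply/all_filterP/allP => y.
    by apply: contraTneq => ->.
  by rewrite mem_window /= /c'; apply: contraTneq => ->; lia.
have htot : wtot V = (\prod_(i < n) qnat q (N + i).+1) * qnat q (n.+1 + N) * wtot V2.
  rewrite hV -cat_rcons wtot_cat_min // size_rcons !size_window big_ord_recr /=.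
  by rewrite addnC.
have hsum : wsum V (fun s => (chain c ((n, T) :: l) s)%:R) = q ^+ n *
   \sum_(s <- permutations (V1 ++ V2)) (T (seq.filter (mem V1) s))%:R *
     (chain c' l (seq.filter (mem V2) s))%:R * q ^+ linv s.
  rewrite /wsum (eq_bigr (fun s => if ohead s == Some c' then
     (T [seq y <- s | y < c'] && chain c' l [seq y <- s | c' < y])%:R * q ^+ linv s else 0)); last first.
    by move=> s _ /=; rewrite -/c'; case: (ohead s == Some c') => //=; rewrite mul0r.
  rewrite -big_mkcond /= -big_filter (perm_big _ (permutations_head _ _)); last 2 first.
  - exact: uniq_window.
  - by rewrite hV mem_cat mem_head orbT.
  rewrite big_map hrem mulr_sumr; apply: eq_big_seq => s; rewrite mem_permutations => ps.
  rewrite /= ltxx.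
  have f1 : [seq y <- s | y < c'] = seq.filter (mem V1) s.
    apply: eq_in_filter => y; rewrite (perm_mem ps) mem_cat /= !mem_window /c'; lia.
  have f2 : [seq y <- s | c' < y] = seq.filter (mem V2) s.
    apply: eq_in_filter => y; rewrite (perm_mem ps) mem_cat /= !mem_window /c'; lia.
  have hn : nlt c' s = n.
    rewrite /nlt -size_filter f1 -[RHS](size_window (c + 1) n) -/V1.
    rewrite -[in RHS](_ : seq.filter (mem V1) (V1 ++ V2) = V1).
      by apply: perm_size; apply: perm_filter.
    rewrite filter_cat (all_filterP _); last by apply/allP.
    rewrite (eq_in_filter (a2 := pred0)) ?filter_pred0 ?cats0 // => y.
    by rewrite /= !mem_window /c' => h; apply/negP; lia.
  by rewrite f1 f2 hn exprD -mulnb natrM mulrCA !mulrA.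
rewrite /wexp htot hsum (@wsum_shuffle (c + 1) n V2 T (fun s => (chain c' l s)%:R) sV12).
rewrite (sum_permutations_cat_min q (fun s => (chain c' l s)%:R) sV12) !size_window.
rewrite -/(wsum V2 (fun s => (chain c' l s)%:R)).
have h1 : wtot V2 != 0 by rewrite gt_eqF // wtot_gt0.
have h2 : qnat q (n.+1 + N) != 0 by rewrite gt_eqF // addSn qnat_gt0.
have h3 : \prod_(i < n) qnat q (N + i).+1 != 0.
  by rewrite gt_eqF // prodr_gt0 // => i _; exact: qnat_gt0.
by rewrite /wexp; field; rewrite h1 h2 h3 gt_eqF ?wtot_gt0.
Qed.

Hypothesis q1 : q < 1.

Lemma cvg_qnatV : (qnat q n.+1)^-1 @[n --> \oo] --> 1 - q.
Proof.
rewrite -[X in _ --> X]invrK; apply: cvgV; first by rewrite invr_neq0 // subr_eq0 gt_eqF.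
have h : series (geometric 1 q) n @[n --> \oo] --> (1 - q)^-1.
  by rewrite -div1r; apply: cvg_geometric_series; rewrite ger0_norm.
rewrite -(cvg_shiftS (series (geometric 1 q))) in h; apply: cvg_trans h; apply: near_eq_cvg.
apply: nearW => n; rewrite /series /= /qnat big_mkord; apply: eq_bigr => i _.
by rewrite /geometric /= mul1r.
Qed.

(** Limit of the chain probability as the window grows upwards: independent geometric gaps carrying
    Mallows patterns. *)
Fixpoint chainlim (c : int) (l : seq (nat * (seq int -> bool))) : R :=
  if l is (n, T) :: l' then
    q ^+ n * (1 - q) * wexp (window (c + 1) n) T * chainlim (c + n.+1%:Z) l'
  else 1.

Lemma cvg_wexp_chain c l :
  wexp (window (c + 1) n) (chain c l) @[n --> \oo] --> chainlim c l.
Proof.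
elim: l c => [|[n T] l IH] c.
  apply: cvg_near_cst; apply: nearW => n.
  by rewrite /wexp -/(wtot _) divff // gt_eqF // wtot_gt0.
rewrite -(cvg_shiftn n.+1) /=.
under eq_cvg do rewrite addnC wexp_chain_cons.
apply: cvgM (IH _); apply: cvgM; last exact: cvg_cst.
apply: cvgM; first exact: cvg_cst.
have h := cvg_qnatV; rewrite -(cvg_shiftn n) in h.
by under eq_cvg do rewrite addSn addnC.
Qed.

End Wexp.

(** * Binary search trees *)

Lemma bst_fuel_enough n x : (size x <= n)%N -> bst_fuel n x = BST x.
Proof.
rewrite /BST; elim/ltn_ind: n x => -[|n] IH [|a r] //= hx.
have hs p : (size (seq.filter p r) <= size r)%N by rewrite size_filter count_size.
have hn : (size r <= n)%N by [].
by rewrite !(IH n) ?(leq_trans (hs _)) // !(IH (size r)) ?hs.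
Qed.

Lemma BST_nil : BST [::] = set0.
Proof. by []. Qed.

Lemma BST_cons a r : BST (a :: r) =
  [set [::]] `|` [set false :: w | w in BST [seq y <- r | y < a]]
             `|` [set true :: w | w in BST [seq y <- r | a < y]].
Proof. by rewrite {1}/BST /= !bst_fuel_enough // size_filter count_size. Qed.

Lemma seq_size_ind (T : Type) (P : seq T -> Prop) :
  (forall s, (forall t, (size t < size s)%N -> P t) -> P s) -> forall s, P s.
Proof.
move=> h s; have [n] := ubnP (size s); elim: n s => // n IH s hs.
by apply: h => t ht; apply: IH; apply: leq_trans ht _.
Qed.

(** The tree depends on comparisons only, so the pattern of a gap can be translated to the values 1,
    ..., n. *)
Lemma BST_map (f : int -> int) x : {mono f : a b / a < b} -> BST (map f x) = BST x.
Proof.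
move=> fm; elim/seq_size_ind: x => -[|a r] IH //=.
have hs p : (size (seq.filter p r) < (size r).+1)%N by rewrite ltnS size_filter count_size.
have e1 : [seq y <- map f r | y < f a] = map f [seq y <- r | y < a].
  by rewrite filter_map; congr map; apply: eq_filter => y /=; exact: fm.
have e2 : [seq y <- map f r | f a < y] = map f [seq y <- r | a < y].
  by rewrite filter_map; congr map; apply: eq_filter => y /=; exact: fm.
by rewrite !BST_cons e1 e2 (IH _ (hs _)) (IH _ (hs _)).
Qed.

Lemma BST_prefix x : binary_tree (BST x).
Proof.
rewrite /binary_tree; elim/seq_size_ind: x => -[|a r] IH u v; rewrite ?BST_cons //.
have hs p : (size (seq.filter p r) < size (a :: r))%N by rewrite ltnS size_filter count_size.
case: u => [|b u]; first by left; left.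
case=> [[//|[w hw [<- e]]]|[w hw [<- e]]]; [left; right|right]; exists u => //;
  by apply: (IH _ (hs _) u v); rewrite -e.
Qed.

Lemma BST_finite x : exists s, [/\ uniq s, BST x = [set w | w \in s] & uniq x -> size s = size x].
Proof.
elim/seq_size_ind: x => -[|a r] IH.
  by exists [::]; split => //; rewrite BST_nil; apply/seteqP; split.
have hs p : (size (seq.filter p r) < size (a :: r))%N by rewrite ltnS size_filter count_size.
have [s1 [u1 e1 z1]] := IH _ (hs (fun y => y < a)).
have [s2 [u2 e2 z2]] := IH _ (hs (fun y => a < y)).
exists ([::] :: map (cons false) s1 ++ map (cons true) s2); split.
- rewrite /= mem_cat negb_or cat_uniq !map_inj_uniq ?u1 ?u2; try by move=> ? ? [].
  rewrite /= !andbT /=; apply/andP; split.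
  + by apply/andP; split; apply/negP => /mapP[].
  + by apply/hasPn => w /mapP[w' _ ->]; apply/negP => /mapP[].
- rewrite BST_cons e1 e2; apply/seteqP; split => w /=.
  + move=> [[->|[w' h <-]]|[w' h <-]]; rewrite in_cons mem_cat /= ?eqxx //.
      by rewrite (map_f (cons false)).
    by rewrite (map_f (cons true)) // orbT.
  + rewrite in_cons mem_cat => /or3P[/eqP->|/mapP[w' h ->]|/mapP[w' h ->]].
    * by left; left.
    * by left; right; exists w'.
    * by right; exists w'.
move=> /= /andP[ar ur]; rewrite size_cat !size_map z1 ?z2 ?filter_uniq //.
congr _.+1; rewrite !size_filter -[RHS](count_predC (fun y => y < a)); congr (_ + _)%N.
apply: eq_in_count => y yr /=; case: ltgtP => // e.
by rewrite e yr in ar.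
Qed.

(** * Arrangements of a window as elements of the symmetric group *)

Definition pv (c : int) (n : nat) (s : 'S_n) : seq int := [seq c + (s i : nat)%:Z | i <- enum 'I_n].

Lemma perm_values_pv n (s : 'S_n) : perm_values s = pv 1 s.
Proof. by apply: eq_map => i; rewrite -addn1 PoszD addrC. Qed.

Lemma pv_shift c n (s : 'S_n) : pv c s = map (+%R (c - 1)) (pv 1 s).
Proof. by rewrite -map_comp; apply: eq_map => i /=; rewrite addrA subrK. Qed.

Lemma mem_pv c n (s : 'S_n) : perm_eq (pv c s) (window c n).
Proof.
apply: uniq_perm; last 2 first.
- exact: uniq_window.
- move=> y; rewrite mem_window; apply/mapP/idP => [[i _ ->]|h].
    by have := ltn_ord (s i); lia.
  have hn : (`|y - c| < n)%N by lia.
  exists (s^-1 (Ordinal hn))%g; first by rewrite mem_enum.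
  by rewrite permKV /=; lia.
rewrite map_inj_uniq ?enum_uniq // => i j /addrI [] /val_inj; exact: perm_inj.
Qed.

Lemma permutations_window c n :
  perm_eq (permutations (window c n)) [seq pv c s | s <- enum {: 'S_n}].
Proof.
have inj : injective (@pv c n).
  move=> s t /eq_in_map h; apply/permP => i.
  by have /addrI [] := h i (mem_enum _ i); move/val_inj.
have u1 : uniq [seq pv c s | s <- enum {: 'S_n}] by rewrite (map_inj_uniq inj) enum_uniq.
have sub : {subset [seq pv c s | s <- enum {: 'S_n}] <= permutations (window c n)}.
  by move=> x /mapP[s _ ->]; rewrite mem_permutations mem_pv.
have hz : (size (permutations (window c n)) <= size [seq pv c s | s <- enum {: 'S_n}])%N.
  by rewrite size_permutations ?uniq_window // size_window size_map -cardE card_Sn.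
have [_ e] := uniq_min_size u1 sub hz.
rewrite perm_sym; apply: uniq_perm => //; exact: permutations_uniq.
Qed.

Lemma linv_map_sorted n (g : 'I_n -> int) (r : seq 'I_n) :
  sorted (fun i j : 'I_n => (i < j)%N) r ->
  linv (map g r) = (\sum_(i <- r) count (fun j : 'I_n => (i < j)%N && (g j < g i)%R) r)%N.
Proof.
elim: r => [|i r IH] /= hr; first by rewrite big_nil.
have hi : all (fun j : 'I_n => (i < j)%N) r.
  by apply: order_path_min hr => a b c; exact: ltn_trans.
rewrite big_cons IH; last exact: path_sorted hr.
rewrite /= ltnn /= add0n; congr (_ + _)%N.
  rewrite /nlt count_map; apply: eq_in_count => j /(allP hi) /= -> //.
apply: eq_big_seq => j /(allP hi) /= ij.
by rewrite ltnNge (ltnW ij).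
Qed.

Lemma linv_pv c n (s : 'S_n) : linv (pv c s) = Defs.Inv s.
Proof.
rewrite /pv (@linv_map_sorted n (fun i : 'I_n => c + (s i : nat)%:Z)); last first.
  rewrite -(@sorted_map _ _ (@nat_of_ord n) ltn) val_enum_ord; exact: iota_ltn_sorted.
rewrite /Defs.Inv -sum1_card (eq_bigl (fun p : 'I_n * 'I_n => xpredT p.1 && ((p.1 < p.2)%N && (s p.2 < s p.1)%N))); last by move=> p; apply/idP/idP => [/set_mem|h]; [|apply/mem_set].
rewrite -(pair_big_dep xpredT (fun i j : 'I_n => (i < j)%N && (s j < s i)%N) (fun _ _ => 1%N)) /=.
rewrite big_enum /=; apply: eq_bigr => i _; rewrite -sum1_count big_enum_cond /=.
by apply: eq_bigl => j; rewrite ltrD2l ltz_nat.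
Qed.

Lemma wsum_window (R : realType) (q : R) c n (g : seq int -> R) :
  wsum q (window c n) g = \sum_(s : 'S_n) g (pv c s) * q ^+ Defs.Inv s.
Proof.
rewrite /wsum (perm_big _ (permutations_window c n)) /= big_map big_enum /=.
by apply: eq_bigr => s _; rewrite linv_pv.
Qed.

(** A singleton [T] gives [prob_bst], and [setT] gives 1; the set form treats prescribed and free
    trees at once. *)
Definition prob_bst_in (R : realType) (q : R) (n : nat) (T : set (set (seq bool))) : R :=
  \sum_(s : 'S_n) (if `[< T (BST (perm_values s)) >] then mallows q s else 0).

Lemma wexp_BST (R : realType) (q : R) c n T :
  wexp q (window c n) (fun x => `[< T (BST x) >]) = prob_bst_in q n T.
Proof.
rewrite /wexp /wtot !wsum_window /prob_bst_in mulr_suml; apply: eq_bigr => s _.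
have -> : BST (pv c s) = BST (perm_values s).
  rewrite perm_values_pv pv_shift BST_map // => a b; exact: ltrD2l.
rewrite /mallows /Zmallows (eq_bigr (fun s0 : 'S_n => q ^+ Defs.Inv s0)); last by move=> t _; rewrite mul1r.
by case: ifP; rewrite ?mul1r ?mul0r.
Qed.

Lemma prob_bst_inT (R : realType) (q : R) n : 0 <= q -> prob_bst_in q n setT = 1.
Proof.
move=> q0; rewrite -(wexp_BST q 1) /wexp /wtot.
have -> : (fun s : seq int => `[< [set: set (seq bool)] (BST s) >]%:R) = (fun=> 1) :> (seq int -> R).
  by apply/funext => s; rewrite asboolT.
by rewrite divff // gt_eqF // wtot_gt0.
Qed.

(** * The two-sided permutation *)

Section TheOr.
Variables (A : Type) (x0 : A) (P : A -> Prop).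

Lemma the_orP : (exists! x, P x) -> P (the_or x0 P).
Proof.
move=> h; rewrite /the_or; case: pselect => // h'.
by apply: ClassicalEpsilon.epsilon_spec; case: h' => x [Px _]; exists x.
Qed.

Lemma the_or_eq x : P x -> (forall y, P y -> y = x) -> the_or x0 P = x.
Proof.
move=> Px h; apply: (h); apply: the_orP; exists x; split => // y hy; exact/esym/h.
Qed.

Lemma the_or_none : (forall x, ~ P x) -> the_or x0 P = x0.
Proof.
by move=> h; rewrite /the_or; case: pselect => // -[x [/h]].
Qed.
End TheOr.

(* A partition L and its conjugate c are linked by (j <= L l) = (l <= c j); the      *)
(* numbers l - L l and 1 - j + c j then partition the integers.                      *)
Section Galois.
Variables (L c : nat -> nat).
Hypothesis gal : forall l j, (0 < l)%N -> (0 < j)%N -> (j <= L l)%N = (l <= c j)%N.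

Definition el (l : nat) : int := l%:Z - (L l)%:Z.
Definition kk (i : int) : int := if 0 < i then 0 else i + (c `|1 - i|)%:Z.

Lemma gal_disj l (i : int) : (0 < l)%N -> i <= 0 -> el l <> kk i.
Proof.
move=> l0 i0; rewrite /el /kk ifN ?leNgt //; last by lia.
have j0 : (0 < `|1 - i|)%N by lia.
have := gal l0 j0; case: leqP => h; case: leqP => // h' _; lia.
Qed.

Lemma gal_noninc l : (0 < l)%N -> (L l.+1 <= L l)%N.
Proof.
move=> l0; case: (posnP (L l.+1)) => [->//|h].
rewrite gal //; have := gal (isT : (0 < l.+1)%N) h; rewrite leqnn => /esym; exact: ltnW.
Qed.

Lemma gal_noninc_le l l' : (0 < l)%N -> (l <= l')%N -> (L l' <= L l)%N.
Proof.
move=> l0; elim: l' => [|l' IH]; first by lia.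
rewrite leq_eqVlt => /orP[/eqP->//|h]; apply: leq_trans (gal_noninc _) (IH _) => //; lia.
Qed.

Lemma gal_eventually l : (c 1 < l)%N -> L l = 0%N.
Proof.
move=> h; have l0 : (0 < l)%N by lia.
by have := gal l0 (isT : (0 < 1)%N); rewrite [X in _ = X]leqNgt h /=; lia.
Qed.

Lemma el_mono l l' : (0 < l)%N -> (l < l')%N -> el l < el l'.
Proof. by move=> l0 h; have := gal_noninc_le l0 (ltnW h); rewrite /el; lia. Qed.

Lemma gal_noninc_c j j' : (0 < j)%N -> (j <= j')%N -> (c j' <= c j)%N.
Proof.
move=> j0 jj; case: (posnP (c j')) => [->//|h].
have j0' : (0 < j')%N by lia.
rewrite -gal // (leq_trans jj) // gal //.
Qed.

Lemma kk_mono (i j : int) : i < j <= 0 -> kk i < kk j.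
Proof.
move=> ij; rewrite /kk !ifN; try by rewrite -leNgt; lia.
have := @gal_noninc_c `|1 - j| `|1 - i|; lia.
Qed.

(** Take the least [l] with [z <= el l]. Unless equality holds, [z] falls in the jump of [el] before
    [l], and such jumps are filled by the values of [kk]. *)
Lemma gal_cover (z : int) : (exists2 l, (0 < l)%N & el l = z) \/ (exists2 i, i <= 0 & kk i = z).
Proof.
have ex : exists l, (0 < l)%N && (z <= el l).
  exists (maxn (c 1).+1 `|z|); apply/andP; split; first by lia.
  by rewrite /el gal_eventually; lia.
case: (ex_minnP ex) => l /andP[l0 zl] hmin.
case: (eqVneq (el l) z) => [e|ne]; first by left; exists l.
right; have zl' : z < el l by rewrite lt_def ne.
(* The column in question has length [l - 1], and [z = i + (l - 1)] forces this [i]. *)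
pose i : int := 1 - (l%:Z - z); have i0 : i <= 0 by move: zl'; rewrite /el /i; lia.
exists i => //; have j0 : (0 < `|1 - i|)%N by lia.
suff hc : c `|1 - i|%N = l.-1 by rewrite /kk ifN -?leNgt // hc /i; lia.
apply/eqP; rewrite eqn_leq; apply/andP; split.
  rewrite -ltnS prednK // ltnNge -gal // -ltnNge; move: zl'; rewrite /el /i; lia.
case: (posnP l.-1) => [->//|l1]; rewrite -gal //.
have : ~~ ((0 < l.-1)%N && (z <= el l.-1)) by apply/negP => /hmin; lia.
by rewrite l1 /= -ltNge /el /i; lia.
Qed.

End Galois.

Lemma dec_enum_uniq (e e' : nat -> int) :
  (forall m n, (m < n)%N -> e n < e m) -> (forall m n, (m < n)%N -> e' n < e' m) ->
  (forall z, (exists n, e n = z) <-> (exists n, e' n = z)) -> forall n, e n = e' n.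
Proof.
move=> de de' h; elim/ltn_ind => n IH.
have [m hm] : exists m, e' m = e n by apply/h; exists n.
have [k hk] : exists k, e k = e' n by apply/h; exists n.
have nm : (n <= m)%N.
  rewrite leqNgt; apply/negP => mn; have := de _ _ mn; rewrite (IH _ mn) hm ltxx //.
have nk : (n <= k)%N.
  by rewrite leqNgt; apply/negP => kn; have := de' _ _ kn; rewrite -(IH _ kn) hk ltxx.
apply/eqP; rewrite eq_le; apply/andP; split.
  by rewrite -hm; move: nm; rewrite leq_eqVlt => /orP[/eqP->//|/de' /ltW].
by rewrite -hk; move: nk; rewrite leq_eqVlt => /orP[/eqP->//|/de /ltW].
Qed.

Lemma set_size_sub (T : eqType) (S S' : set T) n :
  set_size S n -> set_size S' n -> S `<=` S' -> S = S'.
Proof.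
move=> [s [us zs ->]] [s' [us' zs' ->]] sub.
have [] := @uniq_min_size _ s s' us; rewrite ?zs ?zs' //.
by move=> _ e; apply/seteqP; split => x /=; rewrite e.
Qed.

Lemma set_size_bounded (S : set nat) n : set_size S n -> exists b, forall x, S x -> (x <= b)%N.
Proof.
move=> [s [_ _ ->]]; exists (\sum_(x <- s) x)%N => x /= xs.
by rewrite (big_rem x) //= leq_addr.
Qed.

Definition LSpec (M : nat -> nat) (L : nat -> nat) : Prop :=
  L 0%N = 0%N /\
  (forall j, (1 <= j)%N -> (L j.+1 <= L j)%N) /\
  (forall i, (1 <= i)%N -> set_size [set j | (1 <= j)%N /\ L j = i] (M i)).

Lemma LSpec_le M L j j' : LSpec M L -> (1 <= j)%N -> (j <= j')%N -> (L j' <= L j)%N.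
Proof.
move=> [_ [h _]] j0; elim: j' => [|j' IH]; first by lia.
rewrite leq_eqVlt => /orP[/eqP->//|jj]; apply: leq_trans (h _ _) (IH _) => //; lia.
Qed.

(** At the first index [j] where [L' j < L j], the indices at which [L'] takes the value [L j] all
    precede [j], so [L] takes that value there too. Both index sets have [M (L j)] elements, hence
    coincide, but [j] belongs to only one of them. *)
Lemma LSpec_uniq M L L' : LSpec M L -> LSpec M L' -> L = L'.
Proof.
move=> h h'; apply/funext; elim/ltn_ind => j IH.
case: (posnP j) => [->|j0]; first by case: h => ->; case: h' => ->.
wlog hlt : L L' h h' IH / (L' j < L j)%N => [W|].
  case: (ltngtP (L j) (L' j)) => //.
    by move=> /(W _ _ h' h) -> // i /IH.
  exact: W.
have a1 : (1 <= L j)%N by lia.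
have hs := h.2.2 _ a1; have hs' := h'.2.2 _ a1.
have e := set_size_sub hs' hs.
have /e : [set i | (1 <= i)%N /\ L' i = L j] `<=` [set i | (1 <= i)%N /\ L i = L j].
  move=> i /= [i1 e']; split => //; case: (ltnP i j) => ij; first by rewrite IH.
  by have := LSpec_le h' j0 ij; lia.
move/seteqP => [_ /(_ j)] /= []; first by []. by move=> _; lia.
Qed.

Lemma Lambda_eq M L : LSpec M L -> Lambda M = L.
Proof. by move=> h; apply: the_or_eq => // y hy; apply: LSpec_uniq h. Qed.

Lemma LSpec_support M L : LSpec M L -> exists n, forall i, (n < i)%N -> M i = 0%N.
Proof.
move=> h; exists (L 1%N) => i hi; have [|s [us <- e]] := h.2.2 i; first by lia.
case: s us e => // j s _ e; have : [set x | x \in j :: s] j by rewrite /= mem_head.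
by rewrite -e /= => -[j1 ej]; have := LSpec_le h (isT : (1 <= 1)%N) j1; lia.
Qed.

(** All parts are bounded by the first one, so an [M] of infinite support admits no [Lambda] and the
    default, the empty partition, is taken. *)
Lemma Lambda_none M : (forall n, exists2 i, (n < i)%N & M i <> 0%N) -> Lambda M = fun=> 0%N.
Proof.
move=> h; apply: the_or_none => L /LSpec_support [n hn].
by have [i /hn] := h n.
Qed.

Lemma LSpec_eventually M L : LSpec M L -> exists n, forall l, (n < l)%N -> L l = 0%N.
Proof.
move=> h; have [b hb] : exists b, forall i j, (1 <= i <= L 1%N)%N -> (1 <= j)%N -> L j = i -> (j <= b)%N.
  elim: (L 1%N) => [|a [b IH]]; first by exists 0%N => i j; lia.
  have [b' hb'] := set_size_bounded (h.2.2 a.+1 isT).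
  exists (maxn b b') => i j hi j1 e; case: (eqVneq i a.+1) => [ia|ia].
    by have := hb' j; rewrite /= e ia; lia.
  by have := IH i j _ j1 e; lia.
exists b => l hl; case: (posnP (L l)) => // h0; have l1 : (1 <= l)%N by lia.
have := LSpec_le h (isT : (1 <= 1)%N) l1.
by have := hb (L l) l; lia.
Qed.

Lemma Lambda_spec M : exists n, [/\ forall l, (n < l)%N -> Lambda M l = 0%N &
  forall l, (0 < l)%N -> (Lambda M l.+1 <= Lambda M l)%N].
Proof.
case: (pselect (exists L, LSpec M L)) => [[L hL]|hN].
  rewrite (Lambda_eq hL); have [n hn] := LSpec_eventually hL.
  by exists n; split => //; exact: hL.2.1.
have -> : Lambda M = fun=> 0%N.
  by apply: the_or_none => L hL; apply: hN; exists L.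
by exists 0%N.
Qed.

(** The default value of [Lambda] is itself a partition, so the conjugate exists for every outcome;
    [two_sided_spec] and the measurability lemma [m_X] then hold on the whole sample space. *)
Lemma Lambda_gal M : exists c : nat -> nat,
  forall l j, (0 < l)%N -> (0 < j)%N -> (j <= Lambda M l)%N = (l <= c j)%N.
Proof.
have [n [hn hd]] := Lambda_spec M; set L := Lambda M in hn hd *.
have hle l l' : (0 < l)%N -> (l <= l')%N -> (L l' <= L l)%N.
  move=> l0; elim: l' => [|l' IH]; first by lia.
  rewrite leq_eqVlt => /orP[/eqP->//|jj]; apply: leq_trans (hd _ _) (IH _) => //; lia.
have ex j : exists c, (0 < j)%N ==> (L c.+1 < j)%N.
  by exists n; rewrite hn //; apply/implyP.
exists (fun j => ex_minn (ex j)) => l j l0 j0; case: ex_minnP => c; rewrite j0 /= => hc hmin.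
case: (leqP l c) => lc; last by apply/negbTE; rewrite -ltnNge (leq_ltn_trans _ hc) // hle.
rewrite leqNgt; apply/negP => h; have := hmin l.-1; rewrite prednK // => /(_ h); lia.
Qed.

Definition KSpec (M : nat -> nat) (k : int -> int) : Prop :=
  (forall i : int, 0 < i -> k i = 0) /\
  (forall i j : int, i < j <= 0 -> k i < k j) /\
  (forall z : int, (forall i, (1 <= i)%N -> ell M i <> z) <->
                   (exists i : int, i <= 0 /\ k i = z)).

Lemma KSpec_uniq M k k' : KSpec M k -> KSpec M k' -> k = k'.
Proof.
move=> h h'; apply/funext => i; case: (ltP 0 i) => i0; first by rewrite h.1 ?h'.1.
have -> : i = - (`|i|%N)%:Z by lia.
pose e (f : int -> int) (n : nat) := f (- n%:Z).
have de f : (forall i j : int, i < j <= 0 -> f i < f j) ->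
    forall m n, (m < n)%N -> e f n < e f m.
  by move=> hf m n mn; apply: hf; lia.
apply: (dec_enum_uniq (de _ h.2.1) (de _ h'.2.1)) => z.
have hz f : (exists n, e f n = z) <-> (exists i : int, i <= 0 /\ f i = z).
  split=> [[n <-]|[j [j0 <-]]]; first by exists (- n%:Z); split => //; lia.
  by exists `|j|%N; congr f; lia.
by rewrite !hz -h.2.2 -h'.2.2.
Qed.

Lemma kenum_eq M c :
  (forall l j, (0 < l)%N -> (0 < j)%N -> (j <= Lambda M l)%N = (l <= c j)%N) ->
  kenum M = kk c.
Proof.
move=> gal; have hK : KSpec M (kk c).
  split; first by move=> i; rewrite /kk => ->.
  split; first by move=> i j; apply: (kk_mono gal).
  move=> z; split.
    by case: (gal_cover gal z) => [[l l0 <-] /(_ l l0)//|[i i0 <-] _]; exists i.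
  move=> [i [i0 <-]] l l0; exact: (gal_disj gal).
by apply: the_or_eq => // k hk; apply: KSpec_uniq hK.
Qed.

(** Since the two families of positions partition the integers ([gal_cover], [gal_disj]),
    prescribing X on both determines exactly one function. *)
Lemma two_sided_spec Pip Pim M c (X := two_sided_mallows Pip Pim M) :
  (forall l j, (0 < l)%N -> (0 < j)%N -> (j <= Lambda M l)%N = (l <= c j)%N) ->
  (forall i, (1 <= i)%N -> X (el (Lambda M) i) = (Pip i)%:Z) /\
  (forall i : int, i <= 0 -> X (kk c i) = 1 - (Pim `|1 - i|%N)%:Z).
Proof.
move=> gal; have hk := kenum_eq gal.
pose Q (X : int -> int) := (forall i, (1 <= i)%N -> X (ell M i) = (Pip i)%:Z) /\
    (forall i : int, i <= 0 -> X (kenum M i) = 1 - (Pim `|1 - i|%N)%:Z).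
suff : Q X by rewrite /Q hk.
apply: the_orP.
have hz z : exists v, (forall i, (1 <= i)%N -> ell M i = z -> v = (Pip i)%:Z) /\
    (forall i : int, i <= 0 -> kenum M i = z -> v = 1 - (Pim `|1 - i|%N)%:Z).
  case: (gal_cover gal z) => [[l l0 <-]|[i i0 <-]].
    exists (Pip l)%:Z; split.
      move=> i i1 e; case: (ltngtP i l) => [il|il|->//].
        by have := el_mono gal i1 il; rewrite (e : el (Lambda M) i = _) ltxx.
      by have := el_mono gal l0 il; rewrite (e : el (Lambda M) i = _) ltxx.
    by move=> i i0; rewrite hk => /esym /(gal_disj gal l0 i0).
  exists (1 - (Pim `|1 - i|%N)%:Z); split.
    by move=> l l0 /(gal_disj gal l0 i0).
  move=> j j0; rewrite hk => e; case: (ltgtP i j) => [ij|ij|->//].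
    by have := @kk_mono _ _ gal i j; rewrite ij j0 => /(_ isT); rewrite e ltxx.
  by have := @kk_mono _ _ gal j i; rewrite ij i0 => /(_ isT); rewrite e ltxx.
have [x hx] := choice hz; exists x; split.
  by split=> i hi; [apply: (hx _).1|apply: (hx _).2].
move=> y [hy1 hy2]; apply/funext => z.
case: (gal_cover gal z) => [[l l0 <-]|[i i0 <-]].
  by rewrite (hy1 l l0 : y (el (Lambda M) l) = _); apply: (hx _).1.
by rewrite -hk hy2 //; apply: (hx _).2.
Qed.

(** * Finite words coding a stretch of X together with the partition *)

Definition npos (f : seq int) : nat := count (fun x : int => 0 < x) f.
Definition nneg (f : seq int) : nat := count (fun x : int => x <= 0) f.
Arguments npos : simpl never.
Arguments nneg : simpl never.

Lemma npos_cons (x : int) (f : seq int) : npos (x :: f) = ((0 < x)%R + npos f)%N. Proof. by []. Qed.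
Lemma nneg_cons (x : int) (f : seq int) : nneg (x :: f) = ((x <= 0)%R + nneg f)%N. Proof. by []. Qed.

Lemma nneg_cat (s t : seq int) : nneg (s ++ t) = (nneg s + nneg t)%N.
Proof. exact: count_cat. Qed.

Lemma npos_nneg (f : seq int)  : (npos f + nneg f = size f)%N.
Proof.
rewrite /npos -(count_predC (fun x : int => 0 < x) f); congr (_ + _)%N.
by apply: eq_count => x /=; rewrite leNgt.
Qed.

Definition fpos (f : seq int) : seq int := seq.filter (fun x : int => 0 < x) f.
Definition fneg (f : seq int) : seq int := seq.filter (fun x : int => x <= 0) f.

(* A word f stands for the values of X on an interval of positions: positive letters *)
(* are the positions ell_i, the others the positions k_i.  lam f lists the row       *)
(* lengths of Lambda (non-positive letters after each positive one), and mu f the     *)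
(* column lengths, read from right to left.                                          *)
Fixpoint lam (f : seq int) : seq nat :=
  if f is x :: f' then if 0 < x then nneg f' :: lam f' else lam f' else [::].
Fixpoint mu (f : seq int) : seq nat :=
  if f is x :: f' then if 0 < x then map S (mu f') else rcons (mu f') 0%N else [::].

Definition nth1 (s : seq nat) (l : nat) : nat := if l is l'.+1 then nth 0%N s l' else 0%N.

Lemma size_mu (f : seq int)  : size (mu f) = nneg f.
Proof.
elim: f => //= x f IH; rewrite nneg_cons leNgt; case: ifP => /= _; first by rewrite size_map.
by rewrite size_rcons IH.
Qed.

Lemma lam_le (f : seq int) y : y \in lam f -> (y <= nneg f)%N.
Proof.
elim: f => //= x f IH; rewrite nneg_cons; case: ifP => _; last by move/IH; lia.
by rewrite in_cons => /orP[/eqP->|/IH]; lia.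
Qed.

Lemma nth_rcons0 (s : seq nat) i : nth 0%N (rcons s 0%N) i = nth 0%N s i.
Proof.
rewrite nth_rcons; case: ltngtP => // h; rewrite nth_default //; last by rewrite h.
exact: ltnW.
Qed.

(** Read as a lattice path with one step for each letter, [f] bounds a Young diagram whose rows are
    [lam f] and whose columns are [mu f]. *)
Lemma gal_word (f : seq int) l j : (0 < l)%N -> (0 < j)%N ->
  (j <= nth1 (lam f) l)%N = (l <= nth1 (mu f) j)%N.
Proof.
case: l => // l _; case: j => // j _ /=.
elim: f l => [|x f IH] l /=; first by rewrite !nth_nil.
case: ifP => _; last by rewrite nth_rcons0.
case: (ltnP j (nneg f)) => hj.
  rewrite (nth_map 0%N) ?size_mu // ltnS; case: l => [|l] /=; first by rewrite hj.
  exact: IH.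
rewrite (nth_default _ (s := map S _)) ?size_map ?size_mu //.
case: l => [|l] /=; first by rewrite ltnNge hj.
case: (ltnP l (size (lam f))) => hl; last by rewrite nth_default.
by apply/negbTE; rewrite -ltnNge ltnS (leq_trans (lam_le (mem_nth 0%N hl))).
Qed.

Lemma nth_lam (f : seq int) p : (p < size f)%N -> 0 < nth 0 f p ->
  nth 0%N (lam f) (npos (take p f)) = nneg (drop p f).
Proof.
elim: f p => // x f IH [|p] /=; rewrite ?ltnS => hp.
  by move=> x0; rewrite x0 /= nneg_cons leNgt x0.
by move=> h; rewrite npos_cons; case: ifP => _ /=; apply: IH.
Qed.

Lemma nth_mu (f : seq int) p : (p < size f)%N -> nth 0 f p <= 0 ->
  nth1 (mu f) (nneg (drop p f)) = npos (take p f).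
Proof.
elim: f p => // x f IH [|p] /=; rewrite ?ltnS => hp.
  by move=> x0; rewrite ltNge x0 /= nneg_cons x0 /= nth_rcons0 nth_default ?size_mu.
move=> h; rewrite npos_cons; have := IH _ hp h.
have h1 : (0 < nneg (drop p f) <= nneg f)%N.
  rewrite (drop_nth 0) // nneg_cons h /= -[X in (_ <= nneg X)%N](cat_take_drop p f).
  by rewrite nneg_cat (drop_nth 0 hp) nneg_cons h leq_addl.
case: (nneg (drop p f)) h1 => // j hj /=.
case: ifP => _ /=; last by rewrite nth_rcons0.
by rewrite (nth_map 0%N) ?size_mu // => ->.
Qed.

(** The positive and the non-positive letters before index [p] together number [p]; the same count
    underlies [kk_word]. Thus both kinds of letters sit at the integer [p + 1 - nneg f], and the
    word covers contiguous positions. *)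
Lemma el_word (f : seq int) p : (p < size f)%N -> 0 < nth 0 f p ->
  el (nth1 (lam f)) (npos (take p f)).+1 = p%:Z + 1 - (nneg f)%:Z.
Proof.
move=> hp h; rewrite /el /= nth_lam //.
have := nneg_cat (take p f) (drop p f); rewrite cat_take_drop.
have := npos_nneg (take p f); rewrite size_takel; last exact: ltnW.
lia.
Qed.

Lemma kk_word (f : seq int) p : (p < size f)%N -> nth 0 f p <= 0 ->
  kk (nth1 (mu f)) (1 - (nneg (drop p f))%:Z) = p%:Z + 1 - (nneg f)%:Z.
Proof.
move=> hp h; have h0 : (0 < nneg (drop p f))%N by rewrite (drop_nth 0) // nneg_cons h.
rewrite /kk ifN; last by lia.
rewrite (_ : absz _ = nneg (drop p f)); last by lia.
rewrite nth_mu //.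
have := nneg_cat (take p f) (drop p f); rewrite cat_take_drop.
have := npos_nneg (take p f); rewrite size_takel; last exact: ltnW.
lia.
Qed.

Lemma set_size_nth1 (s : seq nat) i : (0 < i)%N ->
  set_size [set j | (1 <= j)%N /\ nth1 s j = i] (count_mem i s).
Proof.
move=> i0; exists [seq k.+1 | k <- iota 0 (size s) & nth 0%N s k == i]; split.
- by rewrite map_inj_uniq ?filter_uniq ?iota_uniq // => a b [].
- rewrite size_map size_filter -[in RHS](mkseq_nth 0%N s) /mkseq count_map.
  by apply: eq_count.
apply/seteqP; split => j /=.
  case: j => [[]//|j [_ /= e]]; apply/map_f; rewrite mem_filter e eqxx mem_iota /=.
  by rewrite ltnNge; apply/negP => h; rewrite nth_default in e => //; lia.
by move=> /mapP[k]; rewrite mem_filter => /andP[/eqP e _] ->.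
Qed.

Lemma LSpec_word M (f : seq int) : (forall i, (0 < i)%N -> M i = count_mem i (lam f)) ->
  LSpec M (nth1 (lam f)).
Proof.
move=> hM; split => //; split; last by move=> i i0; rewrite hM //; exact: set_size_nth1.
by move=> j j0; apply: (gal_noninc (@gal_word f)).
Qed.

(** A positive letter before a non-positive one is always an inversion and the opposite order never
    is, so the mixed inversions are the cells of the diagram. *)
Lemma linv_word (f : seq int)  : linv f =
  (linv (fpos f) + linv (fneg f) + sumn (lam f))%N.
Proof.
elim: f => //= x f ->; rewrite (leNgt x); case: ifP => x0 /=.
  have -> : nlt x f = (nlt x (fpos f) + nneg f)%N; last by rewrite -/(fpos f) -/(fneg f); lia.
  elim: f => //= y f IH; rewrite !nlt_cons nneg_cons (leNgt y); case: ifP => y0 /=.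
    by rewrite nlt_cons IH -/(fpos f); lia.
  by rewrite IH -/(fpos f); have -> : (y < x) = true; lia.
have -> : nlt x f = nlt x (fneg f); last by rewrite -/(fpos f) -/(fneg f); lia.
elim: f => //= y f IH; rewrite !nlt_cons (leNgt y); case: ifP => y0 /=.
  by rewrite nlt_cons IH.
by rewrite -/(fneg f) -IH; have -> : (y < x) = false; lia.
Qed.

(** Inverse of reading a word: a non-positive letter with [n] non-positive letters from it onwards
    is directly preceded by the [M n] positive letters whose rows have length [n]. The empty rows
    come last. *)
Fixpoint build (M : nat -> nat) (n : nat) (gp gm : seq int) : seq int :=
  if n is n'.+1 then
    take (M n) gp ++ head 0 gm :: build M n' (drop (M n) gp) (behead gm)
  else gp.

Lemma lam_cat_pos (s t : seq int) : all (fun x : int => 0 < x) s ->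
  lam (s ++ t) = nseq (size s) (nneg t) ++ lam t.
Proof.
elim: s => //= x s IH /andP[-> hs]; rewrite IH //=; congr (_ :: _).
rewrite nneg_cat (_ : nneg s = 0%N) //; apply/eqP; rewrite -leqn0 leqNgt -has_count.
by apply/hasPn => y /(allP hs); rewrite ltNge.
Qed.

Lemma buildP M n (gp gm : seq int) : all (fun x : int => 0 < x) gp -> all (fun x : int => x <= 0) gm ->
  size gm = n -> (\sum_(1 <= i < n.+1) M i <= size gp)%N ->
  [/\ fpos (build M n gp gm) = gp,
      fneg (build M n gp gm) = gm &
      forall i, (0 < i)%N -> count_mem i (lam (build M n gp gm)) = if (i <= n)%N then M i else 0%N].
Proof.
elim: n gp gm => [|n IH] gp gm.
  move=> hp hm /size0nil -> _; split => /=; rewrite /fpos /fneg.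
  - exact/all_filterP.
  - rewrite (eq_in_filter (a2 := pred0)) ?filter_pred0 // => x /(allP hp) /=.
    by rewrite leNgt => ->.
  move=> i i0; rewrite leqn0 gtn_eqF // -[gp]cats0 lam_cat_pos //= cats0.
  by rewrite count_nseq /= -[nneg [::]]/0%N [0%N == i]eq_sym eqn0Ngt i0.
case: gm => // g gm hp /= /andP[g0 hm] [sz].
rewrite big_nat_recr //= => hM.
have hM1 : (M n.+1 <= size gp)%N by apply: leq_trans hM; rewrite leq_addl.
have hp1 : all (fun x : int => 0 < x) (take (M n.+1) gp) by apply/allP => x /mem_take /(allP hp).
have hp2 : all (fun x : int => 0 < x) (drop (M n.+1) gp) by apply/allP => x /mem_drop /(allP hp).
have [|e1 e2 e3] := IH (drop (M n.+1) gp) gm hp2 hm sz; first by rewrite size_drop; lia.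
rewrite /fpos /fneg in e1 e2 *; split.
- rewrite filter_cat /= ltNge g0 /= e1 (all_filterP hp1); exact: cat_take_drop.
- rewrite filter_cat /= g0 e2 (eq_in_filter (a2 := pred0)) ?filter_pred0 // => x /(allP hp1) /=.
  by rewrite leNgt => ->.
move=> i i0; rewrite lam_cat_pos // count_cat count_nseq size_takel //= ltNge g0 /= e3 //.
rewrite nneg_cons g0 /nneg -size_filter e2 sz.
rewrite /= eq_sym; case: (ltngtP i n.+1) => [h|h|->] /=.
- by rewrite mul0n add0n -ltnS h.
- by rewrite mul0n add0n leqNgt ltnW.
- by rewrite mul1n ltnn addn0.
Qed.

(** * One-sided Mallows permutations and the trials they inspect *)

Section MallowsN.
Variable B : nat -> nat -> bool.

Lemma mnext_some i s : (exists j, [&& (0 < j)%N, j \notin s & B i j]) ->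
  [/\ (0 < mnext B i s)%N, mnext B i s \notin s, B i (mnext B i s) &
      forall j, (0 < j)%N -> j \notin s -> B i j -> (mnext B i s <= j)%N].
Proof.
move=> h; rewrite /mnext; case: pselect => // h'; case: ex_minnP => m /and3P[h1 h2 h3] hmin.
by split => // j j0 js bj; apply: hmin; rewrite j0 js bj.
Qed.

Lemma mnext_none i s : (forall j, (0 < j)%N -> j \notin s -> ~~ B i j) -> mnext B i s = 0%N.
Proof.
move=> h; rewrite /mnext; case: pselect => // h'; exfalso; case: h' => j /and3P[h1 h2 h3].
by have := h _ h1 h2; rewrite h3.
Qed.

Lemma mallowsNS n : mallowsN B n.+1 = mnext B n.+1 (mseq B n).
Proof. by rewrite /mallowsN /= last_rcons. Qed.

Lemma mseqS n : mseq B n.+1 = rcons (mseq B n) (mallowsN B n.+1).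
Proof. by rewrite mallowsNS. Qed.

Lemma mseqE n : mseq B n = [seq mallowsN B i | i <- iota 1 n].
Proof. by elim: n => // n IH; rewrite mseqS IH -[n.+1 in RHS]addn1 iotaD map_cat cats1 add1n. Qed.

(** Infinitely many ones in each row make every choice well defined; infinitely many in each column
    make every value occur. *)
Definition goodB := (forall i n, (0 < i)%N -> exists2 j, (n < j)%N & B i j) /\
                    (forall j n, (0 < j)%N -> exists2 i, (n < i)%N & B i j).

Hypothesis gB : goodB.

Lemma mnext_good n : exists j, [&& (0 < j)%N, j \notin mseq B n & B n.+1 j].
Proof.
have [j hj bj] := gB.1 n.+1 (sumn (mseq B n)) isT; exists j; rewrite bj (leq_trans _ hj) // andbT /=.
apply/negP => js; move: hj; rewrite ltnNge sumnE (big_rem j) //= leq_addr //.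
Qed.

Lemma mallowsN_gt0 i : (0 < i)%N -> (0 < mallowsN B i)%N.
Proof. by case: i => // i _; rewrite mallowsNS; case: (mnext_some (mnext_good i)). Qed.

Lemma mseq_uniq n : uniq (mseq B n).
Proof.
elim: n => // n IH; rewrite mseqS rcons_uniq IH andbT mallowsNS.
by case: (mnext_some (mnext_good n)).
Qed.

Lemma mallowsN_inj i j : (0 < i)%N -> (0 < j)%N -> mallowsN B i = mallowsN B j -> i = j.
Proof.
wlog ij : i j / (i < j)%N => [W i0 j0 e|i0 _ e].
  by case: (ltngtP i j) => // h; [apply: W|apply/esym/W].
have := mseq_uniq j; case: j ij e => // j; rewrite ltnS => ij e.
rewrite mseqS rcons_uniq -e mseqE => /andP[/negP[]].
by apply/map_f; rewrite mem_iota; lia.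
Qed.

(** If [v] never occurred, each of the infinitely many rows with a one in column [v] would choose a
    value below [v]. Rows choose distinct values, and only [v - 1] are available. *)
Lemma mallowsN_surj v : (0 < v)%N -> exists2 i, (0 < i)%N & mallowsN B i = v.
Proof.
move=> v0; apply: contrapT => hN.
have hN' i : (0 < i)%N -> mallowsN B i <> v by move=> i0 e; apply: hN; exists i.
have hle i : (0 < i)%N -> B i v -> (0 < mallowsN B i < v)%N.
  case: i => // i _ bi; apply/andP; split; first exact: mallowsN_gt0.
  rewrite ltn_neqAle; apply/andP; split; first by apply/eqP/hN'.
  rewrite mallowsNS; case: (mnext_some (mnext_good i)) => _ _ _; apply => //.
  by rewrite mseqE; apply/mapP => -[k]; rewrite mem_iota => hk e; apply: (hN' k) => //; lia.
have hex n : exists i, (n < i)%N /\ B i v by have [i h1 h2] := gB.2 v n v0; exists i.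
have [h hh] := choice hex.
pose g k := iter k.+1 h 0%N.
have gm : {homo g : a b / (a < b)%N}.
  apply: homo_ltn => [x y z|n]; [exact: ltn_trans|exact: (hh _).1].
have g0 k : (0 < g k)%N by rewrite /g iterS; apply: leq_ltn_trans (hh _).1.
have u : uniq [seq mallowsN B (g k) | k <- iota 0 v].
  rewrite map_inj_uniq ?iota_uniq // => a b /(mallowsN_inj (g0 a) (g0 b)).
  by move=> e; case: (ltngtP a b) => // /gm; rewrite e ltnn.
have /(uniq_leq_size u) : {subset [seq mallowsN B (g k) | k <- iota 0 v] <= iota 1 v.-1}.
  by move=> x /mapP[k _ ->]; rewrite mem_iota; have := hle _ (g0 k) (hh _).2; lia.
by rewrite size_map !size_iota; lia.
Qed.
End MallowsN.

(* All values outside {1, ..., b}, including the junk value 0, are identified.        *)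
Definition clipN (b x : nat) : nat := if (0 < x <= b)%N then x else b.+1.

Definition rowasg (b i : nat) (s : seq nat) (x : nat) : seq ((nat * nat) * bool) :=
  [seq ((i, j), false) | j <- [seq j <- iota 1 b | (j \notin s) && (j < x)%N]] ++
  (if (x <= b)%N then [:: ((i, x), true)] else [::]).

(* The entries of the Bernoulli array that have to be inspected to see that the       *)
(* clipped Mallows sequence starts with g, together with their required values.      *)
Fixpoint asg (b i : nat) (s g : seq nat) : seq ((nat * nat) * bool) :=
  if g is x :: g' then rowasg b i s x ++ asg b i.+1 (x :: s) g' else [::].

Lemma rowasgP B b i s s' x : (0 < x <= b.+1)%N -> ((x <= b)%N -> x \notin s) ->
  (forall j, (0 < j <= b)%N -> (j \in s) = (j \in s')) ->
  (forall t, t \in rowasg b i s x -> B t.1.1 t.1.2 = t.2) <-> clipN b (mnext B i s') = x.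
Proof.
move=> hx xs ss.
have -> : (forall t, t \in rowasg b i s x -> B t.1.1 t.1.2 = t.2) <->
  (forall j, (0 < j <= b)%N -> j \notin s' -> (j < x)%N -> B i j = false) /\ ((x <= b)%N -> B i x).
  rewrite /rowasg; split.
    move=> h; split.
      move=> j hj js jx; apply: (h ((i, j), false)); rewrite mem_cat map_f //.
      by rewrite mem_filter ss // js jx mem_iota; lia.
    by move=> xb; apply: (h ((i, x), true)); rewrite mem_cat xb inE eqxx orbT.
  move=> [h1 h2] t; rewrite mem_cat => /orP[/mapP[j + ->]|].
    rewrite mem_filter mem_iota add1n ltnS => /andP[/andP[js jx] hj]; apply: h1 => //.
    by rewrite -ss.
  by case: ifP => // xb; rewrite inE => /eqP -> /=; apply: h2.
case: (pselect (exists j, [&& (0 < j)%N, j \notin s' & B i j])) => [h|hN].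
  have [m0 ms bm hm] := mnext_some h; set m := mnext B i s' in m0 ms bm hm *.
  split=> [[h1 h2]|e].
    rewrite /clipN; case: ifP => hmb.
      case: (ltngtP m x) => // hmx.
        by have := h1 m hmb ms hmx; rewrite bm.
      have xb : (x <= b)%N by lia.
      have := hm x; rewrite -ss; last by lia.
      by rewrite xs // h2 //; lia.
    apply/eqP; rewrite eqn_leq (andP hx).2 andbT ltnNge; apply/negP => xb.
    have := hm x; rewrite -ss; last by lia.
    by rewrite xs // h2 //; move: hmb; lia.
  move: e; rewrite /clipN; case: ifP => hmb e.
    split; last by rewrite -e.
    move=> j hj js jx; apply/negP => bj; have := hm j _ js bj; lia.
  split; last by lia.
  move=> j hj js jx; apply/negP => bj; have := hm j _ js bj; lia.
have hN' j : (0 < j)%N -> j \notin s' -> ~~ B i j.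
  by move=> j0 js; apply/negP => bj; apply: hN; exists j; rewrite j0 js.
rewrite (mnext_none hN') /clipN /=; split=> [[_ h2]|e].
  case: (leqP x b) => xb; last by lia.
  have x0 : (0 < x <= b)%N by lia.
  by have := hN' x (andP x0).1; rewrite -ss // xs // h2 // => /(_ isT).
by split=> [j hj js jx|]; [apply/negbTE/hN' => //; lia|lia].
Qed.

Lemma asgP B b i s g :
  all (fun x => 0 < x <= b.+1)%N g -> uniq [seq x <- g | (x <= b)%N] ->
  (forall x, x \in g -> (x <= b)%N -> x \notin s) ->
  (forall j, (0 < j <= b)%N -> (j \in s) = (j \in mseq B i)) ->
  (forall t, t \in asg b i.+1 s g -> B t.1.1 t.1.2 = t.2) <->
  (forall k, (k < size g)%N -> clipN b (mallowsN B (i + k).+1) = nth 0%N g k).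
Proof.
elim: g i s => [|x g IH] i s /=; first by [].
move=> /andP[hx hg] ug gs ss.
have xs : (x <= b)%N -> x \notin s by apply: gs; rewrite mem_head.
have hrow := rowasgP B i.+1 hx xs ss; rewrite -mallowsNS in hrow.
have ug' : uniq [seq x <- g | (x <= b)%N] by move: ug; case: ifP => //= _ /andP[].
have gs' y : y \in g -> (y <= b)%N -> y \notin x :: s.
  move=> yg yb; rewrite in_cons negb_or gs ?in_cons ?yg ?orbT // andbT.
  apply/eqP => e; move: ug; rewrite -e yb /= mem_filter yb yg //.
have hS : clipN b (mallowsN B i.+1) = x ->
    forall j, (0 < j <= b)%N -> (j \in x :: s) = (j \in mseq B i.+1).
  move=> e j hj; rewrite mseqS mem_rcons !in_cons ss //; congr (_ || _).
  by move: e; rewrite /clipN; case: ifP => hm e; apply/eqP/eqP; lia.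
split.
  move=> h; have e : clipN b (mallowsN B i.+1) = x.
    by apply/hrow => t ht; apply: h; rewrite mem_cat ht.
  have {}IH := IH i.+1 (x :: s) hg ug' gs' (hS e).
  case=> [_|k]; first by rewrite addn0.
  rewrite ltnS addnS -addSn; apply: (proj1 IH) => t ht; apply: h.
  by rewrite mem_cat ht orbT.
move=> h; have e : clipN b (mallowsN B i.+1) = x by have := h 0%N isT; rewrite addn0.
have {}IH := IH i.+1 (x :: s) hg ug' gs' (hS e).
move=> t; rewrite mem_cat => /orP[|]; first exact: (proj2 hrow e).
by apply: (proj2 IH) => k hk; have := h k.+1 hk; rewrite addnS -addSn.
Qed.

Lemma asg_keys b i s g t : t \in asg b i s g -> (i <= t.1.1)%N.
Proof.
elim: g i s => //= x g IH i s; rewrite mem_cat => /orP[|/IH]; last by lia.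
rewrite mem_cat => /orP[/mapP[j _ ->]//|]; case: ifP => // _; by rewrite inE => /eqP ->.
Qed.

Lemma asg_valid b i s g t : (0 < i)%N -> all (fun x => 0 < x)%N g ->
  t \in asg b i s g -> (0 < t.1.1)%N && (0 < t.1.2)%N.
Proof.
move=> i0 hg ht; have := asg_keys ht; move=> h; rewrite (leq_trans i0 h) /=.
elim: g i s hg ht {i0 h} => //= x g IH i s /andP[x0 hg]; rewrite mem_cat => /orP[|/(IH _ _ hg)//].
rewrite mem_cat => /orP[/mapP[j + ->]|]; first by rewrite mem_filter mem_iota /=; lia.
by case: ifP => // _; rewrite inE => /eqP ->.
Qed.

Lemma asg_uniq b i s g : uniq [seq t.1 | t <- asg b i s g].
Proof.
elim: g i s => //= x g IH i s; rewrite map_cat cat_uniq IH andbT; apply/andP; split.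
  rewrite /rowasg map_cat -map_comp cat_uniq; apply/and3P; split.
  - by rewrite map_inj_uniq ?filter_uniq ?iota_uniq // => a c [].
  - case: ifP => // _; rewrite /= orbF; apply/mapP => -[j]; rewrite mem_filter => /andP[/andP[_ jx] _] [] e.
    by rewrite e ltnn in jx.
  - by case: ifP.
apply/hasPn => k /mapP[t /asg_keys ht ->]; apply/mapP => -[t' + e].
rewrite mem_cat => /orP[/mapP[j _ e']|]; first by move: ht; rewrite e e' ltnn.
by case: ifP => // _; rewrite inE => /eqP e'; move: ht; rewrite e e' ltnn.
Qed.

Lemma asg_false b i s g :
  all (fun x => 0 < x <= b.+1)%N g ->
  perm_eq [seq x <- g | (x <= b)%N] [seq j <- iota 1 b | j \notin s] ->
  count (fun t => ~~ t.2) (asg b i s g) = linv (map Posz g).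
Proof.
elim: g i s => //= x g IH i s /andP[hx hg] hp.
have hp' : perm_eq [seq x <- g | (x <= b)%N] [seq j <- iota 1 b | j \notin x :: s].
  have -> : [seq j <- iota 1 b | j \notin x :: s] = [seq j <- [seq j <- iota 1 b | j \notin s] | j != x].
    by rewrite -filter_predI; apply: eq_filter => j /=; rewrite in_cons negb_or.
  case: ifP hp => xb hp; last first.
    rewrite (perm_trans hp) // (eq_in_filter (a2 := predT)) ?filter_predT // => j.
    by rewrite mem_filter mem_iota /=; lia.
  have hp2 := perm_filter (predC1 x) hp; rewrite (perm_trans _ hp2) //= eqxx /=.
  rewrite (_ : [seq x0 <- [seq x0 <- g | (x0 <= b)%N] | predC1 x x0] = [seq x0 <- g | (x0 <= b)%N]) //.
  apply/all_filterP/allP => j jg /=.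
  have : uniq (x :: [seq x <- g | (x <= b)%N]) by rewrite (perm_uniq hp) filter_uniq // iota_uniq.
  by move=> /= /andP[+ _]; apply: contraNneq => <-.
rewrite count_cat (IH _ _ hg hp'); congr (_ + _)%N.
rewrite /rowasg count_cat count_map (eq_count (a2 := xpredT)) // count_predT.
rewrite (_ : count _ (if _ then _ else _) = 0%N); last by case: ifP.
rewrite addn0 /nlt count_map (eq_count (a2 := fun y => (y < x)%N)) //.
rewrite -size_filter.
have -> : [seq j <- iota 1 b | (j \notin s) && (j < x)%N] =
    [seq j <- [seq j <- iota 1 b | j \notin x :: s] | (j < x)%N].
  rewrite -filter_predI; apply: eq_filter => j /=; rewrite in_cons negb_or andbC.
  by case: ltngtP => //=; rewrite ?andbF.
rewrite -(perm_size (perm_filter (fun j => (j < x)%N) hp')) -filter_predI.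
rewrite (eq_filter (a2 := fun j => (j < x)%N)) ?size_filter // => j /=.
by apply/andP/idP => [[]//|h]; split => //; lia.
Qed.

Lemma asg_true b i s g : count (fun t => t.2) (asg b i s g) = count (fun x => x <= b)%N g.
Proof.
elim: g i s => //= x g IH i s; rewrite count_cat IH; congr (_ + _)%N.
rewrite /rowasg count_cat count_map (eq_count (a2 := pred0)) // count_pred0.
by case: ifP.
Qed.

Lemma least_above (S : int -> Prop) (y : int) : (exists2 z, y < z & S z) ->
  exists z, [/\ y < z, S z & forall x, y < x -> x < z -> ~ S x].
Proof.
move=> [z0 yz0 Sz0]; have ex : exists n, `[< S (y + n.+1%:Z) >].
  by exists `|z0 - y|.-1; apply/asboolP; rewrite (_ : _ + _ = z0) //; lia.
case: (ex_minnP ex) => n /asboolP hn hmin; exists (y + n.+1%:Z); split => //; first by lia.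
move=> x yx xz Sx; have := hmin `|x - y|.-1; suff h : `[< S (y + `|x - y|.-1.+1%:Z) >].
  by move/(_ h); lia.
by apply/asboolP; rewrite (_ : _ + _ = x) //; lia.
Qed.

Lemma greatest_below (S : int -> Prop) (y : int) : (exists2 z, z < y & S z) ->
  exists z, [/\ z < y, S z & forall x, z < x -> x < y -> ~ S x].
Proof.
move=> [z0 yz0 Sz0]; have [|z [h1 h2 h3]] := @least_above (fun x => S (- x)) (- y).
  by exists (- z0); [lia|rewrite opprK].
exists (- z); split => //; first by lia.
by move=> x zx xy; have := h3 (- x); rewrite opprK; apply; lia.
Qed.

(** * Records *)

Section Records.
Variable sg : int -> int.

(* U0, Uup and Udn describe the record enumeration by countably many quantifiers over *)
(* integers, which makes its measurability apparent.                                *)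
Definition RSpec (r : int -> int) :=
  [/\ (forall i j : int, i < j -> r i < r j),
      (forall z, is_record sg z <-> exists k, r k = z) &
      sg (r 0) <= 0 < sg (r 1)].

Definition nextr (y z : int) := [/\ y < z, is_record sg y, is_record sg z &
  forall x, y < x -> x < z -> ~ is_record sg x].
Definition U0 (z : int) := [/\ is_record sg z, sg z <= 0 &
  forall y, z < y -> is_record sg y -> 0 < sg y].
Fixpoint Uup (n : nat) (z : int) : Prop :=
  if n is n'.+1 then exists2 y, Uup n' y & nextr y z else U0 z.
Fixpoint Udn (n : nat) (z : int) : Prop :=
  if n is n'.+1 then exists2 y, Udn n' y & nextr z y else U0 z.
Definition Ur (k : int) : int -> Prop :=
  match k with Posz n => Uup n | Negz n => Udn n.+1 end.

Lemma U0_fun z z' : U0 z -> U0 z' -> z = z'.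
Proof.
wlog h : z z' / z < z' => [W h h'|[_ _ h1] [h2 h3 _]]; last by have := h1 _ h h2; lia.
by case: (ltgtP z z') => // hl; [apply: W|apply/esym/W].
Qed.

Lemma nextr_funr y z z' : nextr y z -> nextr y z' -> z = z'.
Proof.
wlog h : z z' / z < z' => [W h h'|[h1 _ h2 _] [_ _ _ h3]]; last by case: (h3 z).
by case: (ltgtP z z') => // hl; [apply: W|apply/esym/W].
Qed.

Lemma nextr_funl y z z' : nextr z y -> nextr z' y -> z = z'.
Proof.
wlog h : z z' / z < z' => [W h h'|[_ _ _ h3] [h1 h2 _ _]]; last by case: (h3 z').
by case: (ltgtP z z') => // hl; [apply: W|apply/esym/W].
Qed.

Lemma Ur_fun k z z' : Ur k z -> Ur k z' -> z = z'.
Proof.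
case: k => n.
  elim: n z z' => [|n IH] z z' /=; first exact: U0_fun.
  by move=> [y h1 h2] [y' h3 h4]; rewrite (IH _ _ h1 h3) in h2; exact: nextr_funr h2 h4.
rewrite /Ur; elim: n.+1 z z' => [|m IH] z z' /=; first exact: U0_fun.
by move=> [y h1 h2] [y' h3 h4]; rewrite (IH _ _ h1 h3) in h2; exact: nextr_funl h2 h4.
Qed.

Lemma Ur_next k y z : Ur k y -> Ur (k + 1) z -> nextr y z.
Proof.
case: k => n.
  rewrite (_ : Posz n + 1 = Posz n.+1); last by lia.
  by move=> hy [y' h1 h2]; rewrite (@Ur_fun (Posz n) y y').
case: n => [|n].
  by rewrite (_ : Negz 0 + 1 = Posz 0) // => -[y' h1 h2] /(U0_fun h1) <-.
rewrite (_ : Negz n.+1 + 1 = Negz n); last by lia.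
by move=> [y' h1 h2] hz; rewrite (@Ur_fun (Negz n) z y').
Qed.

Lemma RSpec_Ur r : RSpec r -> forall k, Ur k (r k).
Proof.
move=> [h1 h2 /andP[h3 h4]].
have rec k : is_record sg (r k) by apply/h2; exists k.
have hinj (i j : int) : r i < r j -> i < j.
  by case: (ltgtP i j) => [//|/h1|->]; [lia|rewrite ltxx].
have nx k : nextr (r k) (r (k + 1)).
  split => //; first by apply: h1; lia.
  by move=> x h5 h6 /h2 [j e]; move: h5 h6; rewrite -e => /hinj ? /hinj; lia.
have u0 : U0 (r 0).
  split => // y + /h2[j e]; rewrite -e => /hinj j0.
  case: (eqVneq j 1) => [->//|j1]; apply: lt_trans h4 _; apply: rec; apply: h1; lia.
case=> n.
  elim: n => // n IH; exists (r (Posz n)) => //.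
  by have := nx (Posz n); rewrite (_ : Posz n + 1 = Posz n.+1) //; lia.
rewrite /Ur (_ : Negz n = - n.+1%:Z) //; elim: n.+1 => // m IH; exists (r (- m%:Z)) => //.
by have := nx (- m.+1%:Z); rewrite (_ : _ + 1 = - m%:Z) //; lia.
Qed.

Lemma Ur_RSpec : (forall k, exists z, Ur k z) -> exists2 r, RSpec r & forall k, Ur k (r k).
Proof.
move=> /choice[r hr]; exists r => //.
have nx k : nextr (r k) (r (k + 1)) by exact: Ur_next (hr k) (hr (k + 1)).
have hstep (k : int) (n : nat) : r k + n%:Z <= r (k + n%:Z).
  elim: n => [|n IH]; first by rewrite !addr0.
  by have [+ _ _ _] := nx (k + n%:Z); rewrite (_ : k + n%:Z + 1 = k + n.+1%:Z); lia.
have h1 (i j : int) : i < j -> r i < r j.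
  move=> ij; have := hstep i `|j - i|%N; rewrite (_ : i + `|j - i|%N%:Z = j); lia.
split => //.
- move=> z; split => [hz|[k <-]]; last by case: (nx k).
  (* Successive records are at least one apart, so [z] lies between [r (- D)] and [r (D + 1)]. The
     last index [k] with [r k <= z] then satisfies [r k = z], as no record lies strictly between
     consecutive ones. *)
  have [D hD] : exists D : nat, - D%:Z <= z - r 0 <= D%:Z by exists (absz (z - r 0)%R); lia.
  have hD' : r (- D%:Z) <= z by have := hstep (- D%:Z) D; rewrite addNr; move: hD; move: (r 0) (r (- D%:Z)) => a b; lia.
  have [k hk1 hk2] : exists2 k, r k <= z & z < r (k + 1).
    have [y [y1 y2 y3]] : exists y : int, [/\ y < D%:Z + 1, r y <= z &
        forall x : int, y < x -> x < D%:Z + 1 -> ~ (r x <= z)].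
      apply: (@greatest_below (fun x => r x <= z)); exists (- D%:Z) => //; lia.
    exists y => //; rewrite ltNge; apply/negP => h; case: (ltP (y + 1) (D%:Z + 1)) => hy.
      by apply: (y3 (y + 1)) => //; lia.
    have := hstep 0 D.+1; rewrite add0r.
    have -> : Posz D.+1 = y + 1 by lia.
    by move: h hD hy y1; move: (r 0) (r (y + 1)) => a b; lia.
  exists k; case: (nx k) => _ _ _ /(_ z) h; apply/eqP; rewrite eq_le hk1 /= leNgt.
  by apply/negP => h'; apply: h.
have [h2 h3 h4] : U0 (r 0) := hr 0.
by rewrite h3 /=; have [h5 _ h6 _] := nx 0; rewrite add0r in h5 h6; exact: h4.
Qed.

Lemma recordsP : (forall k, exists z, Ur k z) -> RSpec (records sg).
Proof.
move=> /Ur_RSpec [r h1 h2]; rewrite (_ : records sg = r) //; apply: the_or_eq => // r' /RSpec_Ur h3.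
by apply/funext => k; apply: Ur_fun (h3 k) (h2 k).
Qed.

Lemma records_none : ~ (forall k, exists z, Ur k z) -> records sg = fun=> 0.
Proof. by move=> h; apply: the_or_none => r /RSpec_Ur hr; apply: h => k; exists (r k). Qed.

Variable pos : int -> int.
Hypotheses (sgK : cancel sg pos) (posK : cancel pos sg).
Hypothesis hb : exists p0 : int, forall k : int, k < p0 -> sg k <= 0.

(** Each of the finitely many values between [v] and 0 is taken only once, so positions far enough
    to the left avoid them all. *)
Lemma sg_below (v : int) : exists p : int, forall k : int, k < p -> sg k <= v.
Proof.
have H (n : nat) : exists p : int, forall k : int, k < p -> sg k <= - n%:Z.
  elim: n => [|n [p hp]]; first by rewrite oppr0.
  exists (Num.min p (pos (- n%:Z))) => k; rewrite lt_min => /andP[/hp h1 h2].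
  have : sg k != - n%:Z by apply: contraTneq h2 => <-; rewrite sgK ltxx.
  lia.
by have [p hp] := H (absz v); exists p => k /hp; lia.
Qed.

(** While [p] is not a record, replace it by an earlier position with a larger value; by [sg_below]
    only finitely many positions are available. *)
Lemma runmax (p : int) : exists z : int, [/\ z <= p, is_record sg z & sg p <= sg z].
Proof.
have [p1 hp1] := sg_below (sg p - 1).
have [n hn] : exists n : nat, forall k : int, k < p - n%:Z -> sg k < sg p.
  exists (absz (p - p1)%R) => k hk; have := hp1 k; lia.
elim/ltn_ind: n p hn {hp1 p1} => n IH p hn.
case: (pselect (is_record sg p)) => [h|]; first by exists p.
move=> /existsNP[k] /not_implyP[kp /negP]; rewrite -leNgt => h.
have hlt : sg p < sg k by rewrite lt_neqAle h andbT; apply: contraTneq kp => /(can_inj sgK) ->; rewrite ltxx.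
have kn : p - n%:Z <= k by rewrite leNgt; apply/negP => /hn; lia.
have [||z [h1 h2 h3]] := IH (absz ((k : int) - (p - n%:Z))%R) _ k; first by lia.
  by move=> k' hk'; apply: lt_trans hlt; apply: hn; lia.
by exists z; split => //; lia.
Qed.

Lemma sg_bounded (p : int) : exists b : int, forall k : int, k <= p -> sg k <= b.
Proof.
have [p0 h0] := hb; have H (n : nat) : exists b : int, forall k : int, k < p0 + n%:Z -> sg k <= b.
  elim: n => [|n [b IH]]; first by exists 0; rewrite addr0.
  exists (Num.max b (sg (p0 + n%:Z))) => k hk; rewrite le_max.
  case: (eqVneq k (p0 + n%:Z)) => [->|ne]; first by rewrite lexx orbT.
  by rewrite IH //; lia.
by have [b hb'] := H (absz (p + 1 - p0)%R); exists b => k kp; apply: hb'; lia.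
Qed.

Lemma rec_above (p : int) : exists2 z : int, p < z & is_record sg z.
Proof.
have [b hb'] := sg_bounded p; have [z [h1 h2 h3]] := runmax (pos (b + 1)).
exists z => //; rewrite ltNge; apply/negP => /hb'; move: h3; rewrite posK; lia.
Qed.

Lemma rec_below (p : int) : exists2 z : int, z < p & is_record sg z.
Proof. by have [z [h1 h2 _]] := runmax (p - 1); exists z => //; lia. Qed.

Lemma Ur_exists k : exists z, Ur k z.
Proof.
have up y : is_record sg y -> exists z, nextr y z.
  by move=> hy; have [z [h1 h2 h3]] := least_above (rec_above y); exists z.
have dn y : is_record sg y -> exists z, nextr z y.
  by move=> hy; have [z [h1 h2 h3]] := greatest_below (rec_below y); exists z.
have [z0 hz0] : exists z, U0 z.
  have [z1 [_ r1 p1]] := runmax (pos 1); rewrite posK in p1.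
  have [p0 h0] := sg_below 0; have [z2 [q2 r2 _]] := runmax (p0 - 1).
  have s2 : sg z2 <= 0 by apply: h0; lia.
  have z21 : z2 < z1.
    case: (ltgtP z2 z1) => // [h|e]; first by have := r2 _ h; lia.
    by rewrite e in s2; lia.
  have [|z [h1 [h2 h3] h4]] := @greatest_below (fun x => is_record sg x /\ sg x <= 0) z1.
    by exists z2.
  exists z; split => // y zy ry; case: (ltgtP y z1) => [yz|/ry|->]; [|lia|lia].
  by rewrite ltNge; apply/negP => hy; apply: (h4 y).
case: k => n.
  elim: n => [|n [y hy]]; first by exists z0.
  have ry : is_record sg y by case: n hy => [[]|n [? _ []]].
  by have [z hz] := up y ry; exists z, y.
rewrite /Ur; elim: n.+1 => [|m [y hy]]; first by exists z0.
have ry : is_record sg y by case: m hy => [[]|m [? _ []]].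
by have [z hz] := dn y ry; exists z, y.
Qed.

Lemma records_spec : RSpec (records sg).
Proof. exact: recordsP Ur_exists. Qed.

Definition aval (k : int) : int := sg (records sg k).

Lemma aval_mono (i j : int) : i < j -> aval i < aval j.
Proof.
case: records_spec => h1 h2 _ ij; have : is_record sg (records sg j) by apply/h2; exists j.
by apply; apply: h1.
Qed.

Lemma aval_fst (k v : int) : aval k < v -> pos (aval k) < pos v.
Proof.
case: records_spec => h1 h2 _ h; have r : is_record sg (records sg k) by apply/h2; exists k.
rewrite /aval sgK ltNge le_eqVlt; apply/negP => /orP[/eqP e|/r].
  by move: h; rewrite /aval -e posK ltxx.
by rewrite posK; move: h; rewrite /aval; lia.
Qed.

(** If [v] were visited before the next record, [runmax] started at the position of [v] would yield
    a record strictly between two consecutive ones. *)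
Lemma aval_next (k v : int) : aval k < v -> v != aval (k + 1) -> pos (aval (k + 1)) < pos v.
Proof.
case: records_spec => h1 h2 _ h ne; rewrite ltNge le_eqVlt; apply/negP => /orP[/eqP /(can_inj posK) e|hlt].
  by rewrite e eqxx in ne.
have [z [z1 /h2[j e] z3]] := runmax (pos v); rewrite posK in z3.
move: z1 z3; rewrite -e -/(aval j) => z1 z3.
have kj : k < j by rewrite ltNge le_eqVlt; apply/negP => /orP[/eqP ej|/aval_mono]; [rewrite ej in z3|]; lia.
have : records sg j < records sg (k + 1) by apply: le_lt_trans z1 _; rewrite /aval sgK in hlt.
case: (ltgtP j (k + 1)) => [|/h1|->]; lia.
Qed.

(** With [aval_fst], this makes being a record value a property of the order of visits to the larger
    values. *)
Lemma fst_aval (c : int) : (forall v : int, c < v -> pos c < pos v) -> exists k, c = aval k.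
Proof.
move=> h; case: records_spec => _ h2 _; have /h2[k e] : is_record sg (pos c).
  move=> k hk; rewrite posK ltNge le_eqVlt; apply/negP => /orP[/eqP e|/h].
    by rewrite e sgK ltxx in hk.
  by rewrite sgK; lia.
by exists k; rewrite /aval e posK.
Qed.

Lemma sigma_block_eq (k : int) (s : seq int) : sorted (fun a b => pos a < pos b) s ->
  (forall v : int, v \in s <-> aval k < v < aval (k + 1)) -> sigma_block sg k = s.
Proof.
move=> hs hv; apply: the_or_eq.
  exists (map pos s); split.
  - by rewrite sorted_map.
  - move=> i; rewrite -[X in X \in _](sgK i) (mem_map (can_inj posK)); exact: hv.
  - by rewrite -map_comp map_id_in // => v _ /=; rewrite posK.
move=> y [idx [h1 h2 ->]]; suff -> : idx = map pos s.
  by rewrite -map_comp map_id_in // => v _ /=; rewrite posK.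
apply: lt_sorted_eq => //; first by rewrite sorted_map.
move=> i; apply/idP/idP.
  by move/h2/hv => hi; rewrite -(sgK i) map_f.
by rewrite -(sgK i) (mem_map (can_inj posK)) => /hv /h2; rewrite sgK.
Qed.
End Records.

(** * Order of visits, and words read off the two-sided permutation *)

Definition ordered (pos : int -> int) (s : seq int) := sorted (fun a b : int => pos a < pos b) s.

Lemma ordered_eq pos s s' : ordered pos s -> ordered pos s' -> s =i s' -> s = s'.
Proof.
apply: irr_sorted_eq => [y x z|x]; [exact: lt_trans|exact: ltxx].
Qed.

Lemma ordered_filter pos p s : ordered pos s -> ordered pos (seq.filter p s).
Proof. by apply: sorted_filter => y x z; exact: lt_trans. Qed.

Lemma ordered_exists pos (V : seq int) : injective pos -> uniq V ->
  exists2 s, perm_eq s V & ordered pos s.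
Proof.
move=> ip uV; exists (sort (fun a b => pos a <= pos b) V); first by rewrite perm_sort.
have hs : sorted (fun a b => pos a <= pos b) (sort (fun a b => pos a <= pos b) V).
  by apply: sort_sorted => a b; exact: le_total.
have hu : uniq (map pos (sort (fun a b => pos a <= pos b) V)).
  by rewrite map_inj_uniq // sort_uniq.
have : sorted <%R (map pos (sort (fun a b => pos a <= pos b) V)).
  by rewrite lt_sorted_uniq_le hu sorted_map.
by rewrite sorted_map.
Qed.

(** Non-positive values are clipped through the reflection x -> 1 - x that defines that half of X,
    so everything below [1 - a] becomes [- a]. *)
Definition clipZ (a b : nat) (x : int) : int :=
  if 0 < x then (clipN b (absz x))%:Z else 1 - (clipN a (absz (1 - x)%R))%:Z.

(** The initial segments of the two clipped one-sided permutations that [f] prescribes; [gm] is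
    reversed because Pi_- is read from right to left. *)
Definition gp (f : seq int) : seq nat := map absz (fpos f).
Definition gm (f : seq int) : seq nat := rev [seq absz (1 - x)%R | x <- fneg f].

Lemma nth_fpos (f : seq int) p : (p < size f)%N -> 0 < nth 0 f p ->
  nth 0 (fpos f) (npos (take p f)) = nth 0 f p.
Proof.
elim: f p => // x f IH [|p] /=; rewrite ?ltnS => hp h; rewrite /fpos /=; first by rewrite h.
by rewrite npos_cons; case: ifP => _ /=; apply: IH.
Qed.

Lemma nth_fneg (f : seq int) p : (p < size f)%N -> nth 0 f p <= 0 ->
  nth 0 (fneg f) (nneg (take p f)) = nth 0 f p.
Proof.
elim: f p => // x f IH [|p] /=; rewrite ?ltnS => hp h; rewrite /fneg /=; first by rewrite h.
by rewrite nneg_cons; case: ifP => _ /=; apply: IH.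
Qed.

Lemma size_gp f : size (gp f) = npos f. Proof. by rewrite size_map size_filter. Qed.
Lemma size_gm f : size (gm f) = nneg f. Proof. by rewrite size_rev size_map size_filter. Qed.

Section Good.
Variables (Bp Bm : nat -> nat -> bool) (M : nat -> nat).
Hypotheses (gBp : goodB Bp) (gBm : goodB Bm).
Let X := two_sided_mallows (mallowsN Bp) (mallowsN Bm) M.

Lemma X_pos : exists pos, cancel X pos /\ cancel pos X.
Proof.
have [c gal] := Lambda_gal M; have [h1 h2] := two_sided_spec (mallowsN Bp) (mallowsN Bm) gal.
rewrite -/X in h1 h2.
have surj v : exists z, X z = v.
  case: (ltP 0 v) => v0.
    have [|i i0 e] := mallowsN_surj gBp (v := absz v); first by lia.
    by exists (el (Lambda M) i); rewrite h1 // e; lia.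
  have [|j j0 e] := mallowsN_surj gBm (v := absz (1 - v)%R); first by lia.
  exists (kk c (1 - j%:Z)); rewrite h2; last by lia.
  by rewrite (_ : absz _ = j) ?e; lia.
have inj z z' : X z = X z' -> z = z'.
  case: (gal_cover gal z) => -[l l0 <-]; case: (gal_cover gal z') => -[l' l0' <-].
  - by rewrite !h1 // => -[] /(mallowsN_inj gBp l0 l0') ->.
  - by rewrite h1 // h2 //; have := mallowsN_gt0 gBp l0; have := @mallowsN_gt0 _ gBm `|1 - l'|; lia.
  - by rewrite h1 // h2 //; have := mallowsN_gt0 gBp l0'; have := @mallowsN_gt0 _ gBm `|1 - l|; lia.
  - rewrite !h2 // => e.
    have : mallowsN Bm `|1 - l| = mallowsN Bm `|1 - l'| by lia.
    move/(mallowsN_inj gBm) => e'; congr (kk c _); lia.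
have [pos hpos] := choice surj; exists pos; split => // z.
by apply: inj; rewrite hpos.
Qed.

Lemma X_bounded : exists p0 : int, forall k : int, k < p0 -> X k <= 0.
Proof.
have [c gal] := Lambda_gal M; have [h1 h2] := two_sided_spec (mallowsN Bp) (mallowsN Bm) gal.
rewrite -/X in h1 h2.
exists (el (Lambda M) 1) => k; case: (gal_cover gal k) => -[l l0 <-].
  case: (ltngtP l 1%N) => [|h|->]; rewrite ?ltxx //; first by lia.
  by have := el_mono gal (isT : (0 < 1)%N) h; lia.
by rewrite h2 //; have := @mallowsN_gt0 _ gBm `|1 - l|; lia.
Qed.

Variables (f : seq int) (a b : nat).
Hypotheses (hM : forall i, (0 < i)%N -> M i = count_mem i (lam f))
  (hp : forall k, (k < size (gp f))%N -> clipN b (mallowsN Bp (0 + k).+1) = nth 0%N (gp f) k)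
  (hm : forall k, (k < size (gm f))%N -> clipN a (mallowsN Bm (0 + k).+1) = nth 0%N (gm f) k).

(** The hypothesis on [M] makes [lam f] the partition and [mu f] its conjugate, so [el_word] and
    [kk_word] locate every letter. *)
Lemma X_word p : (p < size f)%N -> clipZ a b (X (p%:Z + 1 - (nneg f)%:Z)) = nth 0 f p.
Proof.
have hL := Lambda_eq (LSpec_word hM).
have gal : forall l j, (0 < l)%N -> (0 < j)%N ->
    (j <= Lambda M l)%N = (l <= nth1 (mu f) j)%N by move=> l j; rewrite hL; exact: gal_word.
have [h1 h2] := two_sided_spec (mallowsN Bp) (mallowsN Bm) gal; rewrite -/X in h1 h2.
move=> pf; case: (ltP 0 (nth 0 f p)) => h0.
  rewrite -(el_word pf h0) -hL h1 //.
  have l0 := mallowsN_gt0 gBp (isT : (0 < (npos (take p f)).+1)%N).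
  rewrite /clipZ ifT; last by lia.
  have hl : (npos (take p f) < npos f)%N.
    rewrite -[X in (_ < npos X)%N](cat_take_drop p f) /npos count_cat -/(npos _) (drop_nth 0 pf) /= h0.
    lia.
  rewrite /= -[X in clipN b (mallowsN Bp X.+1)]add0n hp ?size_gp // (nth_map 0); last by rewrite size_filter.
  by rewrite nth_fpos // gtz0_abs.
have j0 : (0 < nneg (drop p f))%N by rewrite (drop_nth 0 pf) nneg_cons h0.
rewrite -(kk_word pf h0) h2; last by lia.
rewrite (_ : absz _ = nneg (drop p f)); last by lia.
have l0 := mallowsN_gt0 gBm j0.
rewrite /clipZ ifF; last by lia.
rewrite (_ : absz _ = mallowsN Bm (nneg (drop p f))); last by lia.
have hcat : (nneg f = nneg (take p f) + nneg (drop p f))%N by rewrite -nneg_cat cat_take_drop.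
rewrite -[X in mallowsN Bm X](prednK j0) -[X in clipN a (mallowsN Bm X.+1)]add0n hm; last first.
  by rewrite size_gm; lia.
rewrite /gm nth_rev ?size_map ?size_filter -/(nneg f); last by lia.
rewrite (_ : (nneg f - _)%N = nneg (take p f)); last by lia.
rewrite (nth_map 0) ?size_filter -/(nneg f); last by lia.
by rewrite nth_fneg //; lia.
Qed.

(** Clipping fixes the values in [J] and sends no other value into [J], so the letters of [f] in [J]
    are true values of X, listed by increasing position. *)
Lemma word_ordered pos (J : pred int) : cancel X pos -> cancel pos X ->
  (forall x, J x -> 1 - a%:Z <= x <= b%:Z) -> ordered pos (seq.filter J f).
Proof.
move=> XK posK hJ.
pose ps := [seq p%:Z + 1 - (nneg f)%:Z | p <- iota 0 (size f)].
have hf : f = map (clipZ a b \o X) ps.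
  apply: (@eq_from_nth _ 0); rewrite ?size_map ?size_iota // => p pf.
  by rewrite -map_comp (nth_map 0%N) ?size_iota // nth_iota //= X_word.
have hclip x : J (clipZ a b x) -> clipZ a b x = x.
  move/hJ; rewrite /clipZ /clipN; case: ifP => x0; case: ifP => h; lia.
have hclip2 x : J x -> clipZ a b x = x.
  move/hJ; rewrite /clipZ /clipN; case: ifP => x0; case: ifP => h; lia.
have -> : seq.filter J f = map X [seq z <- ps | J (X z)].
  rewrite hf filter_map (eq_filter (a2 := fun z => J (X z))); last first.
    by move=> z /=; apply/idP/idP => h; [rewrite -(hclip _ h)|rewrite hclip2].
  by apply/eq_in_map => z; rewrite mem_filter => /andP[h _] /=; rewrite hclip2.
rewrite /ordered sorted_map.
rewrite (eq_sorted (e' := <%R)); last by move=> x y /=; rewrite !XK.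
apply: sorted_filter; first exact: lt_trans.
rewrite sorted_map; apply: sub_sorted (iota_ltn_sorted 0 (size f)) => x y /=; lia.
Qed.

End Good.

(* The multiset of letters of a word of length 2 L clipped to {1 - a, ..., b}.         *)
Definition wbase (a b L : nat) : seq int :=
  nseq (L - a) (- a%:Z) ++ window (1 - a%:Z) (a + b) ++ nseq (L - b) b.+1%:Z.

Lemma linv_rcons s x : linv (rcons s x) = (linv s + count (fun y : int => (x < y)%R) s)%N.
Proof. by elim: s => //= y s IH; rewrite IH /nlt -cats1 count_cat /= addn0; lia. Qed.

Lemma linv_rev_refl (s : seq int) : linv (rev [seq 1 - x | x <- s]) = linv s.
Proof.
elim: s => //= x s IH; rewrite rev_cons linv_rcons IH addnC; congr (_ + _)%N.
rewrite count_rev count_map; apply: eq_count => y /=; lia.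
Qed.

Section Base.
Variables (a b L : nat).

Lemma wbase_pos : fpos (wbase a b L) = map Posz (iota 1 b ++ nseq (L - b) b.+1).
Proof.
rewrite /fpos /wbase !filter_cat window_cat filter_cat.
rewrite (eq_in_filter (a2 := pred0)) ?filter_pred0; last first.
  by move=> x; rewrite mem_nseq => /andP[_ /eqP ->]; apply/negbTE; rewrite -leNgt; lia.
rewrite (eq_in_filter (a1 := fun x : int => 0 < x) (a2 := pred0) (s := window _ a)) ?filter_pred0; last first.
  by move=> x; rewrite mem_window /= => h; apply/negbTE; lia.
rewrite map_cat /=; congr (_ ++ _).
  rewrite (_ : 1 - a%:Z + a%:Z = 1); last by lia.
  rewrite (all_filterP _); last by apply/allP => x; rewrite mem_window; lia.
  rewrite /window (iotaDl 1 0) -map_comp; apply: eq_map => i /=; lia.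
rewrite (all_filterP _); last by apply/allP => x; rewrite mem_nseq => /andP[_ /eqP ->]; lia.
by rewrite map_nseq.
Qed.

Lemma wbase_neg : fneg (wbase a b L) = nseq (L - a) (- a%:Z) ++ window (1 - a%:Z) a.
Proof.
rewrite /fneg /wbase !filter_cat window_cat filter_cat.
have -> : [seq x <- nseq (L - a) (- a%:Z) | (x <= 0)%R] = nseq (L - a) (- a%:Z).
  by apply/all_filterP/allP => x; rewrite mem_nseq => /andP[_ /eqP ->]; lia.
have -> : [seq x <- window (1 - a%:Z) a | (x <= 0)%R] = window (1 - a%:Z) a.
  by apply/all_filterP/allP => x; rewrite mem_window; lia.
have -> : [seq x <- window (1 - a%:Z + a%:Z) b | (x <= 0)%R] = [::].
  rewrite (eq_in_filter (a2 := pred0)) ?filter_pred0 // => x.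
  by rewrite mem_window /= => h; apply/negbTE; lia.
have -> : [seq x <- nseq (L - b) b.+1%:Z | (x <= 0)%R] = [::].
  by rewrite (eq_in_filter (a2 := pred0)) ?filter_pred0 // => x; rewrite mem_nseq => /andP[_ /eqP ->].
by rewrite !cats0.
Qed.

Lemma wbase_gp f : perm_eq f (wbase a b L) -> perm_eq (gp f) (iota 1 b ++ nseq (L - b) b.+1).
Proof.
move=> pf; rewrite /gp; have h : perm_eq (fpos f) (fpos (wbase a b L)) by exact: perm_filter.
rewrite (perm_trans (perm_map _ h)) // wbase_pos -map_comp map_id_in //.
Qed.

Lemma wbase_gm f : perm_eq f (wbase a b L) -> perm_eq (gm f) (iota 1 a ++ nseq (L - a) a.+1).
Proof.
move=> pf; rewrite /gm perm_rev; have h : perm_eq (fneg f) (fneg (wbase a b L)) by exact: perm_filter.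
rewrite (perm_trans (perm_map _ h)) // wbase_neg map_cat perm_catC; apply: perm_cat; last first.
  by rewrite map_nseq (_ : absz _ = a.+1) //; lia.
apply: uniq_perm; rewrite ?iota_uniq //.
  rewrite map_inj_in_uniq ?uniq_window // => x y; rewrite !mem_window; lia.
move=> j; rewrite mem_iota; apply/mapP/idP => [[x + ->]|hj]; first by rewrite mem_window; lia.
by exists (1 - j%:Z); rewrite ?mem_window; lia.
Qed.

Lemma clip_iota (g : seq nat) (c : nat) : perm_eq g (iota 1 c ++ nseq (L - c) c.+1) ->
  [/\ all (fun x => 0 < x <= c.+1)%N g, uniq [seq x <- g | (x <= c)%N],
     perm_eq [seq x <- g | (x <= c)%N] (iota 1 c) & count (fun x => x <= c)%N g = c].
Proof.
move=> pg; have e : [seq x <- iota 1 c ++ nseq (L - c) c.+1 | (x <= c)%N] = iota 1 c.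
  rewrite filter_cat (all_filterP _); last by apply/allP => x; rewrite mem_iota; lia.
  rewrite (eq_in_filter (a2 := pred0)) ?filter_pred0 ?cats0 // => x.
  by rewrite mem_nseq => /andP[_ /eqP ->]; rewrite ltnn.
have p : perm_eq [seq x <- g | (x <= c)%N] (iota 1 c) by rewrite -e; exact: perm_filter.
split => //.
- rewrite (perm_all _ pg) all_cat; apply/andP; split; apply/allP => x.
    by rewrite mem_iota; lia.
  by rewrite mem_nseq => /andP[_ /eqP ->]; rewrite ltnSn.
- by rewrite (perm_uniq p) iota_uniq.
- by rewrite -size_filter (perm_size p) size_iota.
Qed.
End Base.

Lemma perm_clipN (Bx : nat -> nat -> bool) (c L : nat) : goodB Bx ->
  (forall v, (0 < v <= c)%N -> exists2 i, (0 < i <= L)%N & mallowsN Bx i = v) ->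
  perm_eq [seq clipN c (mallowsN Bx k) | k <- iota 1 L] (iota 1 c ++ nseq (L - c) c.+1).
Proof.
move=> gB hv; pose r := [seq mallowsN Bx k | k <- iota 1 L].
have ur : uniq r by rewrite /r -mseqE; exact: mseq_uniq.
have pr x : x \in r -> (0 < x)%N.
  by move=> /mapP[k]; rewrite mem_iota => hk ->; apply: mallowsN_gt0 => //; lia.
have p1 : perm_eq [seq x <- r | (x <= c)%N] (iota 1 c).
  apply: uniq_perm; rewrite ?filter_uniq ?iota_uniq // => x; rewrite mem_filter mem_iota.
  apply/andP/idP => [[xc /pr]|hx]; first by lia.
  split; first by lia.
  have [|i hi <-] := hv x; first by lia.
  by apply: map_f; rewrite mem_iota; lia.
have sz : size [seq x <- r | ~~ (x <= c)%N] = (L - c)%N.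
  have := count_predC (fun x => x <= c)%N r; rewrite -!size_filter (perm_size p1) size_iota.
  by rewrite {2}/r size_map size_iota => <-; rewrite addKn.
have e : map (clipN c) r = [seq clipN c (mallowsN Bx k) | k <- iota 1 L] by rewrite -map_comp.
rewrite -e; have p2 : perm_eq r ([seq x <- r | (x <= c)%N] ++ [seq x <- r | ~~ (x <= c)%N]).
  by rewrite perm_sym (perm_filterC (fun x => x <= c)%N).
rewrite (perm_trans (perm_map _ p2)) // map_cat; apply: perm_cat.
  rewrite map_id_in // => x; rewrite mem_filter => /andP[xc /pr x0].
  by rewrite /clipN x0 xc.
rewrite (_ : map _ _ = nseq (L - c) c.+1) // -sz; apply: (@eq_from_nth _ 0%N); rewrite ?size_map ?size_nseq //.
move=> i hi; rewrite (nth_map 0%N) // nth_nseq hi; have := mem_nth 0%N hi.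
by rewrite mem_filter /clipN => /andP[/negbTE -> _]; rewrite andbF.
Qed.

Lemma mallowsN_bound Bx c : goodB Bx -> exists L0, forall L, (L0 <= L)%N ->
  forall v, (0 < v <= c)%N -> exists2 i, (0 < i <= L)%N & mallowsN Bx i = v.
Proof.
move=> gB; elim: c => [|c [L0 IH]]; first by exists 0%N => L _ v; lia.
have [i i0 hi] := mallowsN_surj gB (isT : (0 < c.+1)%N).
exists (maxn L0 i) => L hL v hv; case: (eqVneq v c.+1) => [->|ne].
  by exists i => //; lia.
by apply: IH; lia.
Qed.

(** Once the first [L] terms of both one-sided permutations contain all the values kept by the
    clipping, they have the right multiset of letters, and [build] interleaves them according to
    [M]. *)
Lemma word_exists (Bp Bm : nat -> nat -> bool) (M : nat -> nat) (a b : nat) :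
  goodB Bp -> goodB Bm -> (exists n, forall i, (n < i)%N -> M i = 0%N) ->
  exists L0, forall L, (L0 <= L)%N -> exists f,
   [/\ perm_eq f (wbase a b L), forall i, (0 < i)%N -> M i = count_mem i (lam f),
    forall k, (k < size (gp f))%N -> clipN b (mallowsN Bp (0 + k).+1) = nth 0%N (gp f) k &
    forall k, (k < size (gm f))%N -> clipN a (mallowsN Bm (0 + k).+1) = nth 0%N (gm f) k].
Proof.
move=> gBp gBm [n hn].
have [L1 h1] := mallowsN_bound b gBp; have [L2 h2] := mallowsN_bound a gBm.
pose S := (\sum_(1 <= i < n.+1) M i)%N.
(* Besides covering all kept values, [L] must bound the largest part, at most [n], and the number
   [S] of parts, so that the diagram fits in the word. *)
exists (a + b + L1 + L2 + n + S)%N => L hL.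
pose rp := [seq clipN b (mallowsN Bp k) | k <- iota 1 L].
pose rm := [seq clipN a (mallowsN Bm k) | k <- iota 1 L].
have pp : perm_eq rp (iota 1 b ++ nseq (L - b) b.+1) by apply: perm_clipN => //; apply: h1; lia.
have pm : perm_eq rm (iota 1 a ++ nseq (L - a) a.+1) by apply: perm_clipN => //; apply: h2; lia.
pose gpi := map Posz rp; pose gmi := rev [seq 1 - k%:Z | k <- rm].
have clip0 c x : (0 < clipN c x)%N by rewrite /clipN; case: ifP => // /andP[].
have ap : all (fun x : int => 0 < x) gpi.
  by apply/allP => x /mapP[y /mapP[k _ ->] ->]; have := clip0 b (mallowsN Bp k); lia.
have am : all (fun x : int => x <= 0) gmi.
  rewrite all_rev; apply/allP => x /mapP[y /mapP[k _ ->] ->]; have := clip0 a (mallowsN Bm k); lia.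
have zm : size gmi = L by rewrite size_rev !size_map size_iota.
have hS : (\sum_(1 <= i < L.+1) M i <= size gpi)%N.
  rewrite !size_map size_iota (@big_cat_nat _ _ _ n.+1) /=; [|lia|lia].
  rewrite [X in (_ + X)%N]big_nat_cond [X in (_ + X)%N]big1 ?addn0; last by move=> i hi; apply: hn; lia.
  by rewrite -/S; lia.
have [e1 e2 e3] := buildP ap am zm hS; set f := build M L gpi gmi in e1 e2 e3.
have hgp : gp f = rp by rewrite /gp e1 /gpi -map_comp map_id_in.
have hgm : gm f = rm.
  rewrite /gm e2 /gmi map_rev revK -map_comp map_id_in // => k /mapP[j _ ->] /=.
  have := clip0 a (mallowsN Bm j); lia.
exists f; split.
- have pf : perm_eq f (fpos f ++ fneg f).
    rewrite /fpos /fneg (eq_filter (a1 := fun x : int => x <= 0) (a2 := predC (fun x : int => 0 < x))); last by move=> x /=; rewrite leNgt.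
    by rewrite perm_sym perm_filterC.
  have pb : perm_eq (wbase a b L) (fpos (wbase a b L) ++ fneg (wbase a b L)).
    rewrite /fpos /fneg (eq_filter (a1 := fun x : int => x <= 0) (a2 := predC (fun x : int => 0 < x))); last by move=> x /=; rewrite leNgt.
    by rewrite perm_sym perm_filterC.
  rewrite (perm_trans pf) // perm_sym (perm_trans pb) // perm_sym; apply: perm_cat.
    by rewrite e1 wbase_pos /gpi (perm_map Posz pp).
  rewrite e2 perm_rev (perm_trans (perm_map (fun k : nat => 1 - k%:Z) pm)) // wbase_neg map_cat perm_catC.
  apply: perm_cat; first by rewrite map_nseq (_ : 1 - _ = - a%:Z) //; lia.
  apply: uniq_perm; rewrite ?uniq_window //.
    by rewrite map_inj_uniq ?iota_uniq // => x y; lia.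
  move=> y; rewrite mem_window; apply/mapP/idP => [[k + ->]|hy]; first by rewrite mem_iota; lia.
  by exists (absz (1 - y)%R); rewrite ?mem_iota; lia.
- move=> i i0; rewrite e3 //; case: leqP => // h; apply: hn; lia.
- move=> k; rewrite hgp !size_map size_iota => kL.
  by rewrite (nth_map 0%N) ?size_iota // nth_iota // add1n add0n.
- move=> k; rewrite hgm !size_map size_iota => kL.
  by rewrite (nth_map 0%N) ?size_iota // nth_iota // add1n add0n.
Qed.

Local Open Scope ereal_scope.

(** * Measurability and the law of the inputs *)

Section Meas.
Context (d : measure_display) (T : measurableType d).

Lemma m_cst (Q : Prop) : measurable [set _ : T | Q].
Proof.
case: (pselect Q) => h.
  by rewrite (_ : [set _ | _] = setT) //; apply/seteqP; split.
by rewrite (_ : [set _ | _] = set0) //; apply/seteqP; split.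
Qed.

Lemma m_and (A B : T -> Prop) : measurable [set w | A w] -> measurable [set w | B w] ->
  measurable [set w | A w /\ B w].
Proof. exact: measurableI. Qed.

Lemma m_or (A B : T -> Prop) : measurable [set w | A w] -> measurable [set w | B w] ->
  measurable [set w | A w \/ B w].
Proof. exact: measurableU. Qed.

Lemma m_not (A : T -> Prop) : measurable [set w | A w] -> measurable [set w | ~ A w].
Proof. exact: measurableC. Qed.

Lemma m_ext (A B : T -> Prop) : (forall w, A w <-> B w) -> measurable [set w | A w] ->
  measurable [set w | B w].
Proof.
by move=> h; rewrite (_ : [set w | A w] = [set w | B w]) //; apply/seteqP; split => w /= /h.
Qed.

Lemma m_imp (A B : T -> Prop) : measurable [set w | A w] -> measurable [set w | B w] ->
  measurable [set w | A w -> B w].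
Proof.
move=> mA mB; apply: m_ext (m_or (m_not mA) mB) => w.
by rewrite implyE.
Qed.

Lemma m_iff (A B : T -> Prop) : measurable [set w | A w] -> measurable [set w | B w] ->
  measurable [set w | A w <-> B w].
Proof. by move=> mA mB; apply: m_and; apply: m_imp. Qed.

Lemma m_ex (U : countType) (A : U -> T -> Prop) : (forall u, measurable [set w | A u w]) ->
  measurable [set w | exists u, A u w].
Proof.
move=> mA; rewrite (_ : [set w | _] = \bigcup_u [set w | A u w]).
  by apply: countable_bigcupT_measurable => //; exact: countableP.
by apply/seteqP; split => w /=; [move=> [u h]; exists u|move=> [u _ h]; exists u].
Qed.

Lemma m_all (U : countType) (A : U -> T -> Prop) : (forall u, measurable [set w | A u w]) ->
  measurable [set w | forall u, A u w].
Proof.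
move=> mA; apply: m_ext (m_not (m_ex (fun u => m_not (mA u)))) => w; split.
  by move=> h u; apply: contrapT => hu; apply: h; exists u.
by move=> h [u]; apply.
Qed.

Lemma m_ex2 (U : countType) (A B : U -> T -> Prop) : (forall u, measurable [set w | A u w]) ->
  (forall u, measurable [set w | B u w]) -> measurable [set w | exists2 u, A u w & B u w].
Proof.
move=> mA mB; apply: m_ext (m_ex (fun u => m_and (mA u) (mB u))) => w.
by split=> -[u]; [move=> []; exists u|exists u].
Qed.
End Meas.

Section Prob.
Context (d : measure_display) (T : measurableType d) (R : realType) (P : probability T R).

Lemma prob1_sub (A B : set T) : measurable A -> measurable B -> P A = 1 -> A `<=` B -> P B = 1.
Proof.
move=> mA mB h AB; apply/eqP; rewrite eq_le probability_le1 //= -h.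
by apply: le_measure => //; rewrite inE.
Qed.

Lemma prob0_sub (A B : set T) : measurable A -> measurable B -> P B = 0 -> A `<=` B -> P A = 0.
Proof.
move=> mA mB h AB; apply/eqP; rewrite eq_le measure_ge0 andbT -h.
by apply: le_measure => //; rewrite inE.
Qed.

Lemma prob1C (A : set T) : measurable A -> P (~` A) = 0 -> P A = 1.
Proof.
move=> mA h; have := probability_setC P (measurableC mA).
by rewrite h setCK sube0.
Qed.

Lemma prob0C (A : set T) : measurable A -> P A = 1 -> P (~` A) = 0.
Proof. by move=> mA h; rewrite probability_setC // h subee. Qed.

Lemma prob1I (A G : set T) : measurable A -> measurable G -> P G = 1 -> P (A `&` G) = P A.
Proof.
move=> mA mG hG.
have -> : P A = P (A `&` G) + P (A `&` ~` G).
  rewrite -measureU; [|exact: measurableI|by apply: measurableI => //; exact: measurableC|].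
    by rewrite -setIUr setUv setIT.
  by apply/seteqP; split => // w [[_ h] [_]].
rewrite [X in _ + X](_ : _ = 0) ?adde0 //.
by apply: prob0_sub (prob0C mG hG) _ => //; [apply: measurableI => //|]; exact: measurableC.
Qed.

Lemma prob1_forall (A : nat -> T -> Prop) : (forall n, measurable [set w | A n w]) ->
  (forall n, P [set w | A n w] = 1) -> P [set w | forall n, A n w] = 1.
Proof.
move=> mA h; apply: prob1C; first exact: m_all.
have : P.-negligible (\bigcup_n ~` [set w | A n w]).
  apply: negligible_bigcup => n; exists (~` [set w | A n w]); split => //.
    exact: measurableC.
  exact: prob0C.
move=> [N [mN hN sub]]; apply: prob0_sub mN hN _; first by apply: measurableC; exact: m_all.
apply: subset_trans sub => w /= /existsNP[n hn]; by exists n.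
Qed.

Lemma prob1_and (A B : set T) : measurable A -> measurable B -> P A = 1 -> P B = 1 -> P (A `&` B) = 1.
Proof. by move=> mA mB hA hB; rewrite prob1I. Qed.

Lemma prob_partition (A : set T) (f : T -> nat) : measurable A ->
  (forall n, measurable [set w | f w = n]) ->
  P A = \sum_(0 <= n <oo) P (A `&` [set w | f w = n]).
Proof.
move=> mA mf; have mI n : measurable (A `&` [set w | f w = n]) by exact: measurableI.
rewrite -(@measure_semi_bigcup _ _ _ P (fun n => A `&` [set w | f w = n])) //.
- by congr (P _); rewrite -setI_bigcupr; apply/seteqP; split => w; [split => //; exists (f w)|case].
- apply/trivIsetP => i j _ _ ij; apply/seteqP; split => // w /= [[_ h] [_ h']].
  by rewrite -h -h' eqxx in ij.
- exact: bigcupT_measurable.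
Qed.

(** The events that [A] holds and that [Q m] holds for all m >= n increase to [A] up to a null set;
    [P (A & Q n)] lies between their probabilities and that of [A]. *)
Lemma prob_evt_cvg (A : set T) (Q : nat -> set T) (G : set T) :
  measurable A -> measurable G -> (forall n, measurable (Q n)) -> P G = 1 ->
  (forall w, G w -> exists N, forall n, (N <= n)%N -> Q n w) ->
  P (A `&` Q n) @[n --> \oo] --> P A.
Proof.
move=> mA mG mQ hG hQ.
pose F n := A `&` [set w | forall m, (n <= m)%N -> Q m w].
have mF n : measurable (F n).
  by apply: measurableI => //; apply: m_all => m; apply: m_imp; [exact: m_cst|exact: mQ].
have mU : measurable (\bigcup_n F n) by exact: bigcupT_measurable.
have eF : P (\bigcup_n F n) = P A.
  apply/eqP; rewrite eq_le; apply/andP; split.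
    by apply: le_measure; rewrite ?inE //; apply: bigcup_sub => n _ w [].
  rewrite -(prob1I mA mG hG); apply: le_measure; rewrite ?inE //; first exact: measurableI.
  by move=> w [wA wG]; have [N hN] := hQ w wG; exists N.
have cF : (P \o F) n @[n --> \oo] --> P A.
  rewrite -eF; apply: nondecreasing_cvg_mu => // n m nm; apply/subsetPset.
  by move=> w [wA h]; split => // k mk; apply: h; apply: leq_trans mk.
apply: (@squeeze_cvge _ _ _ _ (P \o F) _ (fun=> P A)) => //; last exact: cvg_cst.
apply: nearW => n; apply/andP; split; apply: le_measure; rewrite ?inE //.
- exact: measurableI.
- by move=> w [wA h]; split => //; exact: h.
- exact: measurableI.
Qed.
End Prob.

Lemma nneseries_EFin (R : realType) (u : nat -> R) (l : R) :
  (\sum_(0 <= i < n) u i)%R @[n --> \oo] --> l -> \sum_(0 <= i <oo) (u i)%:E = l%:E.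
Proof.
move=> h; apply: cvg_lim => //.
under eq_cvg do rewrite sumEFin.
by apply: cvg_EFin => //; apply: nearW.
Qed.

(* Input coordinates: Bernoulli entries (true for B^+, false for B^-) and the M_i.    *)
Definition icoord : eqType := ((bool * (nat * nat)) + nat)%type.
Definition valid (c : icoord) : bool :=
  match c with inl (_, (i, j)) => (0 < i)%N && (0 < j)%N | inr i => (0 < i)%N end.
Definition wt (R : realType) (q : R) (c : icoord) (v : nat) : R :=
  match c with
  | inl _ => match v with 0%N => q | 1%N => (1 - q)%R | _ => 0%R end
  | inr i => (q ^+ (i * v) * (1 - q ^+ i))%R
  end.
Definition pairsN (N : nat) : seq (nat * nat) := [seq (i, j) | i <- iota 1 N, j <- iota 1 N].
Definition box (N : nat) : seq icoord :=
  [seq inl (true, p) | p <- pairsN N] ++ [seq inl (false, p) | p <- pairsN N] ++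
  [seq inr i | i <- iota 1 N].

Lemma mem_pairsN N i j : ((i, j) \in pairsN N) = (0 < i <= N)%N && (0 < j <= N)%N.
Proof.
rewrite /pairsN; apply/allpairsP/idP => [[[x y] [/= h1 h2 [-> ->]]]|].
  by move: h1 h2; rewrite !mem_iota add1n !ltnS => -> ->.
by move=> /andP[h1 h2]; exists (i, j); rewrite !mem_iota add1n !ltnS.
Qed.

Lemma box_uniq N : uniq (box N).
Proof.
have up : uniq (pairsN N) by apply: allpairs_uniq; rewrite ?iota_uniq // => -[? ?] [? ?] _ _ [-> ->].
rewrite /box !cat_uniq !map_inj_uniq ?iota_uniq ?up; try by move=> ? ? [].
rewrite /= andbT; apply/andP; split.
  rewrite has_cat negb_or; apply/andP; split; apply/hasPn => c /mapP[p _ ->]; by apply/mapP => -[? _].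
by apply/hasPn => c /mapP[p _ ->]; apply/mapP => -[? _].
Qed.

Lemma mem_box N (c : icoord) : (c \in box N) = valid c &&
  match c with inl (_, (i, j)) => (i <= N)%N && (j <= N)%N | inr i => (i <= N)%N end.
Proof.
rewrite !mem_cat; case: c => [[b [i j]]|i] /=.
  have -> : ((inl (b, (i, j)) : icoord) \in [seq (inr i : icoord) | i <- iota 1 N]) = false.
    by apply/negbTE/mapP => -[].
  have h b' : ((inl (b, (i, j)) : icoord) \in [seq (inl (b', p) : icoord) | p <- pairsN N]) =
      (b == b') && ((i, j) \in pairsN N).
    apply/mapP/andP => [[p hp [-> ->]]|[/eqP -> hp]]; first by rewrite eqxx.
    by exists (i, j).
  by rewrite !h mem_pairsN; case: (b) => /=; rewrite ?orbF; case: (0 < i)%N; case: (0 < j)%N; rewrite ?andbF.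
have h b' : ((inr i : icoord) \in [seq (inl (b', p) : icoord) | p <- pairsN N]) = false.
  by apply/negbTE/mapP => -[].
rewrite !h /= (mem_map (fun (x y : nat) (e : inr x = inr y :> icoord) => let: erefl := e in erefl)).
by rewrite mem_iota add1n ltnS.
Qed.

Section Law.
Context (R : realType) (q : R) (hq0 : (0 <= q)%R) (hq1 : (q < 1)%R)
  (d : measure_display) (Omega : measurableType d) (P : probability Omega R)
  (Bp Bm : Omega -> nat -> nat -> bool) (M : Omega -> nat -> nat)
  (mBp : forall i j, measurable [set w | Bp w i j])
  (mBm : forall i j, measurable [set w | Bm w i j])
  (mM : forall i m, measurable [set w | M w i = m])
  (hlaw : input_law q P Bp Bm M).

Definition cval (w : Omega) (c : icoord) : nat :=
  match c with
  | inl (b, (i, j)) => if b then Bp w i j : nat else Bm w i j : nat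
  | inr i => M w i
  end.

Lemma m_bool (b : Omega -> bool) (n : nat) : measurable [set w | b w] ->
  measurable [set w | (b w : nat) = n].
Proof.
move=> mb; case: n => [|[|n]].
- by apply: m_ext (m_not mb) => w; case: (b w); split => // h; exfalso; apply: h.
- by apply: m_ext mb => w; case: (b w); split.
- by apply: m_ext (m_cst _ False) => w; case: (b w); split.
Qed.

Lemma mval c n : measurable [set w | cval w c = n].
Proof. by case: c => [[[] [i j]]|i] /=; [exact: m_bool|exact: m_bool|exact: mM]. Qed.

Definition ev (cs : seq icoord) (v : icoord -> nat) : set Omega :=
  [set w | forall c, c \in cs -> cval w c = v c].

Lemma mev cs v : measurable (ev cs v).
Proof.
rewrite /ev; elim: cs => [|c cs IH].
  by apply: m_ext (m_cst _ True) => w; split.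
apply: m_ext (m_and (mval c (v c)) IH) => w; split.
  by move=> [h1 h2] c'; rewrite in_cons => /orP[/eqP->//|/h2].
by move=> h; split=> [|c' hc]; apply: h; rewrite in_cons ?eqxx // hc orbT.
Qed.

(** Bernoulli coordinates are coded in [nat]; at values above 1 the event is empty and [wt] is 0. *)
Lemma ev_big cs v (c : bool * (nat * nat)) : inl c \in cs -> (1 < v (inl c))%N ->
  P (ev cs v) = (\prod_(c <- cs) wt q c (v c))%:E.
Proof.
move=> hc hv; rewrite (_ : ev cs v = set0).
  rewrite measure0 (big_rem (inl c)) //=; case: (v (inl c)) hv => [|[]]// n _.
  by rewrite mul0r.
apply/seteqP; split => // w /(_ _ hc) /=; case: c hc hv => [[] [i j]] _ hv e; rewrite -e in hv.
  by case: (Bp w i j) hv.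
by case: (Bm w i j) hv.
Qed.

Lemma box_law N v : P (ev (box N) v) = (\prod_(c <- box N) wt q c (v c))%:E.
Proof.
case: (boolP (has (fun c : icoord => if c is inl _ then (1 < v c)%N else false) (box N))).
  by move=> /hasP[[c|//] hc hv]; apply: ev_big hc hv.
move=> /hasPn hN; have := hlaw N (fun i j => v (inl (true, (i, j))) == 1%N)
  (fun i j => v (inl (false, (i, j))) == 1%N) (fun i => v (inr i)).
have hv b i j : (0 < i <= N)%N -> (0 < j <= N)%N -> (v (inl (b, (i, j))) <= 1)%N.
  move=> hi hj; have := hN (inl (b, (i, j))); rewrite mem_box /= -leqNgt; apply.
  by move: hi hj => /andP[-> ->] /andP[-> ->].
set E := (X in P X = _ -> _); have -> : E = ev (box N) v.
  apply/seteqP; split => w.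
    move=> [h1 h2] [[b [i j]]|i]; rewrite mem_box /= => hij; last first.
      by apply: h2.
    have hi : (0 < i <= N)%N by move: hij; lia.
    have hj : (0 < j <= N)%N by move: hij; lia.
    have [e1 e2] := h1 i j hi hj; have := hv b i j hi hj.
    by case: b => h; rewrite ?e1 ?e2; move: h; case: (v _) => [|[]].
  move=> h; split=> [i j hi hj|i hi].
    have hb b : inl (b, (i, j)) \in box N by rewrite mem_box /=; move: hi hj => /andP[-> ->] /andP[-> ->].
    by split; [rewrite -(h _ (hb true))|rewrite -(h _ (hb false))] => /=; case: (_ w i j).
  by apply: (h (inr i)); rewrite mem_box /=.
move=> ->; congr (_%:E); rewrite /box !big_cat !big_map /=.
rewrite mulrA; congr (_ * _)%R; last by rewrite /index_iota subSS subn0.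
rewrite -big_split /= big_allpairs_dep /index_iota subSS subn0 /=.
rewrite big_seq [RHS]big_seq; apply: eq_bigr => i; rewrite mem_iota add1n ltnS => hi.
rewrite big_seq [RHS]big_seq; apply: eq_bigr => j; rewrite mem_iota add1n ltnS => hj.
have hbern b : bern q (v (inl (b, (i, j))) == 1%N) = wt q (inl (b, (i, j))) (v (inl (b, (i, j)))).
  by rewrite /bern /=; have := hv b i j hi hj; case: (v _) => [|[]].
by rewrite !hbern.
Qed.

Lemma wt_ge0 c n : (0 <= wt q c n)%R.
Proof.
case: c => [_|i] /=; first by case: n => [|[]] //; rewrite subr_ge0 ltW.
by rewrite mulr_ge0 ?exprn_ge0 // subr_ge0 exprn_ile1 // ltW.
Qed.

Lemma wt_sum c : valid c -> \sum_(0 <= n <oo) (wt q c n)%:E = 1.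
Proof.
move=> vc; apply: nneseries_EFin; case: c vc => [c _|i i0] /=.
  have hs n : (2 <= n)%N -> (\sum_(0 <= i < n) wt q (inl c) i)%R = 1%R; last first.
    apply: cvg_near_cst; near=> n; apply: hs; near: n; exact: nbhs_infty_ge.
  case: n => [|[|n]] // _; rewrite !big_nat_recl //= [X in (_ + (_ + X))%R]big1 //.
  by rewrite addr0 addrC subrK.
have -> : (fun n => \sum_(0 <= k < n) (q ^+ (i * k) * (1 - q ^+ i))%R)%R = (fun n => 1 - (q ^+ i) ^+ n)%R.
  apply/funext => n; elim: n => [|n IH]; first by rewrite big_geq // expr0 subrr.
  by rewrite big_nat_recr //= IH exprS exprM; ring.
rewrite -[X in _ --> X]subr0; apply: cvgB; first exact: cvg_cst.
apply: cvg_expr; rewrite ger0_norm ?exprn_ge0 // exprn_ilt1 //.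
by rewrite -lt0n.
Unshelve. all: by end_near. Qed.

(** A coordinate is removed by summing over its values, as the weights of a valid coordinate sum to
    1. *)
Lemma law_free e cs : e \notin cs -> valid e ->
  (forall v, P (ev (e :: cs) v) = (\prod_(c <- e :: cs) wt q c (v c))%:E) ->
  forall v, P (ev cs v) = (\prod_(c <- cs) wt q c (v c))%:E.
Proof.
move=> ecs ve h v; rewrite (prob_partition P (mev cs v) (mval e)).
have hn n : P (ev cs v `&` [set w | cval w e = n]) =
    (\prod_(c <- cs) wt q c (v c))%:E * (wt q e n)%:E.
  pose v' c := if c == e then n else v c.
  have e0 : ev cs v `&` [set w | cval w e = n] = ev (e :: cs) v'.
    apply/seteqP; split => w.
      move=> [h1 h2] c; rewrite in_cons /v'; case: eqVneq => [->//|_] /= hc; exact: h1.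
    move=> h1; split; last by have := h1 e (mem_head _ _); rewrite /v' eqxx.
    move=> c hc; have := h1 c; rewrite in_cons hc orbT /v' => /(_ isT).
    by case: eqVneq hc ecs => // -> ->.
  rewrite e0 h big_cons /v' eqxx -EFinM mulrC; congr (_ * _)%:E.
  by apply: eq_big_seq => c hc; case: eqVneq hc ecs => // -> ->.
rewrite (eq_eseriesr (fun n _ => hn n)) nneseriesZl; last by move=> n _; rewrite lee_fin wt_ge0.
by rewrite wt_sum // mule1.
Qed.

(** The input law is given on boxes; a finite family lies in some box, and the other coordinates of
    the box are summed out. *)
Lemma law cs : uniq cs -> all valid cs ->
  forall v, P (ev cs v) = (\prod_(c <- cs) wt q c (v c))%:E.
Proof.
move=> ucs vcs.
have [N hN] : exists N, {subset cs <= box N}.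
  elim: cs vcs {ucs} => [|c cs IH]; first by exists 0%N.
  move=> /= /andP[vc /IH[N hN]].
  pose m := match c with inl (_, (i, j)) => (i + j)%N | inr i => i end.
  exists (N + m)%N => c'; rewrite in_cons => /orP[/eqP->|/hN].
    by rewrite mem_box vc /m; case: (c) => [[b [i j]]|i]; lia.
  rewrite !mem_box => /andP[-> ]; case: (c') => [[b [i j]]|i]; lia.
pose ds := [seq c <- box N | c \notin cs].
have uds : uniq (ds ++ cs).
  rewrite cat_uniq filter_uniq ?box_uniq // ucs andbT /=; apply/hasPn => c hc.
  by rewrite mem_filter hc.
have hds : all valid ds.
  by apply/allP => c; rewrite mem_filter mem_box => /andP[_ /andP[]].
have pds : perm_eq (box N) (ds ++ cs).
  apply: uniq_perm => //; first exact: box_uniq.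
  move=> c; rewrite mem_cat mem_filter; case: (boolP (c \in cs)) => [/hN ->|_] //=.
  by rewrite orbF.
have base v : P (ev (ds ++ cs) v) = (\prod_(c <- ds ++ cs) wt q c (v c))%:E.
  rewrite -(perm_big _ pds) /= -box_law; congr (P _); apply/seteqP; split => w h c hc; apply: h.
    by rewrite -(perm_mem pds).
  by rewrite (perm_mem pds).
elim: ds uds hds base {pds} => //= c ds IH /andP[cN u] /andP[vc vds] base.
by apply: IH => //; apply: (@law_free c).
Qed.

Lemma law1 c v : valid c -> P [set w | cval w c = v] = (wt q c v)%:E.
Proof.
move=> vc; have := @law [:: c] isT; rewrite /= vc => /(_ isT (fun=> v)); rewrite big_seq1 => <-.
by congr (P _); apply/seteqP; split => w /=; [move=> h c'; rewrite inE => /eqP ->|apply; rewrite inE].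
Qed.

Definition evas (s : seq (icoord * nat)) : set Omega := [set w | forall t, t \in s -> cval w t.1 = t.2].

Lemma law_as (s : seq (icoord * nat)) : uniq (map fst s) -> all (fun t => valid t.1) s ->
  P (evas s) = (\prod_(t <- s) wt q t.1 t.2)%:E.
Proof.
move=> us vs; pose v c := (nth (c, 0%N) s (index c (map fst s))).2.
have hv t : t \in s -> v t.1 = t.2.
  move=> ts; rewrite /v; have it : (index t s < size s)%N by rewrite index_mem.
  have -> : index t.1 (map fst s) = index t s.
    rewrite -[in LHS](nth_index t ts) -(nth_map t t.1) // index_uniq ?size_map //.
  by rewrite (set_nth_default t) // nth_index.
have -> : evas s = ev (map fst s) v.
  apply/seteqP; split => w h.
    by move=> c /mapP[t ts ->]; rewrite hv //; apply: h.
  by move=> t ts; rewrite -hv //; apply: h; apply: map_f.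
rewrite law // ?all_map // big_map; congr (_%:E).
by apply: eq_big_seq => t ts; rewrite hv.
Qed.
End Law.

(** * Measurability of the two-sided permutation *)

Section MeasX.
Context (d : measure_display) (Omega : measurableType d).

Lemma m_mnext (B : Omega -> nat -> nat -> bool) i s j :
  (forall i j, measurable [set w | B w i j]) ->
  measurable [set w | mnext (B w) i s = j].
Proof.
move=> mB.
pose none w := forall j', (0 < j')%N /\ j' \notin s -> ~ B w i j'.
have mnone : measurable [set w | none w].
  by apply: m_all => j'; apply: m_imp; [exact: m_cst|apply: m_not; exact: mB].
pose some w := ((0 < j)%N /\ j \notin s) /\ B w i j /\
   forall j', [/\ (0 < j')%N, j' \notin s & (j' < j)%N] -> ~ B w i j'.
have msome : measurable [set w | some w].
  apply: m_and; first exact: m_cst.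
  apply: m_and; first exact: mB.
  by apply: m_all => j'; apply: m_imp; [exact: m_cst|apply: m_not; exact: mB].
apply: m_ext (m_or msome (m_and (m_cst _ (j = 0%N)) mnone)) => w; split.
  move=> [[[j0 js] [bj hj]]|[-> h]]; last by apply: mnext_none => j' j0 js; apply/negP; apply: h.
  have [h1 h2 h3 h4] : _ := @mnext_some (B w) i s (ex_intro _ j (introT and3P (And3 j0 js bj))).
  apply/eqP; rewrite eqn_leq h4 //= leqNgt; apply/negP => h; exact: (hj _ _ h3).
case: (pselect (exists j, [&& (0 < j)%N, j \notin s & B w i j])) => [h e|h e].
  have [h1 h2 h3 h4] := mnext_some h; left; rewrite /some -e; split => //; split => // j' [j0 js jl] bj.
  by have := h4 _ j0 js bj; rewrite leqNgt jl.
right; have hn : none w by move=> j' [j0 js] bj; apply: h; exists j'; rewrite j0 js.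
split => //; rewrite -e; apply: mnext_none => j' j0 js; apply/negP; exact: hn.
Qed.

Lemma m_mallowsN (B : Omega -> nat -> nat -> bool) i j :
  (forall i j, measurable [set w | B w i j]) ->
  measurable [set w | mallowsN (B w) i = j].
Proof.
move=> mB; have ms n s : measurable [set w | mseq (B w) n = s].
  elim: n s => [|n IH] s; first exact: (m_cst _ ([::] = s)).
  apply: m_ext (m_ex (fun s' : seq nat => m_and (IH s') (m_ex (fun k : nat =>
    m_and (m_mnext n.+1 s' k mB) (m_cst _ (rcons s' k = s)))))) => w; split.
    by move=> [s' [e [k [e' <-]]]]; rewrite /= e e'.
  by move=> <-; exists (mseq (B w) n); split => //; exists (mnext (B w) n.+1 (mseq (B w) n)).
apply: m_ext (m_ex (fun s : seq nat => m_and (ms i s) (m_cst _ (last 0%N s = j)))) => w; split.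
  by move=> [s [<- <-]].
by move=> <-; exists (mseq (B w) i).
Qed.

Lemma Lambda_ext M M' : (forall i, (0 < i)%N -> M i = M' i) -> Lambda M = Lambda M'.
Proof.
move=> h; rewrite /Lambda; congr the_or; apply/funext => L; apply/propext.
by split=> -[h1 [h2 h3]]; split => //; split => // i i0; have := h3 i i0; rewrite h.
Qed.

(** Only countably many sequences have finite support, and all others give the default partition, so
    [Lambda] takes countably many values on measurable pieces. *)
Lemma m_Lambda (M : Omega -> nat -> nat) (Phi : (nat -> nat) -> Prop) :
  (forall i m, measurable [set w | M w i = m]) ->
  measurable [set w | Phi (Lambda (M w))].
Proof.
move=> mM.
have ms (s : seq nat) : measurable [set w | forall i, (0 < i)%N -> M w i = nth 0%N s i].
  by apply: m_all => i; apply: m_imp; [exact: m_cst|exact: mM].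
apply: m_ext (m_or (m_ex (fun s : seq nat => m_and (ms s) (m_cst _ (Phi (Lambda (nth 0%N s))))))
  (m_and (m_not (m_ex (fun s : seq nat => ms s))) (m_cst _ (Phi (fun=> 0%N))))) => w.
have h0 : ~ (exists s, forall i, (0 < i)%N -> M w i = nth 0%N s i) -> Lambda (M w) = fun=> 0%N.
  move=> hN; apply: Lambda_none => n; apply: contrapT => hn; apply: hN.
  exists (mkseq (M w) n.+1) => i i0; case: (leqP i n) => hi; first by rewrite nth_mkseq.
  rewrite nth_default ?size_mkseq //; apply: contrapT => e; apply: hn; by exists i.
split.
  move=> [[s [/Lambda_ext -> //]]|[/h0 -> //]].
move=> h; case: (pselect (exists s : seq nat, forall i, (0 < i)%N -> M w i = nth 0%N s i)) => [[s hs]|hN].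
  by left; exists s; split => //; rewrite -(Lambda_ext hs).
by right; split => //; rewrite -(h0 hN).
Qed.

(** The enumeration [kenum] as a function of [Lambda] alone, so that [m_Lambda] applies to it. *)
Definition KL (L : nat -> nat) : int -> int :=
  the_or (fun _ => 0%R) (fun k : int -> int =>
    (forall i : int, (0 < i)%R -> k i = 0%R) /\
    (forall i j : int, (i < j <= 0)%R -> (k i < k j)%R) /\
    (forall z : int, (forall i, (1 <= i)%N -> (i%:Z - (L i)%:Z)%R <> z) <->
                     (exists i : int, (i <= 0)%R /\ k i = z))).

Lemma m_X (Bp Bm : Omega -> nat -> nat -> bool) (M : Omega -> nat -> nat) z v :
  (forall i j, measurable [set w | Bp w i j]) ->
  (forall i j, measurable [set w | Bm w i j]) ->
  (forall i m, measurable [set w | M w i = m]) ->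
  measurable [set w | two_sided_mallows (mallowsN (Bp w)) (mallowsN (Bm w)) (M w) z = v].
Proof.
move=> mBp mBm mM.
have m1 (l : nat) : measurable [set w | ((0 < l)%N /\ ell (M w) l = z) /\ (mallowsN (Bp w) l)%:Z = v].
  apply: m_and.
    apply: m_and; first exact: m_cst.
    exact: (@m_Lambda M (fun L => (l%:Z - (L l)%:Z)%R = z)).
  apply: m_ext (m_ex (fun k : nat => m_and (m_mallowsN l k mBp) (m_cst _ (k%:Z = v)))) => w.
  by split => [[k [-> ->]]|<-] //; exists (mallowsN (Bp w) l).
have m2 (i : int) : measurable [set w | ((i <= 0)%R /\ kenum (M w) i = z) /\
    (1 - (mallowsN (Bm w) `|1 - i|%N)%:Z)%R = v].
  apply: m_and.
    apply: m_and; first exact: m_cst.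
    exact: (@m_Lambda M (fun L => KL L i = z)).
  apply: m_ext (m_ex (fun k : nat => m_and (m_mallowsN `|1 - i|%N k mBm) (m_cst _ ((1 - k%:Z)%R = v)))) => w.
  by split => [[k [-> ->]]|<-] //; exists (mallowsN (Bm w) `|1 - i|%N).
apply: m_ext (m_or (m_ex m1) (m_ex m2)) => w.
have [c gal] := Lambda_gal (M w).
have [h1 h2] := two_sided_spec (mallowsN (Bp w)) (mallowsN (Bm w)) gal.
have hk := kenum_eq gal.
split.
  move=> [[l [[l0 <-] <-]]|[i [[i0 <-] <-]]]; first exact: h1.
  by rewrite hk; exact: h2.
move=> e; case: (gal_cover gal z) => -[l l0 ez].
  by left; exists l; split => //; rewrite -h1 // ez.
by right; exists l; rewrite hk; split => //; rewrite -h2 // ez.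
Qed.
End MeasX.

(** * Probability that the inputs agree with a word *)

Lemma sum_count_mem (s : seq nat) N : all (fun x => x <= N)%N s ->
  (\sum_(i <- iota 1 N) i * count_mem i s = sumn s)%N.
Proof.
elim: s => [_|x s IH] /=; first by rewrite big1 // => i _; rewrite muln0.
move=> /andP[xN /IH <-]; under eq_bigr do rewrite mulnDr.
rewrite big_split /=; congr (_ + _)%N.
case: (posnP x) => [->|x0].
  by rewrite big1_seq // => i /andP[_]; rewrite mem_iota; case: i => //= i _; rewrite muln0.
rewrite (bigD1_seq x) ?iota_uniq ?mem_iota ?x0 //= eqxx muln1 big1 ?addn0 //.
by move=> i ix; rewrite eq_sym (negbTE ix) muln0.
Qed.

Lemma prod_asg (R : realType) (q : R) (s : seq ((nat * nat) * bool)) :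
  (\prod_(t <- s) (if t.2 then 1 - q else q) =
  (1 - q) ^+ count (fun t => t.2) s * q ^+ count (fun t => ~~ t.2) s)%R.
Proof.
elim: s => [|t s IH]; first by rewrite big_nil !expr0 mul1r.
by rewrite big_cons IH /=; case: t.2; rewrite /= ?add0n ?add1n exprS; ring.
Qed.

Section Law2.
Context (R : realType) (q : R) (hq0 : (0 <= q)%R) (hq1 : (q < 1)%R)
  (d : measure_display) (Omega : measurableType d) (P : probability Omega R)
  (Bp Bm : Omega -> nat -> nat -> bool) (M : Omega -> nat -> nat)
  (mBp : forall i j, measurable [set w | Bp w i j])
  (mBm : forall i j, measurable [set w | Bm w i j])
  (mM : forall i m, measurable [set w | M w i = m])
  (hlaw : input_law q P Bp Bm M).

Definition encB (c : bool) (t : (nat * nat) * bool) : icoord * nat := (inl (c, t.1), t.2 : nat).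
Definition encM (f : seq int) (i : nat) : icoord * nat := (inr i, count_mem i (lam f)).

Definition asF (a b : nat) (f : seq int) (N : nat) : seq (icoord * nat) :=
  map (encB true) (asg b 1 [::] (gp f)) ++ map (encB false) (asg a 1 [::] (gm f)) ++
  map (encM f) (iota 1 N).

Definition hpm (a b : nat) (f : seq int) (w : Omega) : Prop :=
  (forall k, (k < size (gp f))%N -> clipN b (mallowsN (Bp w) (0 + k).+1) = nth 0%N (gp f) k) /\
  (forall k, (k < size (gm f))%N -> clipN a (mallowsN (Bm w) (0 + k).+1) = nth 0%N (gm f) k).

Section F.
Variables (a b L : nat) (f : seq int).
Hypothesis pf : perm_eq f (wbase a b L).

Lemma consP N w : evas Bp Bm M (asF a b f N) w <->
  hpm a b f w /\ forall i, (0 < i <= N)%N -> M w i = count_mem i (lam f).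
Proof.
have [h1 h2 h3 h4] := clip_iota (wbase_gp pf).
have [h1' h2' h3' h4'] := clip_iota (wbase_gm pf).
have e1 := @asgP (Bp w) b 0 [::] (gp f) h1 h2 (fun _ _ _ => isT) (fun _ _ => erefl).
have e2 := @asgP (Bm w) a 0 [::] (gm f) h1' h2' (fun _ _ _ => isT) (fun _ _ => erefl).
rewrite /hpm -e1 -e2; split.
  move=> h; split; first split.
  - move=> t ht; have := h (encB true t).
    rewrite /asF mem_cat (map_f (encB true)) // => /(_ isT) /=.
    by case: t {ht} => [[i j] c] /=; case: (Bp w i j); case: c.
  - move=> t ht; have := h (encB false t).
    rewrite /asF !mem_cat (map_f (encB false)) // orbT => /(_ isT) /=.
    by case: t {ht} => [[i j] c] /=; case: (Bm w i j); case: c.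
  - move=> i hi; apply: (h (encM f i)).
    rewrite /asF !mem_cat (map_f (encM f)) ?orbT //.
    by rewrite mem_iota add1n ltnS.
move=> [[g1 g2] g3] t; rewrite /asF !mem_cat => /or3P[/mapP[u /g1 hu ->]|/mapP[u /g2 hu ->]|/mapP[i + ->]] /=.
- by case: u hu => [[i j] c] /= ->.
- by case: u hu => [[i j] c] /= ->.
- by rewrite mem_iota add1n ltnS => /g3.
Qed.

Definition KK (N : nat) : R := ((1 - q) ^+ b * (1 - q) ^+ a * \prod_(i <- iota 1 N) (1 - q ^+ i))%R.

(** The successes give the powers of 1 - q, the failures give q to the inversions of each half, and
    the M_i give q to the sum of the parts; [linv_word] collects the exponents. The bound on [N]
    ensures that every part is counted. *)
Lemma cons_prob N : (nneg f <= N)%N ->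
  P (evas Bp Bm M (asF a b f N)) = (q ^+ linv f * KK N)%:E.
Proof.
move=> hN.
have [h1 h2 h3 h4] := clip_iota (wbase_gp pf).
have [h1' h2' h3' h4'] := clip_iota (wbase_gm pf).
have pos1 : all (fun x => 0 < x)%N (gp f) by apply: sub_all h1 => x /andP[].
have pos2 : all (fun x => 0 < x)%N (gm f) by apply: sub_all h1' => x /andP[].
rewrite (law_as hq0 hq1 mBp mBm mM hlaw); last 2 first.
- rewrite /asF !map_cat -!map_comp !cat_uniq.
  have u1 : uniq (map (fst \o encB true) (asg b 1 [::] (gp f))).
    rewrite (eq_map (g := (fun k => inl (true, k) : icoord) \o fst)) // map_comp map_inj_uniq ?asg_uniq //.
    by move=> x y [].
  have u2 : uniq (map (fst \o encB false) (asg a 1 [::] (gm f))).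
    rewrite (eq_map (g := (fun k => inl (false, k) : icoord) \o fst)) // map_comp map_inj_uniq ?asg_uniq //.
    by move=> x y [].
  have u3 : uniq (map (fst \o encM f) (iota 1 N)).
    by rewrite map_inj_uniq ?iota_uniq // => x y [].
  rewrite u1 u2 u3 /= andbT; apply/andP; split.
    by rewrite has_cat negb_or; apply/andP; split; apply/hasPn => c /mapP[? _ ->]; apply/mapP => -[].
  by apply/hasPn => c /mapP[? _ ->]; apply/mapP => -[].
- rewrite /asF !all_cat !all_map; apply/and3P; split; apply/allP => t /=.
  + by move=> ht; have := asg_valid (isT : (0 < 1)%N) pos1 ht; case: t.1.
  + by move=> ht; have := asg_valid (isT : (0 < 1)%N) pos2 ht; case: t.1.
  + by rewrite mem_iota => /andP[].
congr (_%:E); rewrite /asF !big_cat !big_map /=.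
rewrite (eq_bigr (fun t : nat * nat * bool => if t.2 then 1 - q else q)%R); last by move=> t _; case: t.2.
rewrite [X in (_ * (X * _))%R](eq_bigr (fun t : nat * nat * bool => if t.2 then 1 - q else q)%R); last by move=> t _; case: t.2.
rewrite !prod_asg !asg_true h4 h4'.
rewrite (asg_false _ h1) ?(perm_trans h3) //; last by rewrite filter_predT.
rewrite (asg_false _ h1') ?(perm_trans h3') //; last by rewrite filter_predT.
rewrite big_split /= -expr_sum sum_count_mem; last first.
  by apply/allP => x /lam_le hx; apply: leq_trans hN.
have -> : map Posz (gp f) = fpos f.
  rewrite /gp -map_comp map_id_in // => x; rewrite mem_filter => /andP[x0 _] /=; lia.
have -> : linv (map Posz (gm f)) = linv (fneg f).
  rewrite -(linv_rev_refl (fneg f)) /gm map_rev -map_comp; congr (linv (rev _)).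
  apply/eq_in_map => x; rewrite mem_filter => /andP[x0 _] /=; lia.
by rewrite (linv_word f) !exprD /KK; ring.
Qed.
End F.
End Law2.

Lemma prob_seqU (d : measure_display) (T : measurableType d) (R : realType)
  (P : probability T R) (I : eqType) (s : seq I) (A : I -> set T) :
  uniq s -> (forall i, measurable (A i)) ->
  (forall i j w, i \in s -> j \in s -> A i w -> A j w -> i = j) ->
  P [set w | exists2 i, i \in s & A i w] = \sum_(i <- s) P (A i).
Proof.
move=> us mA; elim: s us => [|i s IH] /= us hd.
  rewrite big_nil (_ : [set w | _] = set0) ?measure0 //.
  by apply/seteqP; split => // w [].
have ms : measurable [set w | exists2 i, i \in s & A i w].
  elim: s {IH us hd} => [|j s IH]; first by apply: m_ext (m_cst _ False) => w; split => // -[].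
  apply: m_ext (m_or (mA j) IH) => w; split.
    by case=> [h|[k ks h]]; [exists j|exists k] => //; rewrite in_cons ?eqxx ?ks ?orbT.
  by move=> [k]; rewrite in_cons => /orP[/eqP ->|ks] h; [left|right; exists k].
move: us => /andP[iN us]; rewrite big_cons -IH //; last first.
  by move=> k l w ks ls; apply: hd; rewrite in_cons ?ks ?ls orbT.
rewrite -measureU //.
  congr (P _); apply/seteqP; split => w.
    by move=> [k]; rewrite in_cons => /orP[/eqP ->|ks] h; [left|right; exists k].
  by case=> [h|[k ks h]]; [exists i|exists k] => //; rewrite in_cons ?eqxx ?ks ?orbT.
apply/seteqP; split => // w [h [k ks h']].
have e : i = k by apply: (hd i k w) => //; rewrite in_cons ?eqxx ?ks ?orbT.
by rewrite e ks in iN.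
Qed.

(** * The order of visits to a window is Mallows distributed *)

Section Law3.
Context (R : realType) (q : R) (hq0 : (0 <= q)%R) (hq1 : (q < 1)%R)
  (d : measure_display) (Omega : measurableType d) (P : probability Omega R)
  (Bp Bm : Omega -> nat -> nat -> bool) (M : Omega -> nat -> nat)
  (mBp : forall i j, measurable [set w | Bp w i j])
  (mBm : forall i j, measurable [set w | Bm w i j])
  (mM : forall i m, measurable [set w | M w i = m])
  (hlaw : input_law q P Bp Bm M).

Definition Xw w := two_sided_mallows (mallowsN (Bp w)) (mallowsN (Bm w)) (M w).

Definition good w := [/\ goodB (Bp w), goodB (Bm w) &
  exists n, forall i, (n < i)%N -> M w i = 0%N].

Lemma m_goodB (B : Omega -> nat -> nat -> bool) : (forall i j, measurable [set w | B w i j]) ->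
  measurable [set w | goodB (B w)].
Proof.
move=> mB; apply: m_and; apply: m_all => i; apply: m_all => n; apply: m_imp;
  by [exact: m_cst|apply: m_ex2 => j; [exact: m_cst|exact: mB]].
Qed.

Lemma m_good : measurable [set w | good w].
Proof.
apply: m_ext (m_and (m_goodB mBp) (m_and (m_goodB mBm) (m_ex (fun n : nat => m_all (fun i : nat =>
  m_imp (m_cst _ (n < i)%N) (mM i 0%N)))))) => w.
by split=> [[h1 [h2 h3]]|[h1 h2 h3]]; split.
Qed.

Lemma le_expr0 (x : \bar R) : 0 <= x -> (forall L, x <= (q ^+ L)%:E) -> x = 0.
Proof.
case: x => [x||]; [|by move=> _ /(_ 0%N)|by []].
rewrite lee_fin => x0 h; congr (_%:E); apply/eqP; rewrite eq_le x0 andbT.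
have c : (q ^+ L)%R @[L --> \oo] --> (0 : R)%R by apply: cvg_expr; rewrite ger0_norm.
rewrite -(cvg_lim (@Rhausdorff R) c); apply: limr_ge; first by apply/cvg_ex; exists 0%R.
by apply: nearW => L; have := h L; rewrite lee_fin.
Qed.

(** The first [L] of these coordinates all vanish with probability q^L, which tends to 0. *)
Lemma inf_often (g : nat -> icoord) : injective g -> (forall k, valid (g k)) ->
  (forall k, if g k is inl _ then true else false) ->
  P [set w | exists k, cval Bp Bm M w (g k) = 1%N] = 1.
Proof.
move=> ig vg lg.
have mv c n := mval mBp mBm mM c n.
have mA : measurable [set w | exists k, cval Bp Bm M w (g k) = 1%N] by apply: m_ex => k; exact: mv.
apply: prob1C => //; apply: le_expr0 => // L.
have u : uniq (map g (iota 0 L)) by rewrite map_inj_uniq ?iota_uniq.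
have vs : all valid (map g (iota 0 L)) by apply/allP => c /mapP[k _ ->].
have := law hq0 hq1 mBp mBm mM hlaw u vs (fun=> 0%N).
rewrite big_map (eq_bigr (fun=> q)); last by move=> k _; have := lg k; case: (g k).
rewrite (_ : \prod_(i <- iota 0 L) q = q ^+ L)%R; last first.
  by rewrite big_const_seq count_predT size_iota iter_mulr_1.
move=> <-; apply: le_measure; rewrite ?inE.
- exact: measurableC.
- exact: (mev mBp mBm mM).
move=> w /= h c /mapP[k _ ->]; have := lg k; have : cval Bp Bm M w (g k) <> 1%N by move=> e; apply: h; exists k.
by case: (g k) => // -[b [i j]] /=; case: b; [case: (Bp w i j)|case: (Bm w i j)].
Qed.

Lemma P_goodB (b : bool) : P [set w | goodB ((if b then Bp else Bm) w)] = 1.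
Proof.
have mB i j : measurable [set w | (if b then Bp else Bm) w i j] by case: b.
have hv w i j : cval Bp Bm M w (inl (b, (i, j))) = ((if b then Bp else Bm) w i j : nat) by case: (b).
rewrite /goodB; apply: prob1_and.
- apply: m_all => i; apply: m_all => n; apply: m_imp;
    by [exact: m_cst|apply: m_ex2 => j; [exact: m_cst|exact: mB]].
- apply: m_all => i; apply: m_all => n; apply: m_imp;
    by [exact: m_cst|apply: m_ex2 => j; [exact: m_cst|exact: mB]].
- apply: prob1_forall => i; first by apply: m_all => n; apply: m_imp;
    [exact: m_cst|apply: m_ex2 => j; [exact: m_cst|exact: mB]].
  apply: prob1_forall => n; first by apply: m_imp;
    [exact: m_cst|apply: m_ex2 => j; [exact: m_cst|exact: mB]].
  case: (posnP i) => [->|i0].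
    by rewrite (_ : [set w | _] = setT) ?probability_setT //; apply/seteqP; split.
  have h := @inf_often (fun k => inl (b, (i, (n + k).+1))) _ (fun k => _) (fun k => isT).
  apply: prob1_sub (h _ _) _.
  + by apply: m_ex => k; exact: (mval mBp mBm mM).
  + apply: m_imp; first exact: m_cst.
    by apply: m_ex2 => j; [exact: m_cst|exact: mB].
  + by move=> k k' [] /addnI.
  + by move=> k /=; rewrite i0.
  + move=> w [k]; rewrite hv => e _; exists (n + k).+1; first by rewrite ltnS leq_addr.
    by move: e; case: (_ w i _).
- apply: prob1_forall => j; first by apply: m_all => n; apply: m_imp;
    [exact: m_cst|apply: m_ex2 => i; [exact: m_cst|exact: mB]].
  apply: prob1_forall => n; first by apply: m_imp;
    [exact: m_cst|apply: m_ex2 => i; [exact: m_cst|exact: mB]].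
  case: (posnP j) => [->|j0].
    by rewrite (_ : [set w | _] = setT) ?probability_setT //; apply/seteqP; split.
  have h := @inf_often (fun k => inl (b, ((n + k).+1, j))) _ (fun k => _) (fun k => isT).
  apply: prob1_sub (h _ _) _.
  + by apply: m_ex => k; exact: (mval mBp mBm mM).
  + apply: m_imp; first exact: m_cst.
    by apply: m_ex2 => i; [exact: m_cst|exact: mB].
  + by move=> k k' [] /addnI.
  + by move=> k /=; rewrite j0.
  + move=> w [k]; rewrite hv => e _; exists (n + k).+1; first by rewrite ltnS leq_addr.
    by move: e; case: (_ w _ j).
Qed.

(** Borel-Cantelli: the probabilities q^(k+1) of a nonzero [M] at index k + 1 are summable. *)
Lemma P_finM : P [set w | exists n, forall i, (n < i)%N -> M w i = 0%N] = 1.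
Proof.
pose F k := [set w | M w k.+1 <> 0%N].
have mF k : measurable (F k) by apply: m_not; exact: mM.
have hF k : P (F k) = (q * q ^+ k)%:E.
  have -> : F k = ~` [set w | M w k.+1 = 0%N] by [].
  rewrite probability_setC // (law1 hq0 hq1 mBp mBm mM hlaw (c := inr k.+1) 0%N) //=.
  by rewrite muln0 expr0 mul1r -EFinB -exprS; congr (_%:E); ring.
have := @lim_sup_set_cvg0 _ _ _ P F mF.
rewrite (eq_eseriesr (fun n _ => hF n)) (nneseries_EFin (l := (q / (1 - q))%R)); last first.
  have := @cvg_geometric_series R q q; rewrite ger0_norm // => /(_ hq1); exact.
rewrite ltry => /(_ isT) h0.
have mN : measurable [set w | exists n, forall i, (n < i)%N -> M w i = 0%N].
  by apply: m_ex => n; apply: m_all => i; apply: m_imp; [exact: m_cst|exact: mM].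
apply: prob1C => //; apply: prob0_sub h0 _ => //.
- exact: measurableC.
- by apply: bigcap_measurableType => n _; apply: bigcup_measurable => k _.
move=> w /= h n _; apply: contrapT => hn; apply: h; exists n => -[//|i] hi.
by apply: contrapT => hM; apply: hn; exists i.
Qed.

Lemma P_good : P [set w | good w] = 1.
Proof.
have -> : [set w | good w] = [set w | goodB (Bp w)] `&` ([set w | goodB (Bm w)] `&`
    [set w | exists n, forall i, (n < i)%N -> M w i = 0%N]).
  by apply/seteqP; split => w; [move=> []|move=> [? []]].
have mN : measurable [set w | exists n, forall i, (n < i)%N -> M w i = 0%N].
  by apply: m_ex => n; apply: m_all => i; apply: m_imp; [exact: m_cst|exact: mM].
apply: prob1_and; [exact: m_goodB|apply: measurableI => //; exact: m_goodB|exact: (P_goodB true)|].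
by apply: prob1_and => //; [exact: m_goodB|exact: (P_goodB false)|exact: P_finM].
Qed.

Definition consinf (a b : nat) (f : seq int) : set Omega :=
  [set w | hpm Bp Bm a b f w /\ forall i, (0 < i)%N -> M w i = count_mem i (lam f)].

Lemma KK_cvg a b : cvg (KK q a b N @[N --> \oo]).
Proof.
apply: nonincreasing_is_cvgn.
  apply/nonincreasing_seqP => N; rewrite /KK -(addn1 N) iotaD big_cat /= big_seq1.
  rewrite mulrA ler_piMr //; last by rewrite gerBl exprn_ge0.
  have h : (0 <= 1 - q)%R by rewrite subr_ge0 ltW.
  rewrite !mulr_ge0 ?exprn_ge0 // prodr_ge0 // => i _.
  by rewrite subr_ge0 exprn_ile1 // ltW.
exists 0%R => _ [N _ <-]; have h : (0 <= 1 - q)%R by rewrite subr_ge0 ltW.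
rewrite /KK !mulr_ge0 ?exprn_ge0 // prodr_ge0 // => i _.
by rewrite subr_ge0 exprn_ile1 // ltW.
Qed.

Section F2.
Variables (a b L : nat) (f : seq int).
Hypothesis pf : perm_eq f (wbase a b L).

Lemma mevas s : measurable (evas Bp Bm M s).
Proof.
rewrite /evas; elim: s => [|t s IH]; first by apply: m_ext (m_cst _ True) => w; split.
apply: m_ext (m_and (mval mBp mBm mM t.1 t.2) IH) => w; split.
  by move=> [h1 h2] t'; rewrite in_cons => /orP[/eqP->//|/h2].
by move=> h; split=> [|t' ht]; apply: h; rewrite in_cons ?eqxx // ht orbT.
Qed.

Lemma consinf_cap : consinf a b f = \bigcap_N evas Bp Bm M (asF a b f N).
Proof.
apply/seteqP; split => w.
  by move=> [h1 h2] N _; apply/(consP Bp Bm M pf); split => // i /andP[i0 _]; exact: h2.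
move=> h; split; first by have /(consP Bp Bm M pf) [] := h 0%N I.
by move=> i i0; have /(consP Bp Bm M pf) [_] := h i I; apply; rewrite i0 leqnn.
Qed.

Lemma m_consinf : measurable (consinf a b f).
Proof. by rewrite consinf_cap; apply: bigcapT_measurable => N; exact: mevas. Qed.

Lemma consinf_prob : P (consinf a b f) = (q ^+ linv f * limn (KK q a b))%:E.
Proof.
have c1 : P (evas Bp Bm M (asF a b f N)) @[N --> \oo] --> P (consinf a b f).
  rewrite consinf_cap; apply: (@nonincreasing_cvg_mu _ _ _ P (fun N => evas Bp Bm M (asF a b f N))).
  - by rewrite (le_lt_trans (probability_le1 _ _)) ?ltry //; exact: mevas.
  - by move=> N; exact: mevas.
  - by rewrite -consinf_cap; exact: m_consinf.
  move=> n m nm; apply/subsetPset => w /(consP Bp Bm M pf) [h1 h2]; apply/(consP Bp Bm M pf); split => //.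
  by move=> i /andP[i0 hi]; apply: h2; rewrite i0 (leq_trans hi).
have c2 : P (evas Bp Bm M (asF a b f N)) @[N --> \oo] --> (q ^+ linv f * limn (KK q a b))%:E.
  have c3 : (q ^+ linv f * KK q a b N)%:E @[N --> \oo] --> (q ^+ linv f * limn (KK q a b))%:E.
    by apply: cvg_EFin; [exact: nearW|apply: cvgM; [exact: cvg_cst|exact: KK_cvg]].
  apply: cvg_trans c3; apply: near_eq_cvg; near=> N.
  rewrite (cons_prob hq0 hq1 mBp mBm mM hlaw pf) //; near: N; exact: nbhs_infty_ge.
exact: (cvg_unique _ c1 c2).
Unshelve. all: by end_near. Qed.
End F2.

(* The entries of s are visited by X in this order. *)
Definition evE (s : seq int) : set Omega := [set w | good w /\
  forall i, (i.+1 < size s)%N -> exists z z' : int, [/\ (z < z')%R, Xw w z = nth 0%R s i & Xw w z' = nth 0%R s i.+1]].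

Lemma m_Xw z v : measurable [set w | Xw w z = v].
Proof. exact: m_X. Qed.

Lemma m_evE s : measurable (evE s).
Proof.
apply: m_and; first exact: m_good.
apply: m_all => i; apply: m_imp; first exact: m_cst.
apply: m_ex => z; apply: m_ex => z'.
apply: m_ext (m_and (m_cst _ (z < z')%R) (m_and (m_Xw z (nth 0%R s i)) (m_Xw z' (nth 0%R s i.+1)))) => w.
by split=> [[h1 [h2 h3]]|[h1 h2 h3]]; split.
Qed.

Lemma evEP s w pos : good w -> cancel (Xw w) pos -> cancel pos (Xw w) ->
  evE s w <-> ordered pos s.
Proof.
move=> gw XK pK; split.
  move=> [_ h]; apply/(sortedP 0%R) => i hi; have [z [z' [zz <- <-]]] := h i hi.
  by rewrite !XK.
move=> /(sortedP 0%R) h; split => // i hi.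
by exists (pos (nth 0%R s i)), (pos (nth 0%R s i.+1)); split; rewrite ?pK //; exact: h.
Qed.

Lemma good_pos w : good w -> exists pos, cancel (Xw w) pos /\ cancel pos (Xw w).
Proof. by move=> [h1 h2 _]; exact: X_pos. Qed.

Lemma wbase_filter a b L lo n : (1 - a%:Z <= lo)%R -> (lo + n%:Z <= b%:Z + 1)%R ->
  seq.filter (mem (window lo n)) (wbase a b L) = window lo n.
Proof.
move=> h1 h2; rewrite /wbase !filter_cat.
have -> : seq.filter (mem (window lo n)) (nseq (L - a) (- a%:Z)%R) = [::].
  rewrite (eq_in_filter (a2 := pred0)) ?filter_pred0 // => x; rewrite mem_nseq => /andP[_ /eqP ->] /=.
  by rewrite mem_window; apply/negbTE; lia.
have -> : seq.filter (mem (window lo n)) (nseq (L - b) b.+1%:Z) = [::].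
  rewrite (eq_in_filter (a2 := pred0)) ?filter_pred0 // => x; rewrite mem_nseq => /andP[_ /eqP ->] /=.
  by rewrite mem_window; apply/negbTE; lia.
rewrite cats0 /=; apply: lt_sorted_eq.
- by apply: sorted_filter; [exact: lt_trans|exact: sorted_window].
- exact: sorted_window.
- by move=> x; rewrite mem_filter /= !mem_window; lia.
Qed.

(** On the event that a compatible word of parameter [L] exists, the order of visits is the pattern
    of that word, so the probability is a sum of word weights and [sum_relabel] compares [x] with
    the increasing order. Then [L] tends to infinity. *)
Lemma evE_law lo n x : x \in permutations (window lo n) ->
  P (evE x) = (q ^+ linv x)%:E * P (evE (window lo n)).
Proof.
move=> px; set V := window lo n.
(* Chosen so that the window lies inside the values from [1 - a] to [b] that clipping fixes. *)
pose a := (absz lo).+1; pose b := (absz lo + n)%N.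
have ha : (1 - a%:Z <= lo)%R by rewrite /a; lia.
have hb : (lo + n%:Z <= b%:Z + 1)%R by rewrite /b; lia.
have hJ v : mem V v -> (1 - a%:Z <= v <= b%:Z)%R by rewrite /= mem_window /a /b; lia.
pose Q L : set Omega := [set w | exists2 f, f \in permutations (wbase a b L) & ([set w | good w] `&` \bigcap_N evas Bp Bm M (asF a b f N)) w].
have mC f : measurable ([set w | good w] `&` \bigcap_N evas Bp Bm M (asF a b f N)).
  by apply: measurableI; [exact: m_good|apply: bigcapT_measurable => N; exact: mevas].
have mQ L : measurable (Q L).
  by apply: m_ex2 => f; [exact: m_cst|exact: mC].
have hx y L : y \in permutations V -> P (evE y `&` Q L) =
    (limn (KK q a b) * \sum_(f <- permutations (wbase a b L) | seq.filter (mem V) f == y) 1 * q ^+ linv f)%:E.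
  rewrite mem_permutations => py.
  have hord f w pos : perm_eq f (wbase a b L) -> good w -> consinf a b f w ->
      cancel (Xw w) pos -> cancel pos (Xw w) -> ordered pos (seq.filter (mem V) f).
    move=> pf [g1 g2 g3] [[c1 c2] c3] XK pK.
    exact: (@word_ordered (Bp w) (Bm w) (M w) g1 g2 f a b c3 c1 c2 pos (mem V)).
  have -> : evE y `&` Q L = [set w | exists2 f, f \in [seq f <- permutations (wbase a b L) | seq.filter (mem V) f == y] &
      ([set w | good w] `&` \bigcap_N evas Bp Bm M (asF a b f N)) w].
    apply/seteqP; split => w.
      move=> [hE [f pf [gw hc]]]; exists f => //; rewrite mem_filter pf andbT.
      rewrite mem_permutations in pf; rewrite -(consinf_cap pf) in hc.
      have [pos [XK pK]] := good_pos gw.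
      have o1 := hord f w pos pf gw hc XK pK; have /(evEP y gw XK pK) o2 := hE.
      apply/eqP; apply: (ordered_eq o1 o2) => v.
      have := perm_filter (mem V) pf; rewrite (wbase_filter L ha hb) => pff.
      by rewrite (perm_mem py) (perm_mem pff).
    move=> [f]; rewrite mem_filter => /andP[/eqP fy pf] [gw hc]; split; last by exists f.
    rewrite mem_permutations in pf; rewrite -(consinf_cap pf) in hc.
    have [pos [XK pK]] := good_pos gw.
    by apply/(evEP y gw XK pK); rewrite -fy; exact: (hord f w).
  (* Different words give disjoint events because [X_word] recovers every letter from the
     outcome. *)
  rewrite prob_seqU //; last 2 first.
  - by rewrite filter_uniq // permutations_uniq.
  - move=> f f' w; rewrite !mem_filter => /andP[_ pf] /andP[_ pf'] [gw hc] [_ hc'].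
    rewrite !mem_permutations in pf pf'; rewrite -(consinf_cap pf) in hc; rewrite -(consinf_cap pf') in hc'.
    have [g1 g2 _] := gw; have [[c1 c2] c3] := hc; have [[c1' c2'] c3'] := hc'.
    have pp : perm_eq f f' by rewrite (perm_trans pf) // perm_sym.
    have nn : nneg f = nneg f' by exact: (seq.permP pp).
    apply: (@eq_from_nth _ 0%R); first exact: perm_size.
    move=> p hp; rewrite -(X_word g1 g2 c3 c1 c2) // nn (X_word g1 g2 c3' c1' c2') //.
    by rewrite -(perm_size pp).
  rewrite big_filter mulr_sumr -sumEFin big_seq_cond [RHS]big_seq_cond.
  apply: eq_bigr => f /andP[]; rewrite mem_permutations => pf _.
  transitivity (P ((\bigcap_N evas Bp Bm M (asF a b f N)) `&` [set w | good w])); first by rewrite setIC.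
  rewrite (prob1I _ m_good P_good); last by apply: bigcapT_measurable => N; exact: mevas.
  by rewrite -(consinf_cap pf) (consinf_prob pf) mul1r mulrC.
have hxV y L : y \in permutations V -> P (evE y `&` Q L) = (q ^+ linv y)%:E * P (evE V `&` Q L).
  move=> py; rewrite !hx ?mem_permutations //; last by rewrite -mem_permutations.
  rewrite -EFinM; congr (_%:E); rewrite mulrCA; congr (_ * _)%R.
  apply: (@sum_relabel _ q (wbase a b L) V y (fun=> 1%R)) => //.
  - exact: uniq_window.
  - by rewrite -mem_permutations.
  - exact: convex_window.
  - exact: linv_window.
  - by rewrite wbase_filter.
have ev w : good w -> exists N, forall L, (N <= L)%N -> Q L w.
  move=> gw; have [g1 g2 g3] := gw; have [L0 h0] := word_exists a b g1 g2 g3.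
  exists L0 => L /h0 [f [pf c3 c1 c2]]; exists f; first by rewrite mem_permutations.
  by split => //; rewrite -(consinf_cap pf).
have cx y := prob_evt_cvg (m_evE y) m_good mQ P_good ev.
have c1 := cx x; have c2 := cx V.
have c3 : P (evE x `&` Q L) @[L --> \oo] --> (q ^+ linv x)%:E * P (evE V).
  by under eq_cvg do rewrite hxV //; apply: cvgeZl.
exact: (cvg_unique _ c1 c3).
Qed.

Definition arrQ (V : seq int) (Q : seq int -> bool) : set Omega :=
  [set w | exists2 s, s \in [seq s <- permutations V | Q s] & evE s w].

(** By [evE_law] the probabilities are proportional to the Mallows weights, and almost surely some
    order occurs; the total mass 1 identifies the constant as the inverse of [wtot]. *)
Lemma arrQ_law lo n Q : P (arrQ (window lo n) Q) = (wexp q (window lo n) Q)%:E.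
Proof.
set V := window lo n; have D : P (evE V) \is a fin_num by exact: fin_num_measure (m_evE V).
have h Q' : P (arrQ V Q') = (wsum q V (fun s => (Q' s)%:R) * fine (P (evE V)))%:E.
  rewrite /arrQ prob_seqU ?filter_uniq ?permutations_uniq //; last 2 first.
  - exact: m_evE.
  - move=> s s' w; rewrite !mem_filter !mem_permutations => /andP[_ ps] /andP[_ ps'] h h'.
    have gw : good w by case: h.
    have [pos [XK pK]] := good_pos gw.
    move/(evEP s gw XK pK): h => o1; move/(evEP s' gw XK pK): h' => o2.
    by apply: (ordered_eq o1 o2) => v; rewrite (perm_mem ps) (perm_mem ps').
  rewrite big_filter big_mkcond /= /wsum mulr_suml -sumEFin; apply: eq_big_seq => s ps.
  case: (Q' s); last by rewrite !mul0r.
  by rewrite (evE_law ps) mul1r EFinM fineK.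
have h1 : P (arrQ V xpredT) = 1.
  apply: (prob1_sub m_good _ P_good).
    by rewrite /arrQ; apply: m_ex2 => s; [exact: m_cst|exact: m_evE].
  move=> w gw; have [pos [XK pK]] := good_pos gw.
  have [s ps os] := ordered_exists (can_inj pK) (uniq_window lo n).
  by exists s; [rewrite mem_filter mem_permutations|apply/(evEP s gw XK pK)].
have e : (wtot q V * fine (P (evE V)) = 1)%R.
  by have := h xpredT; rewrite h1 => -[].
have w0 : wtot q V != 0%R by rewrite gt_eqF // wtot_gt0.
rewrite h /wexp; congr (_%:E); congr (_ * _)%R.
by apply: (mulfI w0); rewrite e divff.
Qed.
End Law3.
Local Close Scope ereal_scope.

(** * From chains of first letters to blocks between records *)

Lemma ordered_head pos s (c : int) : ordered pos s -> (ohead s == Some c) <->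
  (c \in s) /\ (forall v, v \in s -> v != c -> pos c < pos v).
Proof.
case: s => [|x s] o /=; first by split => // -[].
have hx v : v \in s -> pos x < pos v.
  by move=> vs; have /allP := order_path_min (fun (y x z : int) => @lt_trans _ _ (pos y) (pos x) (pos z)) o; apply.
split.
  move=> /eqP[<-]; split; first exact: mem_head.
  by move=> v; rewrite in_cons => /orP[/eqP ->|vs _]; [rewrite eqxx|exact: hx].
rewrite in_cons => -[/orP[/eqP ->//|cs] h]; apply/eqP; congr Some; apply/eqP.
apply: contraT => ne; have := h x (mem_head _ _) ne; have := hx c cs; lia.
Qed.

Fixpoint len (l : seq (nat * (seq int -> bool))) : nat :=
  if l is (n, _) :: l' then (n.+1 + len l')%N else 0%N.

(* Order-theoretic form of chain: c' precedes, in position, all other values in (c, B). *)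
Fixpoint stepsB (pos : int -> int) (B : option int) (c : int) (l : seq (nat * (seq int -> bool))) : Prop :=
  if l is (n, T) :: l' then
    let c' := c + n.+1%:Z in
    [/\ (forall v, c < v -> (if B is Some b then v < b else true) -> v != c' -> pos c' < pos v),
        (exists x, [/\ perm_eq x (window (c + 1) n), ordered pos x & T x]) &
        stepsB pos B c' l']
  else True.

Lemma chain_steps pos B c l s : ordered pos s -> (forall v, v \in s = (c < v < B)) ->
  c + (len l)%:Z < B -> chain c l s <-> stepsB pos (Some B) c l.
Proof.
elim: l c s => [|[n T] l IH] c s o hs hB //=.
set c' := c + n.+1%:Z; move: hB => /= hB.
have o1 : ordered pos [seq y <- s | y < c'] by apply: ordered_filter.
have e1 v : v \in [seq y <- s | y < c'] = (v \in window (c + 1) n).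
  by rewrite mem_filter hs mem_window /c'; lia.
have u1 : uniq [seq y <- s | y < c'].
  apply: sorted_uniq o1 => [y x z|x]; [exact: lt_trans|exact: ltxx].
have p1 : perm_eq [seq y <- s | y < c'] (window (c + 1) n).
  by apply: uniq_perm => //; exact: uniq_window.
have o2 : ordered pos [seq y <- s | c' < y] by apply: ordered_filter.
have hs2 v : v \in [seq y <- s | c' < y] = (c' < v < B).
  by rewrite mem_filter hs /c'; lia.
have hB' : c' + (len l)%:Z < B by rewrite /c'; lia.
have {}IH := IH c' _ o2 hs2 hB'.
have cs : c' \in s by rewrite hs /c'; lia.
have hh := ordered_head c' o.
split.
  move=> /and3P[h1 h2 h3]; split.
  - by move=> v cv vB ne; have [_] := (proj1 hh) h1; apply => //; rewrite hs cv vB.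
  - by exists [seq y <- s | y < c'].
  - exact/IH.
move=> [h1 [x [px ox Tx]] h3]; apply/and3P; split.
- apply/hh; split => // v; rewrite hs => /andP[cv vB]; exact: h1.
- rewrite (_ : [seq y <- s | y < c'] = x) //; apply: ordered_eq o1 ox _ => v.
  by rewrite e1 (perm_mem px).
- exact/IH.
Qed.

Lemma stepsB_all pos c l (B0 : int) : stepsB pos None c l <->
  (forall N : nat, stepsB pos (Some (B0 + N%:Z)) c l).
Proof.
elim: l c => [|[n T] l IH] c //=; split.
  move=> [h1 h2 h3] N; split => //; first by move=> v cv _; exact: h1.
  by have /IH := h3; apply.
move=> h; split.
- by move=> v cv _ ne; have [h1 _ _] := h (absz (v + 1 - B0)%R); apply: h1 => //; lia.
- by case: (h 0%N).
- by apply/IH => N; case: (h N).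
Qed.

Section Blocks.
Variables (sg pos : int -> int).
Hypotheses (sgK : cancel sg pos) (posK : cancel pos sg).
Hypothesis hb : exists p0 : int, forall k : int, k < p0 -> sg k <= 0.

Let blk (k : int) : seq int := sigma_block sg k.
Let av (k : int) : int := aval sg k.

Lemma blkP (k : int) : ordered pos (blk k) /\ perm_eq (blk k) (window (av k + 1) (absz (av (k + 1) - av k - 1)%R)).
Proof.
have [s ps os] := ordered_exists (can_inj posK) (uniq_window (av k + 1) (absz (av (k + 1) - av k - 1)%R)).
have e : blk k = s; last by rewrite e.
apply: (sigma_block_eq sgK posK) => // v; rewrite (perm_mem ps) mem_window.
have : av k < av (k + 1) by apply: (aval_mono sgK posK hb); lia.
by rewrite /av => h; split; lia.
Qed.

Lemma blk_uniq (k : int) : uniq (blk k).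
Proof. by have [_ p] := blkP k; rewrite (perm_uniq p) uniq_window. Qed.

Lemma blk_size (k : int) : av (k + 1) = av k + (size (blk k)).+1%:Z.
Proof.
have [_ p] := blkP k; rewrite (perm_size p) size_window.
have : av k < av (k + 1) by apply: (aval_mono sgK posK hb); lia.
move: (av k) (av (k + 1)) => x y; lia.
Qed.

Fixpoint Blk (k : int) (l : seq (nat * (seq int -> bool))) : Prop :=
  if l is (n, T) :: l' then [/\ size (blk k) = n, T (blk k) & Blk (k + 1) l'] else True.

(** By [aval_next] the first visited value above a record value is the next record value, so a chain
    started at a record value advances by exactly one block at each step. *)
Lemma steps_Blk (k : int) l : stepsB pos None (av k) l <-> Blk k l.
Proof.
elim: l k => [|[n T] l IH] k //=; have [ho hp] := blkP k; have hz := blk_size k; split.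
  move=> [h1 [x [px ox Tx]] h3].
  have e : av k + n.+1%:Z = av (k + 1).
    apply/eqP; apply: contraT => ne.
    have k1 : av k < av (k + 1) by apply: (aval_mono sgK posK hb); lia.
    have := h1 (av (k + 1)) k1 isT; rewrite eq_sym => /(_ ne).
    have := aval_next sgK posK hb (k := k) (v := av k + n.+1%:Z); rewrite -/(av _) -/(av _) => /(_ _ ne).
    by rewrite /av; lia.
  have en : size (blk k) = n by lia.
  have ex : blk k = x.
    apply: (ordered_eq ho ox) => v; rewrite (perm_mem hp) (perm_mem px) !mem_window; lia.
  split => //; first by rewrite ex.
  by apply/IH; rewrite -e.
move=> [en Tb h]; have e : av k + n.+1%:Z = av (k + 1) by rewrite hz en.
rewrite e; split.
- by move=> v kv _ ne; exact: (aval_next sgK posK hb).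
- exists (blk k); split => //; rewrite (_ : n = absz (av (k + 1) - av k - 1)%R) //; lia.
- exact/IH.
Qed.

(** A first step with empty gap from [c - 1] says that [c] precedes all larger values, hence is a
    record value. This makes a chain event assert where it starts. *)
Lemma steps_start (c : int) T l : stepsB pos None (c - 1) ((0%N, T) :: l) <->
  T [::] /\ exists2 k, c = av k & Blk k l.
Proof.
rewrite /= (_ : c - 1 + 1%:Z = c); last by lia.
split.
  move=> [h1 [x [px _ Tx]] h3]; have e : x = [::] by apply/nilP; rewrite /nilp (perm_size px).
  rewrite e in Tx; split => //; have [|k e'] := fst_aval sgK posK hb (c := c).
    by move=> v cv; apply: h1 => //; lia.
  by exists k => //; apply/steps_Blk; rewrite /av -e'.
move=> [T0 [k -> h]]; split.
- move=> v kv _ ne; apply: (aval_fst sgK posK hb); rewrite -/(av k); lia.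
- by exists [::]; split.
- exact/steps_Blk.
Qed.

Lemma Blk_size (k : int) l : Blk k l -> av (k + (size l)%:Z) = av k + (len l)%:Z.
Proof.
elim: l k => [|[n T] l IH] k /=; first by rewrite !addr0.
move=> [en _ /IH]; rewrite blk_size en => e.
rewrite (_ : k + (size l).+1%:Z = k + 1 + (size l)%:Z); last by lia.
by rewrite e; lia.
Qed.

Lemma Blk_cat (k : int) l l' : Blk k (l ++ l') <-> Blk k l /\ Blk (k + (size l)%:Z) l'.
Proof.
elim: l k => [|[n T] l IH] k /=; first by rewrite addr0; split => // -[].
rewrite (_ : k + (size l).+1%:Z = k + 1 + (size l)%:Z); last by lia.
split => [[h1 h2 /(IH (k + 1)) [h3 h4]]|[[h1 h2 h3] h4]]; split => //.
by apply/(IH (k + 1)).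
Qed.

(** The chain passes through the record value [- e], and the next one is [- e + n + 1], positive
    because [e <= n]. So [- e] has index 0, which fixes the indices of all blocks of the chain. *)
Lemma steps_centered l n T l' (e : nat) (k : int := - (size l)%:Z) : e \in iota 0 n.+1 ->
  stepsB pos None (- e%:Z - (len l)%:Z - 1) ((0%N, xpredT) :: l ++ (n, T) :: l') ->
  - e%:Z - (len l)%:Z = av k /\ Blk k (l ++ (n, T) :: l').
Proof.
have [h1 h2 /andP[h3 h4]] := records_spec sgK posK hb; rewrite -/(aval sg 0) in h3; rewrite -/(aval sg 1) in h4.
rewrite mem_iota => he /steps_start [_ [j ej h]].
have /Blk_cat [hl] := h; move=> [en _ _].
have e0 := Blk_size hl; have e1 := blk_size (j + (size l)%:Z); rewrite en in e1.
suff -> : k = j by split.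
have mono := aval_mono sgK posK hb.
have j0 : j + (size l)%:Z = 0.
  case: (ltgtP (j + (size l)%:Z) 0) => // hj.
    have h0 : j + (size l)%:Z + 1 <= 0 by lia.
    have : av (j + (size l)%:Z + 1) <= av 0.
      by move: h0; rewrite le_eqVlt => /orP[/eqP ->//|/mono /ltW].
    by rewrite /av in e0 e1 ej *; lia.
  have h0 : 1 <= j + (size l)%:Z by lia.
  have : av 1 <= av (j + (size l)%:Z).
    by move: h0; rewrite le_eqVlt => /orP[/eqP <-//|/mono /ltW].
  by rewrite /av in e0 e1 ej *; lia.
by rewrite /k; lia.
Qed.

(* The offset e is minus the largest record value that is at most 0. *)
Lemma Blk_centered l n T l' (k : int := - (size l)%:Z) :
  Blk k (l ++ (n, T) :: l') <->
  exists2 e : nat, e \in iota 0 n.+1 &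
    stepsB pos None (- e%:Z - (len l)%:Z - 1) ((0%N, xpredT) :: l ++ (n, T) :: l').
Proof.
have [h1 h2 /andP[h3 h4]] := records_spec sgK posK hb; rewrite -/(aval sg 0) in h3; rewrite -/(aval sg 1) in h4.
split.
  move=> h; have /Blk_cat [hl] := h; rewrite addNr => -[en Tb _].
  have e0 := Blk_size hl; rewrite addNr in e0.
  have e1 := blk_size 0; rewrite add0r en in e1.
  exists (absz (av 0)); first by rewrite mem_iota; rewrite /av in e1 *; lia.
  apply/steps_start; split => //; exists k => //.
  have h3' : av 0 <= 0 := h3.
  by move: e0 h3'; move: (av 0) (av k) => x y; lia.
by move=> [e he hs]; case: (steps_centered he hs).
Qed.

Lemma Blk_map (ent : int -> nat * (seq int -> bool)) (k : int) n :
  Blk k (map ent (window k n)) <->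
  (forall j, j \in window k n -> size (blk j) = (ent j).1 /\ (ent j).2 (blk j)).
Proof.
elim: n k => [|n IH] k; first by [].
rewrite windowS /=; case ek : (ent k) => [a b]; split.
  move=> [h1 h2 /IH h3] j; rewrite in_cons => /orP[/eqP ->|/h3//].
  by rewrite ek.
move=> h; have := h k (mem_head _ _); rewrite ek => -[h1 h2]; split => //.
by apply/IH => j hj; apply: h; rewrite in_cons hj orbT.
Qed.
End Blocks.

Lemma stepsB_mono pos (B B' : int) c l : B <= B' -> stepsB pos (Some B') c l -> stepsB pos (Some B) c l.
Proof.
move=> BB; elim: l c => [|[n T] l IH] c //= [h1 h2 h3]; split => //; last exact: IH.
by move=> v cv vB; apply: h1 => //; exact: lt_le_trans BB.
Qed.

Local Open Scope ereal_scope.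

(** * Measurability of records and blocks *)

Section MeasBlk.
Context (d : measure_display) (Omega : measurableType d) (X : Omega -> int -> int).
Hypothesis mX : forall z v, measurable [set w | X w z = v].

Lemma m_Xlt z z' : measurable [set w | (X w z < X w z')%R].
Proof.
apply: m_ext (m_ex (fun u : int => m_ex (fun v : int => m_and (m_cst _ (u < v)%R)
  (m_and (mX z u) (mX z' v))))) => w; split.
  by move=> [u [v [h [-> ->]]]].
by move=> h; exists (X w z), (X w z').
Qed.

Lemma m_record z : measurable [set w | is_record (X w) z].
Proof. by apply: m_all => k; apply: m_imp; [exact: m_cst|exact: m_Xlt]. Qed.

Lemma m_nextr y z : measurable [set w | nextr (X w) y z].
Proof.
apply: m_ext (m_and (m_and (m_cst _ (y < z)%R) (m_and (m_record y) (m_record z)))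
  (m_all (fun x : int => m_imp (m_cst _ (y < x)%R) (m_imp (m_cst _ (x < z)%R) (m_not (m_record x)))))) => w.
by split=> [[[h1 [h2 h3]] h4]|[h1 h2 h3 h4]]; split.
Qed.

Lemma m_Xle0 z : measurable [set w | (X w z <= 0)%R].
Proof.
apply: m_ext (m_ex (fun v : int => m_and (mX z v) (m_cst _ (v <= 0)%R))) => w; split.
  by move=> [v [-> ]].
by move=> h; exists (X w z).
Qed.

Lemma m_U0 z : measurable [set w | U0 (X w) z].
Proof.
apply: m_ext (m_and (m_and (m_record z) (m_Xle0 z))
  (m_all (fun y : int => m_imp (m_cst _ (z < y)%R) (m_imp (m_record y) (m_not (m_Xle0 y)))))) => w.
split=> [[[h1 h2] h3]|[h1 h2 h3]].
  by split => // y zy ry; rewrite ltNge; apply/negP; exact: h3.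
by split => // y zy ry; apply/negP; rewrite -ltNge; exact: h3.
Qed.

Lemma m_Ur k z : measurable [set w | Ur (X w) k z].
Proof.
case: k => n.
  elim: n z => [|n IH] z /=; first exact: m_U0.
  by apply: m_ex2 => y; [exact: IH|exact: m_nextr].
rewrite /Ur; elim: n.+1 z => [|m IH] z /=; first exact: m_U0.
by apply: m_ex2 => y; [exact: IH|exact: m_nextr].
Qed.

Lemma m_records k z : measurable [set w | records (X w) k = z].
Proof.
have mW : measurable [set w | forall k, exists z, Ur (X w) k z].
  by apply: m_all => k'; apply: m_ex => z'; exact: m_Ur.
apply: m_ext (m_or (m_and mW (m_Ur k z)) (m_and (m_not mW) (m_cst _ (z = 0%R)))) => w; split.
  move=> [[hW hz]|[hN ->]]; last by rewrite records_none.
  exact: Ur_fun (RSpec_Ur (recordsP hW) k) hz.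
move=> <-; case: (pselect (forall k, exists z, Ur (X w) k z)) => [hW|hN].
  by left; split => //; exact: RSpec_Ur (recordsP hW) k.
by right; split => //; rewrite records_none.
Qed.

Definition BSp w (z z' : int) (idx : seq int) := sorted (fun a b : int => (a < b)%R) idx /\
  forall i : int, i \in idx <-> (X w z < X w i < X w z')%R.

(** Unfolds the description of a block into countable quantifiers, including the case where no
    finite index list exists and the default is taken. *)
Lemma sigma_block_cases w k s : sigma_block (X w) k = s <->
  exists z z', (records (X w) k = z /\ records (X w) (k + 1) = z') /\
   ((exists idx, BSp w z z' idx /\ map (X w) idx = s) \/
    ((~ exists idx, BSp w z z' idx) /\ s = [::])).
Proof.
set r := records (X w).
have h1 idx : BSp w (r k) (r (k + 1)%R) idx -> sigma_block (X w) k = map (X w) idx.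
  move=> [a b]; apply: the_or_eq; first by exists idx.
  move=> y [idx' [a' b' ->]]; congr map; apply: lt_sorted_eq => // i.
  by apply/idP/idP => [/b' /b|/b /b'].
have h2 : ~ (exists idx, BSp w (r k) (r (k + 1)%R) idx) -> sigma_block (X w) k = [::].
  by move=> hN; apply: the_or_none => y [idx [a b _]]; apply: hN; exists idx.
split.
  move=> <-; exists (r k), (r (k + 1)%R); split => //.
  case: (pselect (exists idx, BSp w (r k) (r (k + 1)%R) idx)) => [[idx hi]|hN].
    by left; exists idx; split => //; rewrite (h1 idx).
  by right; rewrite h2.
move=> [z [z' [[<- <-] [[idx [hi <-]]|[hN ->]]]]]; [exact: h1|exact: h2].
Qed.

Lemma m_blk k s : measurable [set w | sigma_block (X w) k = s].
Proof.
have mB z z' idx : measurable [set w | BSp w z z' idx].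
  apply: m_and; first exact: m_cst.
  apply: m_all => i; apply: m_iff; first exact: m_cst.
  apply: m_ext (m_and (m_Xlt z i) (m_Xlt i z')) => w.
  by split=> [[-> ->]|/andP[]].
have mm idx : measurable [set w | map (X w) idx = s].
  elim: idx s => [|i idx IH] [|x s] /=.
  - exact: (m_cst _ ([::] = [::] :> seq int)).
  - by apply: m_ext (m_cst _ False) => w; split.
  - by apply: m_ext (m_cst _ False) => w; split.
  - by apply: m_ext (m_and (mX i x) (IH s)) => w; split=> [[-> ->]//|[-> ->]].
apply: m_ext (m_ex (fun z : int => m_ex (fun z' : int => m_and
  (m_and (m_records k z) (m_records (k + 1)%R z'))
  (m_or (m_ex (fun idx : seq int => m_and (mB z z' idx) (mm idx)))
        (m_and (m_not (m_ex (fun idx : seq int => mB z z' idx))) (m_cst _ (s = [::]))))))) => w.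
by split => /sigma_block_cases.
Qed.

Lemma m_blkP k (Phi : seq int -> Prop) : measurable [set w | Phi (sigma_block (X w) k)].
Proof.
apply: m_ext (m_ex (fun s : seq int => m_and (m_blk k s) (m_cst _ (Phi s)))) => w; split.
  by move=> [s [-> ]].
by move=> h; exists (sigma_block (X w) k).
Qed.

Lemma m_blk_all (K : seq int) (Phi : int -> seq int -> Prop) :
  measurable [set w | forall k, k \in K -> Phi k (sigma_block (X w) k)].
Proof. by apply: m_all => k; apply: m_imp; [exact: m_cst|exact: m_blkP]. Qed.
End MeasBlk.

(** * Joint law of the blocks around the origin *)

Section Law4.
Context (R : realType) (q : R) (hq0 : (0 <= q)%R) (hq1 : (q < 1)%R)
  (d : measure_display) (Omega : measurableType d) (P : probability Omega R)
  (Bp Bm : Omega -> nat -> nat -> bool) (M : Omega -> nat -> nat)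
  (mBp : forall i j, measurable [set w | Bp w i j])
  (mBm : forall i j, measurable [set w | Bm w i j])
  (mM : forall i m, measurable [set w | M w i = m])
  (hlaw : input_law q P Bp Bm M).

Let X := Xw Bp Bm M.
Let gd := good Bp Bm M.
Let mX z v : measurable [set w | X w z = v] := m_Xw mBp mBm mM z v.
Let mg : measurable [set w | gd w] := m_good mBp mBm mM.
Let Pg : P [set w | gd w] = 1 := P_good hq0 hq1 mBp mBm mM hlaw.

Lemma m_arrQ V Q : measurable (arrQ Bp Bm M V Q).
Proof. by apply: m_ex2 => s; [exact: m_cst|exact: (m_evE mBp mBm mM)]. Qed.

Lemma arrQP c l (N : nat) w pos : gd w -> cancel (X w) pos -> cancel pos (X w) ->
  arrQ Bp Bm M (window (c + 1)%R (len l + N)) (chain c l) w <->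
  stepsB pos (Some (c + 1 + (len l)%:Z + N%:Z)%R) c l.
Proof.
move=> gw XK pK; set V := window _ _.
have hV s : perm_eq s V -> forall v, v \in s = (c < v < c + 1 + (len l)%:Z + N%:Z)%R.
  by move=> ps v; rewrite (perm_mem ps) mem_window; lia.
have hB : (c + (len l)%:Z < c + 1 + (len l)%:Z + N%:Z)%R by lia.
split.
  move=> [s]; rewrite mem_filter mem_permutations => /andP[hc ps] /(evEP s gw XK pK) os.
  exact/(chain_steps os (hV s ps) hB).
move=> h; have [s ps os] := ordered_exists (can_inj pK) (uniq_window (c + 1)%R (len l + N)).
exists s; last by apply/(evEP s gw XK pK).
rewrite mem_filter mem_permutations ps andbT.
exact/(chain_steps os (hV s ps) hB).
Qed.

Definition evH (c : int) l : set Omega :=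
  \bigcap_N arrQ Bp Bm M (window (c + 1)%R (len l + N)) (chain c l).

Lemma evH_good c l w : evH c l w -> gd w.
Proof. by move=> /(_ 0%N I) [s _ []]. Qed.

Lemma evHP c l w pos : gd w -> cancel (X w) pos -> cancel pos (X w) ->
  evH c l w <-> stepsB pos None c l.
Proof.
move=> gw XK pK; rewrite (stepsB_all pos c l (c + 1 + (len l)%:Z)%R).
split=> h N; first exact: (proj1 (arrQP c l N gw XK pK) (h N I)).
by move=> _; exact: (proj2 (arrQP c l N gw XK pK) (h N)).
Qed.

Lemma m_evH c l : measurable (evH c l).
Proof. by apply: bigcapT_measurable => N; exact: m_arrQ. Qed.

(** The finite-window events decrease as the window grows upwards; their probabilities are given by
    [arrQ_law] and converge by [cvg_wexp_chain]. *)
Lemma evH_law c l : P (evH c l) = (chainlim q c l)%:E.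
Proof.
pose F N := arrQ Bp Bm M (window (c + 1)%R (len l + N)) (chain c l).
have c1 : P (F N) @[N --> \oo] --> P (evH c l).
  apply: (@nonincreasing_cvg_mu _ _ _ P F).
  - by rewrite (le_lt_trans (probability_le1 _ _)) ?ltry //; exact: m_arrQ.
  - by move=> N; exact: m_arrQ.
  - exact: m_evH.
  move=> n m nm; apply/subsetPset => w h.
  have gw : gd w by case: h => s _ [].
  have [pos [XK pK]] := good_pos gw.
  apply/(arrQP c l n gw XK pK); move/(arrQP c l m gw XK pK): h; apply: stepsB_mono.
  by rewrite lerD2l lez_nat.
have c2 : P (F N) @[N --> \oo] --> (chainlim q c l)%:E.
  have h := cvg_wexp_chain hq0 hq1 (c := c) (l := l).
  rewrite -(cvg_shiftn (len l)) in h.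
  under eq_cvg do rewrite /F (arrQ_law hq0 hq1 mBp mBm mM hlaw) addnC.
  by apply: cvg_EFin => //; exact: nearW.
exact: (cvg_unique _ c1 c2).
Qed.

Section Fam.
Variables (n : int -> nat) (TT : int -> set (set (seq bool))).

Definition ent (k : int) : nat * (seq int -> bool) := (n k, fun x => `[< TT k (BST x) >]).

Definition evB (K : seq int) : set Omega := [set w | forall k, k \in K ->
  size (sigma_block (X w) k) = n k /\ TT k (BST (sigma_block (X w) k))].

Lemma m_evB K : measurable (evB K).
Proof. exact: (m_blk_all mX K (fun k s => size s = n k /\ TT k (BST s))). Qed.

Lemma chainlim_ent c ks : chainlim q c (map ent ks) =
  (\prod_(k <- ks) (q ^+ n k * (1 - q) * prob_bst_in q (n k) (TT k)))%R.
Proof.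
elim: ks c => [|k ks IH] c /=; first by rewrite big_nil.
by rewrite big_cons IH wexp_BST.
Qed.

(** The blocks with indices from [- m] to [m] are prescribed by a chain once the position [- e] of
    the record value of index 0 is known. The disjoint cases [e = 0, ..., n 0] have equal
    probability, and their number is the size-biasing factor. *)
Lemma evB_range_law (m : nat) : P (evB (window (- m%:Z)%R (m + m.+1))) =
  (\prod_(k <- window (- m%:Z)%R (m + m.+1)) (size_law q k (n k) * prob_bst_in q (n k) (TT k)))%:E.
Proof.
set W := window _ _.
have hW : W = window (- m%:Z)%R m ++ 0%R :: window 1%R m.
  by rewrite /W window_cat addNr windowS add0r.
pose l := map ent (window (- m%:Z)%R m); pose l' := map ent (window 1%R m).
have hl : map ent W = l ++ ent 0%R :: l' by rewrite hW map_cat.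
have sl : size l = m by rewrite size_map size_window.
(* From [- e] one goes down by the total length of the blocks on the left, and by one more for the
   initial step with empty gap. *)
pose c (e : nat) : int := (- e%:Z - (len l)%:Z - 1)%R.
pose A (e : nat) := evH (c e) ((0%N, xpredT) :: map ent W).
have -> : P (evB W) = P [set w | exists2 e, e \in iota 0 (n 0%R).+1 & A e w].
  rewrite -(prob1I (m_evB W) mg Pg); congr (P _); apply/seteqP; split => w.
    move=> [hB gw]; have [pos [XK pK]] := good_pos gw.
    have hb : exists p0 : int, forall k : int, (k < p0)%R -> (X w k <= 0)%R by case: (gw) => _ g2 _; exact: X_bounded.
    have : Blk (X w) (- (size l)%:Z)%R (map ent W).
      rewrite sl; apply/(Blk_map (X w) ent) => j /hB [h1 h2]; split => //.
      exact/asboolP.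
    rewrite hl => /(Blk_centered XK pK hb) [e he h]; exists e => //.
    by apply/(evHP _ _ gw XK pK); rewrite hl.
  move=> [e he hA]; have gw := evH_good hA; split => //.
  have [pos [XK pK]] := good_pos gw.
  have hb : exists p0 : int, forall k : int, (k < p0)%R -> (X w k <= 0)%R by case: (gw) => _ g2 _; exact: X_bounded.
  move/(evHP _ _ gw XK pK): hA; rewrite hl => /(steps_centered XK pK hb he) [_].
  rewrite -hl sl => /(Blk_map (X w) ent) h j /h [h1 h2]; split => //.
  exact/asboolP.
rewrite prob_seqU ?iota_uniq //; last 2 first.
- by move=> e; exact: m_evH.
- move=> e e' w he he' hA hA'; have gw := evH_good hA.
  have [pos [XK pK]] := good_pos gw.
  have hb : exists p0 : int, forall k : int, (k < p0)%R -> (X w k <= 0)%R by case: (gw) => _ g2 _; exact: X_bounded.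
  move/(evHP _ _ gw XK pK): hA; rewrite hl => /(steps_centered XK pK hb he) [e1 _].
  move/(evHP _ _ gw XK pK): hA'; rewrite hl => /(steps_centered XK pK hb he') [e2 _].
  by move: e1 e2; move: (aval _ _) => x; lia.
(* The leading factor [1 - q] is the price of a record at the starting value; it supplies the second
   factor [1 - q] of the size-biased law at index 0. *)
have hlim e : P (A e) = ((1 - q) * \prod_(k <- W) (q ^+ n k * (1 - q) * prob_bst_in q (n k) (TT k)))%:E.
  rewrite /A evH_law /= chainlim_ent expr0 mul1r; congr (_%:E).
  by rewrite /wexp -/(wtot q _) divff ?mulr1 // gt_eqF // wtot_gt0.
rewrite (eq_bigr _ (fun e _ => hlim e)) sumEFin big_const_seq count_predT size_iota iter_addr_0.
congr (_%:E).
have uW : uniq W by exact: uniq_window.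
have W0 : 0%R \in W by rewrite hW mem_cat mem_head orbT.
rewrite (bigD1_seq 0%R) //= [in RHS](bigD1_seq 0%R) //=.
rewrite (eq_bigr (fun k => q ^+ n k * (1 - q) * prob_bst_in q (n k) (TT k))%R (P := fun k => k != 0%R)
  (F1 := fun k => size_law q k (n k) * prob_bst_in q (n k) (TT k))%R); last first.
  by move=> k k0; rewrite /size_law (negbTE k0) /geom0 (_ : 1 - (1 - q) = q)%R //; ring.
rewrite /size_law eqxx /sbgeom (_ : 1 - (1 - q) = q)%R; last by ring.
by rewrite -mulr_natr; ring.
Qed.
End Fam.
End Law4.

(** * Words and components of the redwood tree *)

Lemma set_size_fun (T : eqType) (S : set T) n n' : set_size S n -> set_size S n' -> n = n'.
Proof.
move=> [s [us <- e]] [s' [us' <- e']]; apply: perm_size; apply: uniq_perm => // x.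
have : [set x | x \in s] = [set x | x \in s'] by rewrite -e -e'.
by move=> /seteqP [h1 h2]; apply/idP/idP => [/h1|/h2].
Qed.

Lemma emb_inj : injective emb.
Proof. by apply: inj_map => x y []. Qed.

Lemma prefixS_inj a : injective (prefixS a).
Proof.
move=> S S' /seteqP [h1 h2]; apply/seteqP; split => u Su.
  have [|v Sv] := h1 (a ++ emb u); first by exists u.
  by move=> /eqP; rewrite eqseq_cat // eqxx /= => /eqP /emb_inj <-.
have [|v Sv] := h2 (a ++ emb u); first by exists u.
by move=> /eqP; rewrite eqseq_cat // eqxx /= => /eqP /emb_inj <-.
Qed.

Lemma set_size_prefixS a S n : set_size S n -> set_size (prefixS a S) n.
Proof.
move=> [s [us <- ->]]; exists [seq a ++ emb u | u <- s]; split.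
- rewrite map_inj_uniq // => u v /eqP; rewrite eqseq_cat // eqxx /= => /eqP; exact: emb_inj.
- by rewrite size_map.
apply/seteqP; split => x /=.
  by move=> [u us' <-]; apply: map_f.
by move=> /mapP[u us' ->]; exists u.
Qed.

Lemma onepow_notin k : Some false \notin onepow k.
Proof. by case: k => n; rewrite mem_nseq andbF. Qed.

Lemma onepow_inj : injective onepow.
Proof.
move=> [n|n] [m|m] /= e.
- by have := congr1 size e; rewrite !size_nseq => ->.
- by case: n e.
- by case: m e.
- by have := congr1 size e; rewrite /= !size_nseq => -[->].
Qed.

Definition root0 (k : int) : word := rcons (onepow k) (Some false).

(** The letter 0 does not occur in [onepow j], so the first 0 of a word marks the end of its spine;
    components of different indices are therefore disjoint. *)
Lemma root0_cat_inj j k u v : root0 j ++ u = root0 k ++ v -> j = k /\ u = v.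
Proof.
rewrite /root0 !cat_rcons => e.
have hz i s : index (Some false) (onepow i ++ Some false :: s) = size (onepow i).
  by rewrite index_cat (negbTE (onepow_notin i)) /= addn0.
have sz : size (onepow j) = size (onepow k) by rewrite -(hz j u) e hz.
move: e => /eqP; rewrite eqseq_cat // => /andP[/eqP /onepow_inj -> /eqP[->]].
by [].
Qed.

Lemma Ycomp_RW sg k : Ycomp (RW sg) k = prefixS (root0 k) (BST (sigma_block sg k)).
Proof.
apply/seteqP; split => x.
  move=> [[j _ [->|[u hu <-]]] [v _]].
    move=> e; have := onepow_notin j; rewrite -e mem_cat mem_rcons mem_head //.
  by move=> /root0_cat_inj [e _]; rewrite -e in hu *; exists u.
move=> [u hu <-]; split; last by exists u.
by exists k => //; right; exists u.
Qed.

Lemma RW_bigcup sg : RW sg = \bigcup_(k in [set: int]) ([set onepow k] `|` Ycomp (RW sg) k).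
Proof. by apply: eq_bigcupr => k _; rewrite Ycomp_RW. Qed.

Lemma size_law_ge0 (R : realType) (q : R) k n : (0 <= q)%R -> (q < 1)%R -> (0 <= size_law q k n)%R.
Proof.
move=> q0 q1; have h1 : (0 <= 1 - q)%R by rewrite subr_ge0 ltW.
have h2 : (0 <= 1 - (1 - q))%R by rewrite opprB addrC subrK.
by rewrite /size_law /sbgeom /geom0; case: ifP => _; rewrite !mulr_ge0 ?exprn_ge0.
Qed.

(** * Finite-dimensional laws of the sizes and of the trees *)

Section Law5.
Context (R : realType) (q : R) (hq0 : (0 <= q)%R) (hq1 : (q < 1)%R)
  (d : measure_display) (Omega : measurableType d) (P : probability Omega R)
  (Bp Bm : Omega -> nat -> nat -> bool) (M : Omega -> nat -> nat)
  (mBp : forall i j, measurable [set w | Bp w i j])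
  (mBm : forall i j, measurable [set w | Bm w i j])
  (mM : forall i m, measurable [set w | M w i = m])
  (hlaw : input_law q P Bp Bm M).

Let X := Xw Bp Bm M.
Let gd := good Bp Bm M.
Let mX z v : measurable [set w | X w z = v] := m_Xw mBp mBm mM z v.
Let mg : measurable [set w | gd w] := m_good mBp mBm mM.
Let Pg : P [set w | gd w] = 1 := P_good hq0 hq1 mBp mBm mM hlaw.
Let evB' := evB Bp Bm M.

(** At index 0 the weights are, by [evB_range_law] with m = 0, the distribution of the size of an
    actual block, so no series has to be computed; at the other indices the geometric series is
    summed. *)
Lemma size_law_sum k : \sum_(0 <= j <oo) (size_law q k j)%:E = 1.
Proof.
case: (eqVneq k 0%R) => [->|k0].
  have := @prob_partition _ _ _ P setT (fun w => size (sigma_block (X w) 0%R)) measurableT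
    (fun j => m_blkP mX 0%R (fun s => size s = j)).
  rewrite probability_setT => ->; apply: eq_eseriesr => j _.
  have := evB_range_law hq0 hq1 mBp mBm mM hlaw (fun=> j) (fun=> setT) 0.
  rewrite big_seq1 oppr0 addr0 prob_bst_inT // mulr1 => <-.
  congr (P _); apply/seteqP; split => w /=.
    by move=> /(_ 0%R); rewrite inE eqxx => /(_ isT) [].
  by move=> [_ h] k'; rewrite inE => /eqP ->.
apply: nneseries_EFin; have := @cvg_geometric_series R (1 - q)%R q.
rewrite ger0_norm // => /(_ hq1); rewrite divff; last by rewrite subr_eq0 gt_eqF.
apply: cvg_trans; apply: near_eq_cvg; apply: nearW => N.
apply: eq_bigr => j _; rewrite /size_law (negbTE k0) /geom0 /geometric /= mulrC.
by congr (_ ^+ _ * _)%R; ring.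
Qed.

Definition wB (n : int -> nat) (TT : int -> set (set (seq bool))) (k : int) : R :=
  (size_law q k (n k) * prob_bst_in q (n k) (TT k))%R.

(** Leaving the tree of [e] free and summing over its size removes the block [e] from the product
    formula. *)
Lemma evB_free e K : e \notin K ->
  (forall n TT, P (evB' n TT (e :: K)) = (\prod_(k <- e :: K) wB n TT k)%:E) ->
  forall n TT, P (evB' n TT K) = (\prod_(k <- K) wB n TT k)%:E.
Proof.
move=> eK h n TT.
rewrite (prob_partition P (m_evB mBp mBm mM n TT K) (fun j => m_blkP mX e (fun s => size s = j))).
have hn j : P (evB' n TT K `&` [set w | size (sigma_block (X w) e) = j]) =
    (\prod_(k <- K) wB n TT k)%:E * (size_law q e j)%:E.
  pose n' k := if k == e then j else n k.
  pose TT' k := if k == e then setT else TT k.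
  have e0 : evB' n TT K `&` [set w | size (sigma_block (X w) e) = j] = evB' n' TT' (e :: K).
    apply/seteqP; split => w.
      move=> [h1 h2] k; rewrite in_cons /n' /TT'; case: eqVneq => [->//|_] /= hk; exact: h1.
    move=> h1; split; last by have [] := h1 e (mem_head _ _); rewrite /n' eqxx.
    move=> k hk; have := h1 k; rewrite in_cons hk orbT /n' /TT' => /(_ isT).
    by case: eqVneq hk eK => // -> ->.
  rewrite e0 h big_cons {1}/wB /n' /TT' eqxx prob_bst_inT // mulr1 -EFinM mulrC; congr (_ * _)%:E.
  by apply: eq_big_seq => k hk; rewrite /wB; case: eqVneq hk eK => // -> ->.
rewrite (eq_eseriesr (fun j _ => hn j)) nneseriesZl; last by move=> j _; rewrite lee_fin size_law_ge0.
by rewrite size_law_sum mule1.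
Qed.

Lemma evB_law K n TT : uniq K -> P (evB' n TT K) = (\prod_(k <- K) wB n TT k)%:E.
Proof.
move=> uK.
have [m hm] : exists m : nat, {subset K <= window (- m%:Z)%R (m + m.+1)}.
  elim: K {uK} => [|k K [m IH]]; first by exists 0%N.
  exists (maxn m (absz k)) => j; rewrite in_cons mem_window => /orP[/eqP ->|/IH]; last rewrite mem_window; lia.
pose ds := [seq k <- window (- m%:Z)%R (m + m.+1) | k \notin K].
have uds : uniq (ds ++ K).
  rewrite cat_uniq filter_uniq ?uniq_window // uK andbT /=; apply/hasPn => c hc.
  by rewrite mem_filter hc.
have pds : perm_eq (window (- m%:Z)%R (m + m.+1)) (ds ++ K).
  apply: uniq_perm => //; first exact: uniq_window.
  move=> c; rewrite mem_cat mem_filter; case: (boolP (c \in K)) => [/hm ->|_] //=.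
  by rewrite orbF.
have base n' TT' : P (evB' n' TT' (ds ++ K)) = (\prod_(k <- ds ++ K) wB n' TT' k)%:E.
  rewrite -(perm_big _ pds) /= -(evB_range_law hq0 hq1 mBp mBm mM hlaw).
  congr (P _); apply/seteqP; split => w h c hc; apply: h.
    by rewrite -(perm_mem pds).
  by rewrite (perm_mem pds).
elim: ds uds base {pds} n TT => [|k ds IH] /=; first by [].
move=> /andP[kN u] base; apply: IH => //.
by apply: (evB_free kN).
Qed.

Let Y := fun w => Yq (Bp w) (Bm w) (M w).

Lemma YE w k : Ycomp (Y w) k = prefixS (root0 k) (BST (sigma_block (X w) k)).
Proof. exact: Ycomp_RW. Qed.

Lemma good_blk_uniq w k : gd w -> uniq (sigma_block (X w) k).
Proof.
move=> gw; have [pos [XK pK]] := good_pos gw; apply: (blk_uniq XK pK).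
by case: gw => _ g2 _; exact: X_bounded.
Qed.

Lemma good_size w k n : gd w -> set_size (Ycomp (Y w) k) n <-> size (sigma_block (X w) k) = n.
Proof.
move=> gw; rewrite YE; have [s [us es sz]] := BST_finite (sigma_block (X w) k).
have h : set_size (prefixS (root0 k) (BST (sigma_block (X w) k))) (size (sigma_block (X w) k)).
  by apply: set_size_prefixS; exists s; split => //; apply: sz; exact: good_blk_uniq.
by split=> [/set_size_fun /(_ h)|<-].
Qed.

Lemma Y_size_law : redwood_size_law q P Y.
Proof.
move=> K n uK; have mS : measurable [set w | forall k, k \in K -> set_size (Ycomp (Y w) k) (n k)].
  apply: m_ext (m_blk_all mX K (fun k s => set_size (prefixS (root0 k) (BST s)) (n k))) => w.
  by split=> h k /h; rewrite YE.
transitivity (P (evB' n (fun=> setT) K)).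
  rewrite -(prob1I mS mg Pg) -(prob1I (m_evB mBp mBm mM n (fun=> setT) K) mg Pg).
  congr (P _); apply/seteqP; split => w [h gw]; split => // k hk.
    by split => //; apply/(good_size k (n k) gw); exact: h.
  by apply/(good_size k (n k) gw); case: (h k hk).
rewrite evB_law //; congr (_%:E); apply: eq_bigr => k _.
by rewrite /wB prob_bst_inT // mulr1.
Qed.

Lemma Y_tree_law : redwood_tree_law q P Y.
Proof.
move=> K n t uK ht.
have mS : measurable [set w | forall k, k \in K -> Ycomp (Y w) k = prefixS (root0 k) (t k)].
  apply: m_ext (m_blk_all mX K (fun k s => prefixS (root0 k) (BST s) = prefixS (root0 k) (t k))) => w.
  by split=> h k /h; rewrite YE.
transitivity (P (evB' n (fun k => [set t k]) K)).
  rewrite -(prob1I mS mg Pg) -(prob1I (m_evB mBp mBm mM n (fun k => [set t k]) K) mg Pg).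
  congr (P _); apply/seteqP; split => w [h gw]; split => // k hk.
    have := h k hk; rewrite YE => /prefixS_inj e; split => //.
    apply/(good_size k (n k) gw); rewrite YE e; apply: set_size_prefixS.
    by case: (ht k hk).
  by have [_ e] := h k hk; rewrite YE (e : BST (sigma_block (X w) k) = t k).
rewrite evB_law // Y_size_law // -EFinM -big_split /=; congr (_%:E).
Qed.

(** * The converse *)

Section Converse.
Context (d' : measure_display) (Omega' : measurableType d') (P' : probability Omega' R)
  (Y' : Omega' -> set word).
Hypotheses (hY' : forall w, Y' w = \bigcup_(k in [set: int]) ([set onepow k] `|` Ycomp (Y' w) k))
  (mY' : forall x : word, measurable [set w | Y' w x])
  (sY' : redwood_size_law q P' Y') (tY' : redwood_tree_law q P' Y').
Variables (F : seq word) (S : set word).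

(** A word in the component of index k has at least |k| letters, so the words of [F] meet only the
    components with index in [K]. *)
Let m := (\sum_(x <- F) size x)%N.
Let K := window (- m%:Z)%R (m + m.+1).
(* Codes of families (t_k)_{k in K} of finite trees; canon selects one code per family. *)
Let code := seq (seq (seq bool)).
Let tr (c : code) (k : int) : set (seq bool) := [set x | x \in nth [::] c (index k K)].
Let bin (c : code) := forall k, k \in K -> binary_tree (tr c k).
Let same (c c' : code) := forall k, k \in K -> tr c k = tr c' k.
Let canon (c : code) := forall c', same c c' -> (pickle c <= pickle c')%N.
Let A (Om : Type) (Z : Om -> set word) (c : code) : set Om :=
  [set w | forall k, k \in K -> Ycomp (Z w) k = prefixS (root0 k) (tr c k)].
(** Indexing by the pickled code turns the possible families into a sequence of events, and
    canonical codes make these events disjoint. *)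
Let B (Om : Type) (Z : Om -> set word) (i : nat) : set Om :=
  [set w | exists c : code, [/\ pickle c = i, bin c, canon c & A Z c w]].

Lemma code_law c : bin c -> P' (A Y' c) = P (A Y c).
Proof.
move=> hc; pose n k := size (undup (nth [::] c (index k K))).
have hn k : k \in K -> binary_tree (tr c k) /\ set_size (tr c k) (n k).
  move=> kK; split; first exact: hc.
  exists (undup (nth [::] c (index k K))); split => //; first exact: undup_uniq.
  by apply/seteqP; split => x /=; rewrite mem_undup.
have uK : uniq K by exact: uniq_window.
by rewrite (tY' uK hn) (Y_tree_law uK hn) (sY' n uK) (Y_size_law n uK).
Qed.

Lemma B_triv (Om : Type) (Z : Om -> set word) : trivIset setT (B Z).
Proof.
apply/trivIsetP => i j _ _ ij; apply/seteqP; split => // w [[c [e _ hc h]] [c' [e' _ hc' h']]].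
suff : pickle c = pickle c' by rewrite e e'; move/eqP: ij.
have s k : k \in K -> tr c k = tr c' k.
  by move=> kK; apply: (@prefixS_inj (root0 k)); rewrite -h // h'.
by apply/eqP; rewrite eqn_leq hc ?hc' // => k /s.
Qed.

Lemma B_cover w : exists i, B Y i w.
Proof.
have hex (k : int) : exists s : seq (seq bool), BST (sigma_block (X w) k) = [set x | x \in s].
  by have [s [_ e _]] := BST_finite (sigma_block (X w) k); exists s.
have [g hg] := choice hex.
pose c0 : code := map g K.
have h0 k : k \in K -> tr c0 k = BST (sigma_block (X w) k).
  move=> kK; rewrite hg /tr (nth_map 0%R) ?index_mem // nth_index //.
have ex : exists i, `[< exists2 c : code, pickle c = i & same c0 c >] by exists (pickle c0); apply/asboolP; exists c0.
case: (ex_minnP ex) => i /asboolP [c ci sc] hmin.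
exists i, c; split => //.
- by move=> k kK; rewrite -sc // h0 //; exact: BST_prefix.
- move=> c' sc'; rewrite ci; apply: hmin; apply/asboolP; exists c' => // k kK.
  by rewrite sc // sc'.
- by move=> k kK; rewrite YE -sc // h0.
Qed.

Lemma dom_K (Z : set word) x k : x \in F -> Ycomp Z k x -> k \in K.
Proof.
move=> xF [_ [u _ e]]; have hs : (size x <= m)%N by rewrite /m (big_rem x) //= leq_addr.
have : (absz k <= size x)%N.
  rewrite -e size_cat size_rcons; case: k {e} => j /=; rewrite size_nseq; lia.
by rewrite mem_window; lia.
Qed.

(** Whether the trace on [F] equals [S] is a property of the code alone, the spine words [onepow k]
    being always present. *)
Let phi (c : code) : Prop :=
  [set x | x \in F /\ ((exists k, x = onepow k) \/ exists2 k, k \in K & prefixS (root0 k) (tr c k) x)] = S.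

Lemma phiP (Z : set word) c : Z = \bigcup_(k in [set: int]) ([set onepow k] `|` Ycomp Z k) ->
  (forall k, k \in K -> Ycomp Z k = prefixS (root0 k) (tr c k)) ->
  (Z `&` [set x | x \in F] = S) <-> phi c.
Proof.
move=> hZ hc; suff -> : Z `&` [set x | x \in F] = [set x | x \in F /\
  ((exists k, x = onepow k) \/ exists2 k, k \in K & prefixS (root0 k) (tr c k) x)] by [].
apply/seteqP; split => x.
  move=> [Zx xF]; split => //; move: (Zx); rewrite {1}hZ => -[k _ [->|h]]; first by left; exists k.
  by right; have kK := dom_K xF h; exists k => //; rewrite -hc.
move=> [xF h]; split => //; rewrite hZ; case: h => [[k ->]|[k kK h]]; exists k => //; first by left.
by right; rewrite hc.
Qed.

Lemma m_A' c : measurable (A Y' c).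
Proof.
apply: m_all => k; apply: m_imp; first exact: m_cst.
apply: m_ext (m_all (fun x : word => m_iff (m_and (mY' x) (m_cst _ (subtree_dom k x)))
  (m_cst _ (prefixS (root0 k) (tr c k) x)))) => w; split.
  by move=> h; apply/seteqP; split => x /h.
by move=> <-.
Qed.

Lemma m_A c : measurable (A Y c).
Proof.
apply: m_ext (m_blk_all mX K (fun k s => prefixS (root0 k) (BST s) = prefixS (root0 k) (tr c k))) => w.
by split=> h k /h; rewrite YE.
Qed.

Lemma BE (Om : Type) (Z : Om -> set word) (i : nat) :
  (exists2 c : code, (bin c /\ canon c) /\ pickle c = i & B Z i = A Z c) \/
  (~ (exists2 c : code, bin c /\ canon c & pickle c = i) /\ B Z i = set0).
Proof.
case: (pselect (exists2 c : code, bin c /\ canon c & pickle c = i)) => [[c [bc cc] ci]|h].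
  left; exists c => //; apply/seteqP; split => w; last by exists c.
  move=> [c' [e' _ _]]; suff -> : c' = c by [].
  by apply: (pcan_inj pickleK); rewrite e' ci.
right; split => //; apply/seteqP; split => // w [c [ci bc cc _]]; apply: h; by exists c.
Qed.

Lemma B_law i : P' (B Y' i) = P (B Y i).
Proof.
case: (BE Y i) => [[c [[bc cc] ci] ->]|[hN ->]].
  case: (BE Y' i) => [[c' [_ ci'] ->]|[hN _]]; last by exfalso; apply: hN; exists c.
  have -> : c' = c by apply: (pcan_inj pickleK); rewrite ci' ci.
  exact: code_law.
case: (BE Y' i) => [[c' [bc ci'] _]|[_ ->]]; last by rewrite !measure0.
by exfalso; apply: hN; exists c'.
Qed.

Lemma m_B i : measurable (B Y i).
Proof. by case: (BE Y i) => [[c _ ->]|[_ ->]]; [exact: m_A|exact: measurable0]. Qed.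

Lemma m_B' i : measurable (B Y' i).
Proof. by case: (BE Y' i) => [[c _ ->]|[_ ->]]; [exact: m_A'|exact: measurable0]. Qed.

(** Split according to the family of trees with indices in [K]. Each family has the same probability
    for [Y'] as for [Y] ([code_law]), and each decides whether the trace on [F] is [S]. *)
Lemma converse_law :
  P' [set w | Y' w `&` [set x | x \in F] = S] = P [set w | Y w `&` [set x | x \in F] = S].
Proof.
set E' := [set w | Y' w `&` _ = S]; set E := [set w | Y w `&` _ = S].
have hI i : E `&` B Y i = [set w | B Y i w /\ forall c, pickle c = i -> phi c].
  apply/seteqP; split => w.
    move=> [hE [c [ci bc cc hA]]]; split; first by exists c.
    move=> c' ci'; have -> : c' = c by apply: (pcan_inj pickleK); rewrite ci' ci.
    exact: (proj1 (phiP (RW_bigcup _) hA) hE).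
  move=> [[c [ci bc cc hA]] h]; split; last by exists c.
  exact: (proj2 (phiP (RW_bigcup _) hA) (h c ci)).
have hI' i : E' `&` B Y' i = [set w | B Y' i w /\ forall c, pickle c = i -> phi c].
  apply/seteqP; split => w.
    move=> [hE [c [ci bc cc hA]]]; split; first by exists c.
    move=> c' ci'; have -> : c' = c by apply: (pcan_inj pickleK); rewrite ci' ci.
    exact: (proj1 (phiP (hY' w) hA) hE).
  move=> [[c [ci bc cc hA]] h]; split; last by exists c.
  exact: (proj2 (phiP (hY' w) hA) (h c ci)).
have mEB i : measurable (E `&` B Y i) by rewrite hI; apply: m_and; [exact: m_B|exact: m_cst].
have mEB' i : measurable (E' `&` B Y' i) by rewrite hI'; apply: m_and; [exact: m_B'|exact: m_cst].
have eq i : P' (E' `&` B Y' i) = P (E `&` B Y i).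
  rewrite hI hI'; case: (pselect (forall c : code, pickle c = i -> phi c)) => hp.
    have -> : [set w | B Y i w /\ (forall c, pickle c = i -> phi c)] = B Y i by apply/seteqP; split => w // [].
    have -> : [set w | B Y' i w /\ (forall c, pickle c = i -> phi c)] = B Y' i by apply/seteqP; split => w // [].
    exact: B_law.
  have -> : [set w | B Y i w /\ (forall c, pickle c = i -> phi c)] = set0 by apply/seteqP; split => w // [].
  have -> : [set w | B Y' i w /\ (forall c, pickle c = i -> phi c)] = set0 by apply/seteqP; split => w // [].
  by rewrite !measure0.
have UB : \bigcup_i B Y i = setT.
  by apply/seteqP; split => // w _; have [i hi] := B_cover w; exists i.
have mUB' : measurable (\bigcup_i B Y' i) by apply: bigcupT_measurable; exact: m_B'.
(* That the relevant components of [Y'] are almost surely finite binary trees is deduced here: the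
   events have the same total mass as for [Y], for which they cover the whole space. *)
have PUB' : P' (\bigcup_i B Y' i) = 1.
  rewrite measure_semi_bigcup //; [|exact: m_B'|exact: B_triv].
  rewrite (eq_eseriesr (fun i _ => B_law i)).
  transitivity (P (\bigcup_i B Y i)); last by rewrite UB probability_setT.
  apply: esym; apply: measure_semi_bigcup; [exact: m_B|exact: B_triv|].
  by rewrite UB; exact: measurableT.
have mE' : measurable E'.
  apply: m_ext (m_all (fun x : word => m_iff (m_and (mY' x) (m_cst _ (x \in F))) (m_cst _ (S x)))) => w; split.
    by move=> h; apply/seteqP; split => x /h.
  by move=> <-.
rewrite -(prob1I mE' mUB' PUB') -[in RHS](setIT E) -UB !setI_bigcupr.
rewrite !measure_semi_bigcup //.
- by apply: eq_eseriesr => i _; exact: eq.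
- by apply: trivIset_setIl; exact: B_triv.
- exact: bigcupT_measurable.
- by apply: trivIset_setIl; exact: B_triv.
- exact: bigcupT_measurable.
Qed.
End Converse.
End Law5.

Local Close Scope ereal_scope.
Theorem theorem1p2 (R : realType) (q : R) (hq0 : 0 <= q) (hq1 : q < 1)
  (d : measure_display) (Omega : measurableType d) (P : probability Omega R)
  (Bp Bm : Omega -> nat -> nat -> bool) (M : Omega -> nat -> nat)
  (mBp : forall i j, measurable [set w | Bp w i j])
  (mBm : forall i j, measurable [set w | Bm w i j])
  (mM : forall i m, measurable [set w | M w i = m])
  (hlaw : input_law q P Bp Bm M) :
  let Y := fun w => Yq (Bp w) (Bm w) (M w) in
  [/\ redwood_size_law q P Y,
      redwood_tree_law q P Y &
      (* converse: these properties characterize the law of Y_q *)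
      forall (d' : measure_display) (Omega' : measurableType d')
             (P' : probability Omega' R) (Y' : Omega' -> set word),
        (forall w, Y' w = \bigcup_(k in [set: int])
                            ([set onepow k] `|` Ycomp (Y' w) k)) ->
        (forall x : word, measurable [set w | Y' w x]) ->
        redwood_size_law q P' Y' -> redwood_tree_law q P' Y' ->
        forall (F : seq word) (S : set word),
          P' [set w | Y' w `&` [set x | x \in F] = S] =
          P [set w | Y w `&` [set x | x \in F] = S]].
Proof.
move=> Y; split.
- exact: (Y_size_law hq0 hq1 mBp mBm mM hlaw).
- exact: (Y_tree_law hq0 hq1 mBp mBm mM hlaw).
move=> d' Omega' P' Y' hY' mY' sY' tY' F S.
exact: (converse_law hq0 hq1 mBp mBm mM hlaw hY' mY' sY' tY').
Qed.
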